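(* Let $p\ge0$ and $q\ge1$ be integers, let $\Omega_0$ be a domain in $\mathbb{R}^{p+1}$ and let $f_0:\Omega_0\to\mathbb{R}_{p+q}$ be a real analytic function. Then there is a p-symmetric slice domain $\Omega\subseteq\Omega_0^{\ast}$ with $\Omega_0\subset\Omega$, on which the slice CK-extension $f=CK[f_0]$ is defined, such that $$GCK[f_0](\boldsymbol{x})=\frac{1}{A_q}\int_{\mathbb{S}}CK[f_0,\underline{\eta}](\boldsymbol{x})\,dS(\underline{\eta})=\check{R}[f](\boldsymbol{x}),\qquad \boldsymbol{x}\in\Omega .$$ That is, $GCK=\check{R}\circ CK$, where $CK[f_0]\in\mathcal{GSM}(\Omega)$ and $\check R[CK[f_0]]\in\mathcal{AM}(\Omega)$.
   Context: $\mathbb{R}_{p+q}$ is the real Clifford algebra generated by $e_1,\dots,e_{p+q}$ with $e_ie_j+e_je_i=-2\delta_{ij}$; $e_0=1$. A point of $\mathbb{R}^{p+q+1}$ is identified with the paravector $\boldsymbol{x}=\boldsymbol{x}_p+\underline{\boldsymbol{x}}_q$, $\boldsymbol{x}_p=\sum_{i=0}^p x_ie_i\in\mathbb{R}^{p+1}$, $\underline{\boldsymbol{x}}_q=\sum_{i=p+1}^{p+q}x_ie_i\in\mathbb{R}^q$; a function value is also written $f(\boldsymbol{x})=f(\boldsymbol{x}_p,\underline{\boldsymbol{x}}_q)$. $\mathbb{S}$ is the unit sphere of $\mathbb{R}^q$, $dS$ its area element, $A_q$ its area, and $\langle\cdot,\cdot\rangle$ the scalar product of $\mathbb{R}^q$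 (for $q=1$, $\mathbb{S}$ is two points with counting measure). $\underline{\boldsymbol{x}}_q=r\underline{\omega}$ with $r=|\underline{\boldsymbol{x}}_q|$, $\underline{\omega}\in\mathbb{S}$. Operators (acting from the left): $D_{\boldsymbol{x}_p}=\sum_{i=0}^p e_i\partial_{x_i}$, $D_{\boldsymbol{x}}=\sum_{i=0}^{p+q}e_i\partial_{x_i}$; $\Delta_{\boldsymbol{x}_p}=\sum_{i=0}^p\partial_{x_i}^2$. Monogenic means $C^1$ with $D_{\boldsymbol{x}}f=0$. $\Omega_0^{\ast}=\{\boldsymbol{x}_p+\underline{\boldsymbol{x}}_q:\boldsymbol{x}_p\in\Omega_0,\ \underline{\boldsymbol{x}}_q\in\mathbb{R}^q\}$. For a domain $\Omega\subseteq\mathbb{R}^{p+q+1}$, $\Omega_{\underline{\omega}}=\Omega\cap(\mathbb{R}^{p+1}\oplus\underline{\omega}\mathbb{R})$. $\Omega$ is a slice domain if $\Omega\cap\mathbb{R}^{p+1}\ne\emptyset$ and each $\Omega_{\underline{\omega}}$ is a domain in $\mathbb{R}^{p+2}$; p-symmetric if $\boldsymbol{x}_p+r\underline{\omega}\in\Omega$ ($r>0$) implies $\boldsymbol{x}_p+r\underline{\eta}\in\Omega$ for all $\underline{\eta}\in\mathbb{S}$. $\mathcal{GSM}(\Omega)$ is the set of $f:\Omega\to\mathbb{R}_{p+q}$ whose restriction to every $\Omega_{\underline{\omega}}$ has continuous partial derivatives and satisfies $(D_{\boldsymbol{x}_p}+\underline{\omega}\partial_r)f(\boldsymbol{x}_p+r\underline{\omega})=0$.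 $\mathcal{AM}(\Omega)$ is the set of monogenic functions on $\Omega$ of the form $f(\boldsymbol{x}_p+r\underline{\omega})=F_1(\boldsymbol{x}_p,r)+\underline{\omega}F_2(\boldsymbol{x}_p,r)$ with $F_1$ even and $F_2$ odd in $r$. Slice CK-extension: $CK[f_0](\boldsymbol{x})=\sum_{k\ge0}\frac{1}{k!}(\underline{\boldsymbol{x}}_qD_{\boldsymbol{x}_p})^kf_0(\boldsymbol{x}_p)$, the generalized partial-slice monogenic extension of $f_0$. CK-extension in a fixed direction $\underline{\eta}\in\mathbb{S}$: $CK[f_0,\underline{\eta}](\boldsymbol{x})=\sum_{k\ge0}\frac{\langle\underline{\eta},\underline{\boldsymbol{x}}_q\rangle^k}{k!}(\underline{\eta}D_{\boldsymbol{x}_p})^kf_0(\boldsymbol{x}_p)$. Generalized CK-extension: $GCK[f_0]$ is the monogenic sum $\sum_{k\ge0}\underline{\boldsymbol{x}}_q^kf_k(\boldsymbol{x}_p)$ for the unique sequence of real analytic functions $f_k$ ($k\ge1$) making this sum converge and be monogenic in a p-symmetric slice domain containing $\Omega_0$; explicitly $$GCK[f_0](\boldsymbol{x})=\sum_{k\ge0}\frac{\Gamma(\frac q2)(-1)^kr^{2k}}{2^{2k}k!\,\Gamma(k+\frac q2)}\Delta_{\boldsymbol{x}_p}^kf_0(\boldsymbol{x}_p)+\underline{\boldsymbol{x}}_qD_{\boldsymbol{x}_p}\sum_{k\ge0}\frac{\Gamma(\frac q2)(-1)^kr^{2k}}{2^{2k+1}k!\,\Gamma(k+\frac q2+1)}\Delta_{\boldsymbol{x}_p}^kf_0(\boldsymbol{x}_p).$$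 Dual Radon transform of a continuous function $f$: $\check{R}[f](\boldsymbol{x}_p,\underline{\boldsymbol{x}}_q)=\frac{1}{A_q}\int_{\mathbb{S}}f(\boldsymbol{x}_p,\langle\underline{\boldsymbol{x}}_q,\underline{\eta}\rangle\underline{\eta})\,dS(\underline{\eta})$. *)

(* Defs.v *)
From HB Require Import structures.
From mathcomp Require Import all_boot all_order all_algebra.
From mathcomp Require Import all_classical all_reals all_analysis.
From mathcomp Require Import measurable_realfun.
From mathcomp.analysis.showcase Require summability.

Set Implicit Arguments.
Unset Strict Implicit.
Unset Printing Implicit Defensive.

Import Order.TTheory GRing.Theory Num.Theory.
Import numFieldNormedType.Exports.

Local Open Scope ring_scope.

(* The real Clifford algebra with n generators, as coordinate vectors in the
   basis of blades e_A = e_(a1) ... e_(ak), A = {a1 < ... < ak}. The topology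
   is the one of the finite-dimensional coordinate space. *)
Definition clifford (R : realType) (n : nat) : Type := 'rV[R]_#|{set 'I_n}|.

Section clifford.
Variables (R : realType) (n : nat).
Local Notation Cl := (clifford R n).
Implicit Types (A B C : {set 'I_n}) (x y z : Cl).

HB.instance Definition _ := NormedModule.on Cl.
HB.instance Definition _ := Complete.on Cl.

Definition cl_coef (x : Cl) (A : {set 'I_n}) : R := x ord0 (enum_rank A).

Definition cl_blade (A : {set 'I_n}) : Cl := delta_mx ord0 (enum_rank A).

Definition symdiff (A B : {set 'I_n}) : {set 'I_n} := (A :\: B) :|: (B :\: A).

(* e_A e_B = cl_sign A B *: e_(symdiff A B): one factor -1 for each
   transposition (a > b) and one for each square (a = b, e_a ^+ 2 = -1). *)
Definition cl_sign (A B : {set 'I_n}) : R :=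
  \prod_(a in A) \prod_(b in B | (b <= a)%N) -1.

Definition cl_mul (x y : Cl) : Cl :=
  \sum_A \sum_B
    (cl_coef x A * cl_coef y B * cl_sign A B) *: cl_blade (symdiff A B).

Lemma cl_coefD x y A : cl_coef (x + y) A = cl_coef x A + cl_coef y A.
Proof. exact: mxE. Qed.

Lemma cl_coefZ a x A : cl_coef (a *: x) A = a * cl_coef x A.
Proof. exact: mxE. Qed.

Lemma cl_coef_blade A B : cl_coef (cl_blade A) B = (B == A)%:R.
Proof. by rewrite /cl_coef mxE eqxx (inj_eq enum_rank_inj). Qed.

Lemma cl_basis x : x = \sum_A cl_coef x A *: cl_blade A.
Proof.
rewrite [LHS]row_sum_delta (reindex (@enum_rank {set 'I_n})) //=.
exact/onW_bij/enum_rank_bij.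
Qed.

Lemma cl_mulDl : left_distributive cl_mul +%R.
Proof.
move=> x y z; rewrite /cl_mul -big_split; apply: eq_bigr => A _ /=.
rewrite -big_split; apply: eq_bigr => B _ /=.
by rewrite cl_coefD !mulrDl scalerDl.
Qed.

Lemma cl_mulDr : right_distributive cl_mul +%R.
Proof.
move=> x y z; rewrite /cl_mul -big_split; apply: eq_bigr => A _ /=.
rewrite -big_split; apply: eq_bigr => B _ /=.
by rewrite cl_coefD mulrDr !mulrDl scalerDl.
Qed.

Lemma cl_scalerAl a x y : a *: cl_mul x y = cl_mul (a *: x) y.
Proof.
rewrite /cl_mul scaler_sumr; apply: eq_bigr => A _.
rewrite scaler_sumr; apply: eq_bigr => B _.
by rewrite cl_coefZ scalerA !mulrA.
Qed.

Lemma cl_scalerAr a x y : a *: cl_mul x y = cl_mul x (a *: y).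
Proof.
rewrite /cl_mul scaler_sumr; apply: eq_bigr => A _.
rewrite scaler_sumr; apply: eq_bigr => B _.
by rewrite cl_coefZ scalerA !mulrA [a * _]mulrC.
Qed.

Lemma cl_mul_blade A B :
  cl_mul (cl_blade A) (cl_blade B) = cl_sign A B *: cl_blade (symdiff A B).
Proof.
rewrite /cl_mul (bigD1 A)//= [X in _ + X]big1 ?addr0; last first.
  move=> C /negbTE CA; apply: big1 => D _.
  by rewrite cl_coef_blade CA !mul0r scale0r.
rewrite (bigD1 B)//= big1 ?addr0; last first.
  move=> D /negbTE DB; rewrite [cl_coef (cl_blade B) D]cl_coef_blade DB.
  by rewrite mulr0 mul0r scale0r.
by rewrite !cl_coef_blade !eqxx !mul1r.
Qed.

Lemma cl_mul_suml (I : Type) (r : seq I) (P : pred I) (F : I -> Cl) y :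
  cl_mul (\sum_(i <- r | P i) F i) y = \sum_(i <- r | P i) cl_mul (F i) y.
Proof.
apply: (big_morph (cl_mul^~ y)) => [u v|]; first exact: cl_mulDl.
by have := cl_scalerAl 0 0 y; rewrite !scale0r.
Qed.

Lemma cl_mul_sumr (I : Type) (r : seq I) (P : pred I) (F : I -> Cl) x :
  cl_mul x (\sum_(i <- r | P i) F i) = \sum_(i <- r | P i) cl_mul x (F i).
Proof.
apply: (big_morph (cl_mul x)) => [u v|]; first exact: cl_mulDr.
by have := cl_scalerAr 0 x 0; rewrite !scale0r.
Qed.

Lemma in_symdiff A B i : (i \in symdiff A B) = (i \in A) (+) (i \in B).
Proof. by rewrite !inE; case: (i \in A); case: (i \in B). Qed.

Lemma symdiffA : associative symdiff.
Proof. by move=> A B C; apply/finset.setP => i; rewrite !in_symdiff addbA. Qed.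

Lemma prod_symdiff (F : 'I_n -> R) A B : (forall i, F i * F i = 1) ->
  \prod_(i in symdiff A B) F i = \prod_(i in A) F i * \prod_(i in B) F i.
Proof.
move=> F1; rewrite !(big_mkcond (fun i => i \in _)) -big_split /=.
apply: eq_bigr => i _; rewrite in_symdiff.
by case: (i \in A); case: (i \in B) => /=; rewrite ?mulr1 ?mul1r.
Qed.

Lemma prodN1_sqr (I : Type) (r : seq I) (P : pred I) :
  (\prod_(i <- r | P i) -1) * (\prod_(i <- r | P i) -1) = 1 :> R.
Proof. by rewrite -big_split /=; apply: big1 => i _; rewrite mulrNN mulr1. Qed.

Lemma cl_sign_symdiffl A B C :
  cl_sign (symdiff A B) C = cl_sign A C * cl_sign B C.
Proof. by apply: prod_symdiff => i; exact: prodN1_sqr. Qed.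

Lemma cl_sign_symdiffr A B C :
  cl_sign A (symdiff B C) = cl_sign A B * cl_sign A C.
Proof.
rewrite /cl_sign -big_split; apply: eq_bigr => a _ /=.
rewrite !big_mkcondr.
by apply: prod_symdiff => b; case: ifP => _; rewrite ?mulrNN mulr1.
Qed.

Lemma cl_lin_ind (P : Cl -> Prop) : P 0 ->
  (forall a x y, P x -> P y -> P (a *: x + y)) ->
  (forall A, P (cl_blade A)) -> forall x, P x.
Proof.
move=> P0 PD Pb x; rewrite (cl_basis x).
by elim/big_rec: _ => // A y _; exact: PD.
Qed.

Lemma cl_mulA : associative cl_mul.
Proof.
have mul0l y : cl_mul 0 y = 0 by have := cl_scalerAl 0 0 y; rewrite !scale0r.
have mul0r y : cl_mul y 0 = 0 by have := cl_scalerAr 0 y 0; rewrite !scale0r.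
move=> x y z; elim/cl_lin_ind: x => [|a x x' IH IH'|A].
- by rewrite !mul0l.
- by rewrite !cl_mulDl -(cl_scalerAl a x y) -!(cl_scalerAl a) IH IH'.
elim/cl_lin_ind: y => [|a y y' IH IH'|B].
- by rewrite mul0r !mul0l mul0r.
- rewrite cl_mulDl !cl_mulDr cl_mulDl -(cl_scalerAl a y z) -!(cl_scalerAr a).
  by rewrite -(cl_scalerAl a) IH IH'.
elim/cl_lin_ind: z => [|a z z' IH IH'|C].
- by rewrite !mul0r.
- by rewrite !cl_mulDr -!(cl_scalerAr a) IH IH'.
rewrite !cl_mul_blade -cl_scalerAr -cl_scalerAl !cl_mul_blade !scalerA symdiffA.
by rewrite cl_sign_symdiffl cl_sign_symdiffr [in LHS]mulrC -!mulrA.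
Qed.

Lemma cl_mul1 : left_id (cl_blade finset.set0) cl_mul.
Proof.
move=> x; rewrite [in LHS](cl_basis x) cl_mul_sumr [RHS]cl_basis.
apply: eq_bigr => A _; rewrite -cl_scalerAr cl_mul_blade /cl_sign.
rewrite big_set0 scale1r.
by congr (_ *: cl_blade _); apply/finset.setP => i; rewrite in_symdiff inE.
Qed.

Lemma cl_mulr1 : right_id (cl_blade finset.set0) cl_mul.
Proof.
move=> x; rewrite [in LHS](cl_basis x) cl_mul_suml [RHS]cl_basis.
apply: eq_bigr => A _; rewrite -cl_scalerAl cl_mul_blade /cl_sign.
rewrite big1 => [|a _]; last by apply: big1 => b; rewrite inE.
rewrite scale1r.
congr (_ *: cl_blade _); apply/finset.setP => i.
by rewrite in_symdiff inE addbF.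
Qed.

Lemma cl_one_neq0 : cl_blade finset.set0 != 0 :> Cl.
Proof.
apply/eqP => /(congr1 (cl_coef^~ finset.set0)).
rewrite cl_coef_blade eqxx /cl_coef mxE.
by move/eqP; rewrite oner_eq0.
Qed.

HB.instance Definition _ := GRing.Zmodule_isNzRing.Build Cl
  cl_mulA cl_mul1 cl_mulr1 cl_mulDl cl_mulDr cl_one_neq0.

HB.instance Definition _ := GRing.Lmodule_isLalgebra.Build R Cl cl_scalerAl.
HB.instance Definition _ := GRing.Lalgebra_isAlgebra.Build R Cl cl_scalerAr.

Definition cl_gen (i : 'I_n) : Cl := cl_blade [set i].

Lemma cl_genC (i j : 'I_n) :
  cl_gen i * cl_gen j + cl_gen j * cl_gen i = - (2 *+ (i == j)) *: 1.
Proof.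
rewrite /GRing.mul /= !cl_mul_blade /cl_sign !big_set1.
have [<-|ij] := eqVneq i j.
  have -> : symdiff [set i] [set i] = finset.set0.
    by apply/finset.setP => k; rewrite in_symdiff addbb inE.
  rewrite (big_pred1 i) => [|k]; last first.
    by rewrite !inE /=; case: eqP => // ->; rewrite leqnn.
  by rewrite -scalerDl mulr1n -opprD.
have -> : symdiff [set j] [set i] = symdiff [set i] [set j].
  by apply/finset.setP => k; rewrite !in_symdiff addbC.
rewrite -scalerDl !big_mkcondr !big_set1 mulr0n oppr0.
rewrite [X in X *: _](_ : _ = 0) ?scale0r //.
case: (ltngtP i j) => [_|_|/val_inj/eqP]; rewrite ?(negbTE ij) // ?subrr //.
by rewrite addrC subrr.
Qed.

End clifford.
Definition dot (R : realType) (n : nat) (x y : 'rV[R]_n) : R :=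
  \sum_(i < n) x ord0 i * y ord0 i.
(* The Euclidean norm; the library's norm on row vectors is the sup norm. *)
Definition enorm (R : realType) (n : nat) (x : 'rV[R]_n) : R :=
  Num.sqrt (dot x x).

Local Open Scope classical_set_scope.

Section lebesgue_tuple.
Variable R : realType.
Local Notation mR := (measurableTypeR R).

Definition cons_tup (n : nat) (z : mR * n.-tuple mR) : n.+1.-tuple mR :=
  [tuple of z.1 :: z.2].

Lemma measurable_cons_tup n :
  measurable_fun [set: mR * n.-tuple mR] (@cons_tup n).
Proof. exact: measurable_cons measurable_fst measurable_snd. Qed.

Definition lebesgue_cons (n : nat)
    (m : {sigma_finite_measure set (n.-tuple mR) -> \bar R}) :
    set (n.+1.-tuple mR) -> \bar R :=
  pushforward (@lebesgue_measure R \x m)%E (@cons_tup n).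

Section lebesgue_cons.
Variables (n : nat) (m : {sigma_finite_measure set (n.-tuple mR) -> \bar R}).

Let lebesgue_cons0 : lebesgue_cons m set0 = 0%E.
Proof. by apply: measure0; exact: measurable_cons_tup. Qed.

Let lebesgue_cons_ge0 A : (0 <= lebesgue_cons m A)%E.
Proof. by apply: measure_ge0; exact: measurable_cons_tup. Qed.

Let lebesgue_cons_sigma_additive : semi_sigma_additive (lebesgue_cons m).
Proof.
by apply: measure_semi_sigma_additive; exact: measurable_cons_tup.
Qed.

HB.instance Definition _ := isMeasure.Build _ _ _ (lebesgue_cons m)
  lebesgue_cons0 lebesgue_cons_ge0 lebesgue_cons_sigma_additive.

Let lebesgue_cons_sigma_finite : sigma_finite setT (lebesgue_cons m).
Proof.
have /sigma_finiteP[F [FT Fnd Foo]] := sigma_finiteT (@lebesgue_measure R).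
have /sigma_finiteP[G [GT Gnd Goo]] := sigma_finiteT m.
pose uncons (t : n.+1.-tuple mR) : mR * n.-tuple mR :=
  (tnth t ord0, [tuple of behead t]).
have consK : cancel (@cons_tup n) uncons.
  by move=> [x t]; congr pair; apply/val_inj.
have muncons : measurable_fun setT uncons.
  by apply: measurable_fun_pair;
    [exact: measurable_tnth|exact: measurable_behead].
exists (fun k => uncons @^-1` (F k `*` G k)).
  rewrite -preimage_bigcup -[LHS](preimage_setT uncons); congr (_ @^-1` _).
  apply/seteqP; split=> -[x t] // _.
  have [i _ Fx] : (\bigcup_i F i) x by rewrite -FT.
  have [j _ Gt] : (\bigcup_i G i) t by rewrite -GT.
  exists (maxn i j) => //; split => /=.
    by move: x Fx; exact/subsetPset/Fnd/leq_maxl.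
  by move: t Gt; exact/subsetPset/Gnd/leq_maxr.
move=> k; have [mF Fk] := Foo k; have [mG Gk] := Goo k; split.
  rewrite -[X in measurable X]setTI; apply: muncons => //.
  exact: measurableX.
rewrite /lebesgue_cons /pushforward -comp_preimage.
rewrite (_ : uncons \o _ = id); last by apply/funext => z; exact: consK.
by rewrite preimage_id product_measure1E// lte_mul_pinfty// ge0_fin_numE.
Qed.

HB.instance Definition _ := Measure_isSigmaFinite.Build _ _ _ (lebesgue_cons m)
  lebesgue_cons_sigma_finite.

End lebesgue_cons.

(* Lebesgue measure on R^n, as an iterated product measure. *)
Fixpoint lebesgue_tup (n : nat) :
    {sigma_finite_measure set (n.-tuple mR) -> \bar R} :=
  match n with
  | 0 => dirac ([tuple] : 0.-tuple mR)
  | k.+1 => lebesgue_cons (lebesgue_tup k)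
  end.

Definition row_of_tup (n : nat) (t : n.-tuple mR) : 'rV[R]_n :=
  \row_i tnth t i.

Definition ball_tup (n : nat) : set (n.-tuple mR) :=
  [set t | enorm (row_of_tup t) <= 1].

Definition normalize_tup (n : nat) (t : n.-tuple mR) : n.-tuple mR :=
  [tuple (tnth t i / enorm (row_of_tup t) : mR) | i < n].

Definition sphere_tup (n : nat) : set (n.-tuple mR) :=
  [set t | enorm (row_of_tup t) = 1].

Lemma measurable_enorm_tup n :
  measurable_fun [set: n.-tuple mR] (fun t => enorm (row_of_tup t) : R).
Proof.
apply: (@measurableT_comp _ _ _ _ _ _ (@Num.sqrt R)).
  by apply: continuous_measurable_fun; exact: sqrt_continuous.
apply: measurable_sum => i; under eq_fun do rewrite !mxE.
by apply: measurable_funM; exact: measurable_tnth.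
Qed.

Lemma measurable_ball_tup n : measurable (@ball_tup n).
Proof.
rewrite (_ : @ball_tup n =
    setT `&` (fun t => enorm (row_of_tup t)) @^-1` `]-oo, 1]).
  by apply: measurable_enorm_tup.
by rewrite setTI; apply/seteqP; split => t /=; rewrite in_itv.
Qed.

Lemma measurable_normalize_tup n :
  measurable_fun [set: n.-tuple mR] (@normalize_tup n).
Proof.
apply/measurable_fun_tnthP => i.
rewrite (_ : _ \o _ = fun t => tnth t i / enorm (row_of_tup t)); last first.
  by apply/funext => t /=; rewrite tnth_mktuple.
apply: measurable_funM; first exact: measurable_tnth.
apply: (@measurableT_comp _ _ _ _ _ _ (@GRing.inv R)); last first.
  exact: measurable_enorm_tup.
have mD : measurable (~` [set 0 : R]) 
  by apply: measurableC.
rewrite -(setvU [set 0 : R]); apply/(measurable_funU _ mD (measurable_set1 0)).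
split; last first.
  move=> _ Y mY; rewrite set1I; case: ifP => _;
    [exact: measurable_set1|exact: measurable0].
apply: open_continuous_measurable_fun.
  exact/closed_openC/accessible_closed_set1/hausdorff_accessible/norm_hausdorff.
by move=> x; rewrite inE => /eqP x0; exact: inv_continuous.
Qed.

(* The area element of the unit sphere of R^n, as the cone measure:
   sphere_measure A = n * lambda_n {x | 0 < |x| <= 1 and x / |x| \in A}
   for A included in the sphere, lambda_n being Lebesgue measure. For n = 1 it
   is the counting measure on {-1, 1}. *)
Definition sphere_measure (n : nat) : set (n.-tuple mR) -> \bar R :=
  pushforward
    (mscale n%:R%:nng (mrestr (lebesgue_tup n) (@measurable_ball_tup n)))
    (@normalize_tup n).

Section sphere_measure.
Variable n : nat.

Let sphere_measure0 : @sphere_measure n set0 = 0%E.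
Proof. by apply: measure0; exact: measurable_normalize_tup. Qed.

Let sphere_measure_ge0 (A : set (n.-tuple mR)) : (0 <= @sphere_measure n A)%E.
Proof. by apply: measure_ge0; exact: measurable_normalize_tup. Qed.

Let sphere_measure_sigma_additive : semi_sigma_additive (@sphere_measure n).
Proof.
by apply: measure_semi_sigma_additive; exact: measurable_normalize_tup.
Qed.

HB.instance Definition _ := isMeasure.Build _ _ _ (@sphere_measure n)
  sphere_measure0 sphere_measure_ge0 sphere_measure_sigma_additive.

End sphere_measure.
End lebesgue_tuple.

Section analytic.
Variables (R : realType) (m : nat) (V : normedModType R).

Definition monomial (alpha : {ffun 'I_m -> nat}) (y : 'rV[R]_m) : R :=
  \prod_(i < m) y ord0 i ^+ alpha i.

(* Around each point of U, f is the sum of a power series; convergence of the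
   family of all monomials is along the finite sets of multi-indices. *)
Definition real_analytic_on (U : set 'rV[R]_m) (f : 'rV[R]_m -> V) : Prop :=
  forall a, U a -> exists c : {ffun 'I_m -> nat} -> V,
    \forall x \near a,
      summability.partial_sum (fun alpha => monomial alpha (x - a) *: c alpha)
        @ summability.totally --> f x.

Definition C1_on (U : set 'rV[R]_m) (f : 'rV[R]_m -> V) : Prop :=
  forall x, U x -> forall i : 'I_m,
    derivable f x (delta_mx ord0 i) /\
    {for x, continuous ('D_(delta_mx ord0 i) f)}.

Definition laplacian (f : 'rV[R]_m -> V) (x : 'rV[R]_m) : V :=
  \sum_(i < m) 'D_(delta_mx ord0 i) ('D_(delta_mx ord0 i) f) x.

Definition domain (U : set 'rV[R]_m) : Prop :=
  [/\ open U, connected U & U !=set0].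

End analytic.

Definition Gamma (R : realType) (s : R) : R :=
  \int[@lebesgue_measure R]_(t in `]0, +oo[) (t `^ (s - 1) * expR (- t)).

Section sphere_integral.
Variable R : realType.

Definition usphere (q : nat) : set 'rV[R]_q := [set w | enorm w = 1].

Definition sphere_area (q : nat) : R :=
  fine (sphere_measure (@sphere_tup R q)).

(* Clifford-valued integral over the sphere, coordinate by coordinate. *)
Definition sphere_int (q n : nat) (g : 'rV[R]_q -> clifford R n) :
    clifford R n :=
  \sum_(A : {set 'I_n})
    (\int[@sphere_measure R q]_(t in @sphere_tup R q)
        cl_coef (g (row_of_tup t)) A) *: cl_blade R A.

Definition sphere_mean (q n : nat) (g : 'rV[R]_q -> clifford R n) :
    clifford R n :=
  (sphere_area q)^-1 *: sphere_int g.

End sphere_integral.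

(* A point x = x_p + x_q of R^(p+q+1) is row_mx x_p x_q : 'rV_(p.+1 + q). *)
Section partial_slice.
Variables (R : realType) (p q : nat).
Local Notation Cl := (clifford R (p + q)).
Local Notation Rp := 'rV[R]_p.+1.
Local Notation Rpq := 'rV[R]_(p.+1 + q).
Implicit Types (Omega : set Rpq) (w eta : 'rV[R]_q).

(* The types 'I_(p.+1 + q) and 'I_(p + q).+1 are convertible; e_0 = 1. *)
Definition para_e (i : 'I_(p.+1 + q)) : Cl :=
  if unlift (@ord0 (p + q)) i is Some j then cl_gen R j else 1.

Definition vecq (y : 'rV[R]_q) : Cl :=
  \sum_(j < q) y ord0 j *: para_e (rshift p.+1 j).

Definition Dxp (f : Rp -> Cl) (y : Rp) : Cl :=
  \sum_(i < p.+1) para_e (lshift q i) * 'D_(delta_mx ord0 i) f y.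

Definition Dx (f : Rpq -> Cl) (x : Rpq) : Cl :=
  \sum_(i < p.+1 + q) para_e i * 'D_(delta_mx ord0 i) f x.

Definition monogenic Omega (f : Rpq -> Cl) : Prop :=
  C1_on Omega f /\ forall x, Omega x -> Dx f x = 0.

(* The set written Omega_0^* *)
Definition cylinder (Omega0 : set Rp) : set Rpq := [set x | Omega0 (lsubmx x)].

(* y = (x_p, r) in R^(p+2) stands for x_p + r w. *)
Definition slice_pt w (y : 'rV[R]_(p.+1 + 1)) : Rpq :=
  row_mx (lsubmx y) (rsubmx y ord0 ord0 *: w).

Definition slice Omega w : set 'rV[R]_(p.+1 + 1) := slice_pt w @^-1` Omega.

Definition slice_domain Omega : Prop :=
  [/\ domain Omega, exists a : Rp, Omega (row_mx a 0) &
      forall w, usphere w -> domain (slice Omega w)].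

Definition p_symmetric Omega : Prop :=
  forall (a : Rp) (r : R) w, 0 < r -> usphere w -> Omega (row_mx a (r *: w)) ->
  forall eta, usphere eta -> Omega (row_mx a (r *: eta)).

Definition GSM Omega (f : Rpq -> Cl) : Prop :=
  forall w, usphere w ->
    let fw := f \o slice_pt w in
    C1_on (slice Omega w) fw /\
    forall y, slice Omega w y ->
      \sum_(i < p.+1)
          para_e (lshift q i) * 'D_(delta_mx ord0 (lshift 1 i)) fw y
      + vecq w * 'D_(delta_mx ord0 (rshift p.+1 ord0)) fw y = 0.

Definition AM Omega (f : Rpq -> Cl) : Prop :=
  monogenic Omega f /\
  exists F1 F2 : Rp -> R -> Cl,
    [/\ forall a r, F1 a (- r) = F1 a r,
        forall a r, F2 a (- r) = - F2 a r &
        forall a r w, usphere w -> Omega (row_mx a (r *: w)) ->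
          f (row_mx a (r *: w)) = F1 a r + vecq w * F2 a r].

(* Terms of the series are functions of k; the vector x_q (resp. eta) is a
   constant for the operator Dxp. *)
Definition CK_term (f0 : Rp -> Cl) (x : Rpq) (k : nat) : Cl :=
  k`!%:R^-1 *:
    iter k (fun (g : Rp -> Cl) y => vecq (rsubmx x) * Dxp g y) f0 (lsubmx x).

Definition CK (f0 : Rp -> Cl) (x : Rpq) : Cl := limn (series (CK_term f0 x)).

Definition CK_dir_term (f0 : Rp -> Cl) eta (x : Rpq) (k : nat) : Cl :=
  (dot eta (rsubmx x) ^+ k / k`!%:R) *:
    iter k (fun (g : Rp -> Cl) y => vecq eta * Dxp g y) f0 (lsubmx x).

Definition CK_dir (f0 : Rp -> Cl) eta (x : Rpq) : Cl :=
  limn (series (CK_dir_term f0 eta x)).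

Definition GCK_even_term (f0 : Rp -> Cl) (r : R) (y : Rp) (k : nat) : Cl :=
  (Gamma (q%:R / 2) * (-1) ^+ k * r ^+ (2 * k)
     / (2 ^+ (2 * k) * k`!%:R * Gamma (k%:R + q%:R / 2))) *:
    iter k (@laplacian R p.+1 Cl) f0 y.

Definition GCK_odd_term (f0 : Rp -> Cl) (r : R) (y : Rp) (k : nat) : Cl :=
  (Gamma (q%:R / 2) * (-1) ^+ k * r ^+ (2 * k)
     / (2 ^+ (2 * k + 1) * k`!%:R * Gamma (k%:R + q%:R / 2 + 1))) *:
    iter k (@laplacian R p.+1 Cl) f0 y.

Definition GCK (f0 : Rp -> Cl) (x : Rpq) : Cl :=
  let r := enorm (rsubmx x) in
  limn (series (GCK_even_term f0 r (lsubmx x))) +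
  vecq (rsubmx x) *
    Dxp (fun y => limn (series (GCK_odd_term f0 r y))) (lsubmx x).

(* The two series and the derivatives in the definition of GCK f0 make sense
   on Omega. *)
Definition GCK_defined Omega (f0 : Rp -> Cl) : Prop :=
  forall x, Omega x ->
    let r := enorm (rsubmx x) in
    [/\ cvgn (series (GCK_even_term f0 r (lsubmx x))),
        \forall y \near lsubmx x, cvgn (series (GCK_odd_term f0 r y)) &
        forall i : 'I_p.+1,
          derivable (fun y => limn (series (GCK_odd_term f0 r y))) (lsubmx x)
            (delta_mx ord0 i)].

(* g is the monogenic sum of a series x_q ^ k f_k(x_p) with f_k analytic and
   f_0 prescribed. *)
Definition generalized_CK_extension (Omega0 : set Rp) Omega (f0 : Rp -> Cl)
    (g : Rpq -> Cl) : Prop :=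
  exists f : nat -> Rp -> Cl,
    [/\ f 0%N = f0,
        forall k, real_analytic_on Omega0 (f k),
        forall x, Omega x ->
          series (fun k => vecq (rsubmx x) ^+ k * f k (lsubmx x)) @ \oo
            --> g x &
        monogenic Omega g].

Definition radon_pt eta (x : Rpq) : Rpq :=
  row_mx (lsubmx x) (dot (rsubmx x) eta *: eta).

Definition dual_radon (f : Rpq -> Cl) (x : Rpq) : Cl :=
  sphere_mean (fun eta => f (radon_pt eta x)).

End partial_slice.

Arguments cylinder {R p} q Omega0 _.

(* Main.v *)
(* Write D for D_(x_p) and D^* for its conjugate. Since e_i x_q = x_q e_i^* for
   i <= p, (x_q D)^k f0 = x_q^k U_k, where U_0 = f0 and U_(k+1) is D U_k or
   D^* U_k according to the parity of k; in particular U_(2m) = Delta^m f0. All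
   extensions are then series sum_k c_k x_q^k U_k with |c_k| <= 1 / k!. For CK,
   c_k = 1 / k!; for GCK, c_k = 1 / (tau_1 ... tau_k), where D_(x_q) x_q^k =
   - tau_k x_q^(k-1), which makes D_x of the series telescope to 0. Cauchy
   estimates |U_k| <= C K^k k! near each point of Omega0 give normal convergence
   of these series and of their derivatives on a tube; Omega is the union of the
   tubes. Integrating the j-th partial derivative of <y, x>^(k+1) (1 - |y|^2) over
   the unit ball gives (q + k) M[eta_j <eta, x>^(k+1)] = (k + 1) x_j M[<eta, x>^k]
   for the mean M over the sphere. Hence M[<eta, x_q>^k eta^k / k!] = c_k x_q^k
   with the c_k of GCK, and M is exchanged with the uniformly convergent series. *)

Require Import Defs.
From HB Require Import structures.
From mathcomp Require Import all_boot all_order all_algebra.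
From mathcomp Require Import all_classical all_reals all_analysis.
From mathcomp Require Import measurable_realfun.
From mathcomp.analysis.showcase Require summability.
From mathcomp Require Import ring lra finmap.
Import Order.TTheory GRing.Theory Num.Theory.
Import numFieldNormedType.Exports.

Set Implicit Arguments.
Unset Strict Implicit.
Unset Printing Implicit Defensive.

Local Open Scope classical_set_scope.
Local Open Scope ring_scope.

(** * Derivatives of Clifford-valued functions *)

(** Three difficulties shape the proof. The area element is the cone measure, so a spherical moment
    is an integral over the ball of a function homogeneous of degree 0. Since 1 - |y|^2 vanishes on
    the boundary, the integration by parts reduces by Fubini to the fundamental theorem of calculus
    on chords of the ball; the powers of |y| that it leaves are removed by a radial formula.
    Term-by-term derivatives are wanted in three situations: on the whole space for monogenicity, on
    each slice for [GSM], and with x_q frozen for the operator D in the odd part of [GCK]. These are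
    one series read through three affine maps [Phi], so the differentiation theorem is proved once,
    for [Phi]. It only speaks of derivatives along lines, and reduces to functions of one real
    variable. The bounds on U_k must have the form C K^k k! on a ball that does not depend on k.
    Derivatives of power series are therefore followed through their coefficients, which costs no
    radius. The norm is the sup norm of the coordinates; it is not submultiplicative, and every
    product costs a factor [cl_kappa], which the width of the tubes compensates. *)

Section clifford_norm.
Variables (R : realType) (n : nat).
Local Notation Cl := (clifford R n).
Implicit Types (A B : {set 'I_n}) (x y : Cl).

Lemma cl_coef_norm x A : `|cl_coef x A| <= `|x|.
Proof.
rewrite [leRHS]mx_normrE.
by apply/bigmax_geP; right; exists (ord0, enum_rank A).
Qed.

Lemma cl_norm_le x (e : R) :
  0 <= e -> (forall A, `|cl_coef x A| <= e) -> `|x| <= e.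
Proof.
move=> e0 xe; rewrite [leLHS]mx_normrE; apply/bigmax_leP; split => // -[i j] _.
by rewrite /= (ord1 i) -(enum_valK j); exact: xe.
Qed.

Lemma cl_coefB x y A : cl_coef (x - y) A = cl_coef x A - cl_coef y A.
Proof. by rewrite cl_coefD -scaleN1r cl_coefZ mulN1r. Qed.

Lemma cl_norm_blade A : `|cl_blade R A| <= 1.
Proof.
apply: cl_norm_le => // B; rewrite cl_coef_blade.
by case: (B == A); rewrite ?normr0 ?normr1.
Qed.

Lemma cl_sign_norm A B : `|cl_sign R A B| = 1.
Proof.
rewrite /cl_sign normr_prod big1// => i _.
by rewrite normr_prod big1// => j _; rewrite normrN1.
Qed.

(** The number of pairs of blades. Each pair contributes at most |x| |y| to every coordinate of a
    product, so this constant replaces submultiplicativity of the norm. *)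
Definition cl_kappa : R := \sum_(A : {set 'I_n}) \sum_(B : {set 'I_n}) 1.

Lemma cl_kappa_ge1 : 1 <= cl_kappa.
Proof.
rewrite /cl_kappa (bigD1 finset.set0)//= (bigD1 finset.set0)//= -addrA lerDl.
by apply: addr_ge0; apply: sumr_ge0 => // i _; rewrite addr_ge0 ?sumr_ge0.
Qed.

Lemma cl_kappa_ge0 : 0 <= cl_kappa.
Proof. exact: le_trans cl_kappa_ge1. Qed.

Lemma cl_normM x y : `|x * y| <= cl_kappa * `|x| * `|y|.
Proof.
have -> : x * y = cl_mul x y by [].
rewrite /cl_mul /cl_kappa -mulrA big_distrl/=.
apply: le_trans (ler_norm_sum _ _ _) _; apply: ler_sum => A _.
rewrite big_distrl/=; apply: le_trans (ler_norm_sum _ _ _) _.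
apply: ler_sum => B _; rewrite normrZ !normrM cl_sign_norm mulr1 mul1r.
apply: le_trans (_ : `|cl_coef x A| * `|cl_coef y B| * 1 <= _).
  by rewrite ler_wpM2l ?cl_norm_blade// mulr_ge0.
by rewrite mulr1 ler_pM ?cl_coef_norm.
Qed.

Lemma cl_cvgM (T : Type) (F : set_system T) {FF : Filter F} (f g : T -> Cl) (a b : Cl) :
  f @ F --> a -> g @ F --> b -> (fun t => f t * g t) @ F --> a * b.
Proof.
move=> fa gb; apply/cvgrPdist_le => e e0.
have K0 : 0 < cl_kappa * (`|a| + `|b| + 1).
  by rewrite mulr_gt0 ?(lt_le_trans ltr01 cl_kappa_ge1)// ltr_wpDl// addr_ge0.
have d0 : 0 < Num.min 1 (e / (cl_kappa * (`|a| + `|b| + 1))).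
  by rewrite lt_min ltr01 divr_gt0.
near=> t.
have : `|a - f t| <= Num.min 1 (e / (cl_kappa * (`|a| + `|b| + 1))).
  by near: t; move/cvgrPdist_le : fa; exact.
have : `|b - g t| <= Num.min 1 (e / (cl_kappa * (`|a| + `|b| + 1))).
  by near: t; move/cvgrPdist_le : gb; exact.
set d := Num.min _ _ => gt ft.
have -> : a * b - f t * g t = a * (b - g t) + (a - f t) * g t.
  by rewrite mulrBr mulrBl addrA subrK.
have gb1 : `|g t| <= `|b| + 1.
  rewrite -[g t](subrK b) addrC (le_trans (ler_normD _ _))// lerD2l.
  by rewrite distrC (le_trans gt)// /d ge_min lexx.
apply: le_trans (ler_normD _ _) _.
apply: le_trans (_ : cl_kappa * `|a| * d + cl_kappa * d * (`|b| + 1) <= _).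
  apply: lerD.
    apply: le_trans (cl_normM _ _) _; rewrite ler_wpM2l ?mulr_ge0 ?cl_kappa_ge0//.
  apply: le_trans (cl_normM _ _) _.
  by rewrite ler_pM ?mulr_ge0 ?cl_kappa_ge0// ler_wpM2l ?cl_kappa_ge0.
rewrite (_ : _ + _ = d * (cl_kappa * (`|a| + `|b| + 1))); last by ring.
by rewrite -ler_pdivlMr// /d ge_min lexx orbT.
Unshelve. all: by end_near. Qed.

Lemma cl_coef_cvg (T : Type) (F : set_system T) {FF : Filter F} (f : T -> Cl) (a : Cl) A :
  f @ F --> a -> (fun t => cl_coef (f t) A) @ F --> cl_coef a A.
Proof.
move=> fa; apply/cvgrPdist_le => e e0; near=> t.
rewrite (_ : _ - _ = cl_coef (a - f t) A); last first.
  by rewrite cl_coefB.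
apply: le_trans (cl_coef_norm _ _) _.
by near: t; move/cvgrPdist_le : fa; exact.
Unshelve. all: by end_near. Qed.

End clifford_norm.

(** * Directional derivatives and affine changes of variable *)

Section directional_derivative.
Variables (R : realType).

Lemma is_derive_cvg (V W : normedModType R) (f : V -> W) (x v : V) (df : W) :
  (fun h => h^-1 *: (f (h *: v + x) - f x)) @ 0^' --> df -> is_derive x v f df.
Proof.
move=> fdf; apply: DeriveDef; last exact: cvg_lim fdf.
by apply/cvg_ex; exists df.
Qed.

Lemma cvg_is_derive (V W : normedModType R) (f : V -> W) (x v : V) (df : W) :
  is_derive x v f df -> (fun h => h^-1 *: (f (h *: v + x) - f x)) @ 0^' --> df.
Proof. by move=> [fx <-]; exact: fx. Qed.

(** A directional derivative gives continuity along its line only, and this is all that the product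
    rule consumes. *)
Lemma is_derive_line_cvg (V W : normedModType R) (f : V -> W) (x v : V) (df : W) :
  is_derive x v f df -> (fun h : R => f (h *: v + x)) @ 0^' --> f x.
Proof.
move=> /cvg_is_derive fdf.
have h0 : (fun h : R => h) @ 0^' --> (0 : R) by apply: cvg_within.
have : (fun h : R => h *: (h^-1 *: (f (h *: v + x) - f x)) + f x) @ 0^'
    --> 0 *: df + f x.
  by apply: cvgD; [exact: cvgZ|exact: cvg_cst].
rewrite scale0r add0r; apply: cvg_trans; apply: near_eq_cvg; near=> h => /=.
have hN0 : h != 0 by near: h; exact: nbhs_dnbhs_neq.
by rewrite scalerA divff// scale1r subrK.
Unshelve. all: by end_near. Qed.

(** The two difference quotients are literally equal, so a derivative of [f] in the single direction
    [w] suffices. *)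
Lemma is_derive_comp_affine (V V' W : normedModType R) (L : V -> V') (f : V' -> W)
    (x v : V) (w : V') (df : W) :
  (forall h : R, L (h *: v + x) = h *: w + L x) ->
  is_derive (L x) w f df -> is_derive x v (f \o L) df.
Proof.
move=> Lx /cvg_is_derive fdf; apply: is_derive_cvg => /=.
by under eq_fun do rewrite Lx.
Qed.

Lemma is_derive_affine (V W : normedModType R) (f : V -> W) (x v : V) (w : W) :
  (forall h : R, f (h *: v + x) = h *: w + f x) -> is_derive x v f w.
Proof.
move=> fx; apply: is_derive_cvg.
have : (fun _ : R => w) @ 0^' --> w by exact: cvg_cst.
apply: cvg_trans; apply: near_eq_cvg; near=> h; rewrite fx addrK scalerA mulVf ?scale1r//.
by near: h; exact: nbhs_dnbhs_neq.
Unshelve. all: by end_near. Qed.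

Lemma is_derive_line (V W : normedModType R) (f : V -> W) (x v : V) (t : R) (df : W) :
  is_derive (t *: v + x) v f df ->
  is_derive t 1 (fun h : R => f (h *: v + x)) df.
Proof.
apply: (@is_derive_comp_affine _ _ _ (fun h : R => h *: v + x)) => h.
by rewrite scalerDl [h *: 1]mulr1 addrA.
Qed.

Lemma line_is_derive (V W : normedModType R) (f : V -> W) (x v : V) (df : W) :
  is_derive (0 : R) 1 (fun h : R => f (h *: v + x)) df -> is_derive x v f df.
Proof.
move=> /cvg_is_derive; under eq_fun => h.
  rewrite addr0 scale0r add0r [h *: 1]mulr1; over.
exact: is_derive_cvg.
Qed.

End directional_derivative.

(** * Product rule and limits of differentiable functions *)

Section clifford_derive.
Variables (R : realType) (n : nat).
Local Notation Cl := (clifford R n).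

Lemma is_derive_clM (V : normedModType R) (f g : V -> Cl) (x v : V) (df dg : Cl) :
  is_derive x v f df -> is_derive x v g dg ->
  is_derive x v (fun y => f y * g y) (df * g x + f x * dg).
Proof.
move=> fx gx; apply: is_derive_cvg.
have : (fun h : R => h^-1 *: (f (h *: v + x) - f x) * g (h *: v + x) +
    f x * (h^-1 *: (g (h *: v + x) - g x))) @ 0^' --> df * g x + f x * dg.
  apply: cvgD; apply: cl_cvgM; [exact: cvg_is_derive|exact: is_derive_line_cvg|
    exact: cvg_cst|exact: cvg_is_derive].
apply: cvg_trans; apply: near_eq_cvg; near=> h => /=.
rewrite -scalerAl -[_ * (_ *: _)]scalerAr -scalerDr; congr (_ *: _).
by rewrite mulrBl mulrBr addrA subrK.
Unshelve. all: by end_near. Qed.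

Lemma is_derive_clMl (V : normedModType R) (b : Cl) (f : V -> Cl) (x v : V) (df : Cl) :
  is_derive x v f df -> is_derive x v (fun y => b * f y) (b * df).
Proof.
move=> fx; have := is_derive_clM (is_derive_cst b x v) fx.
by rewrite mul0r add0r.
Qed.

Lemma is_derive_coef (V : normedModType R) (f : V -> Cl) (x v : V) (df : Cl) A :
  is_derive x v f df -> is_derive x v (fun y => cl_coef (f y) A : R) (cl_coef df A).
Proof.
move=> /cvg_is_derive fx; apply: is_derive_cvg.
apply: cvg_trans (cl_coef_cvg (A := A) fx); apply: near_eq_cvg; near=> h => /=.
by rewrite cl_coefZ cl_coefB.
Unshelve. all: by end_near. Qed.

(** The scalar mean value theorem is applied to each coefficient of [h t - t *: c]. Because the norm
    is the sup norm, the coordinatewise bounds combine without any constant. *)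
Lemma cl_mean_value (h dh : R -> Cl) (d e : R) (c : Cl) : 0 <= e ->
  (forall t : R, `|t| < d -> is_derive t 1 h (dh t)) ->
  (forall t, `|t| < d -> `|dh t - c| <= e) ->
  forall t, `|t| < d -> `|h t - h 0 - t *: c| <= e * `|t|.
Proof.
move=> e0 hdh dhe t td; apply: cl_norm_le => [|A]; first exact: mulr_ge0.
pose k s : R := cl_coef (h s) A - s * cl_coef c A.
pose dk s : R := cl_coef (dh s) A - cl_coef c A.
have kd (s : R) : `|s| < d -> is_derive s 1 k (dk s).
  move=> sd; apply: is_deriveB; first exact/is_derive_coef/hdh.
  by apply: is_derive_affine => u; rewrite mulrDl [u *: 1]mulr1.
have dke s : `|s| < d -> `|dk s| <= e.
  move=> sd; apply: le_trans (dhe s sd).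
  apply: le_trans (cl_coef_norm _ A).
  by rewrite cl_coefB.
have kN : cl_coef (h t - h 0 - t *: c) A = k t - k 0.
  by rewrite /k !cl_coefB cl_coefZ mul0r subr0 addrAC.
have sub a b s : `|a| < d -> `|b| < d -> s \in `[a, b] -> `|s| < d.
  rewrite !ltr_norml in_itv/= => /andP[a1 a2] /andP[b1 b2] /andP[s1 s2].
  by rewrite (lt_le_trans a1 s1) (le_lt_trans s2 b2).
have d0 : `|0 : R| < d by rewrite normr0 (le_lt_trans _ td).
have seg a b : a <= b -> `|a| < d -> `|b| < d -> `|k b - k a| <= e * `|b - a|.
  move=> ab ad bd.
  have [s||s sab ->] := @MVT_segment _ k dk a b ab.
  - by move=> /subset_itv_oo_cc sab; apply: kd; exact: sub sab.
  - apply: derivable_within_continuous => s sab.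
    by have [] := kd s (sub _ _ _ ad bd sab).
  by rewrite normrM ler_wpM2r// dke// (sub a b).
(* The mean value theorem wants an ordered segment, so 0 is its left or its right end according to
   the sign of [t]. *)
rewrite kN; have [t0|t0] := leP 0 t.
  by have := seg _ _ t0 d0 td; rewrite subr0.
by have := seg _ _ (ltW t0) td d0; rewrite distrC sub0r normrN.
Qed.

(** The filter is arbitrary because the lemma serves both sequences of partial sums and sums over
    growing finite sets of multi-indices. *)
Lemma limit_is_derive1 (T : Type) (F : set_system T) {FF : ProperFilter F}
    (S dS : T -> R -> Cl) (h D : R -> Cl) (d : R) : 0 < d ->
  (forall j (t : R), `|t| < d -> is_derive t 1 (S j) (dS j t)) ->
  (forall t, `|t| < d -> (S ^~ t) @ F --> h t) ->
  (forall e, 0 < e -> \forall j \near F, forall t, `|t| < d ->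
    `|dS j t - D t| <= e) ->
  {for 0, continuous D} -> is_derive (0 : R) 1 h (D 0).
Proof.
move=> d0 SdS Sh dSD Dc; apply: is_derive_cvg; apply/cvgrPdist_le => e e0.
have e20 : 0 < e / 2 by rewrite divr_gt0.
have /cvgrPdist_le/(_ _ e20)/nbhs_ballP[r/= r0 rD] := Dc.
pose d' := Num.min d r.
have d'0 : 0 < d' by rewrite lt_min d0.
have key t : `|t| < d' -> `|h t - h 0 - t *: D 0| <= e * `|t|.
  rewrite lt_min => /andP[td tr].
  have cv : (fun j => `|S j t - S j 0 - t *: D 0|) @ F --> `|h t - h 0 - t *: D 0|.
    apply: cvg_norm; apply: cvgB; last exact: cvg_cst.
    by apply: cvgB; apply: Sh => //; rewrite normr0.
  apply: (@closed_cvg _ _ F _ _ [set y : R | y <= e * `|t|] _ _ _ cv).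
    exact: closed_le.
  (* The mean value inequality holds for [S j] with slope [D 0]: half of [e] pays for replacing
     [dS j] by [D], the other half for the oscillation of [D] near 0. *)
  near=> j => /=.
  apply: (@cl_mean_value (S j) (dS j) d') => //; first exact: ltW.
  - by move=> s; rewrite lt_min => /andP[sd _]; exact: SdS.
  - move=> s; rewrite lt_min => /andP[sd sr].
    rewrite [e]splitr -[dS j s](subrK (D s)) -addrA.
    apply: le_trans (ler_normD _ _) _; apply: lerD.
      by move: s sd {sr}; near: j; exact: dSD.
    by rewrite distrC; apply: rD; rewrite /ball/= sub0r normrN.
  - by rewrite lt_min td.
near=> t.
have t0 : t != 0 by near: t; exact: nbhs_dnbhs_neq.
have td : `|t| < d'.
  near: t; apply: cvg_within; apply/nbhs_ballP; exists d' => //= s.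
  by rewrite /ball/= sub0r normrN.
rewrite addr0 [t *: 1]mulr1 distrC.
rewrite (_ : _ - _ = t^-1 *: (h t - h 0 - t *: D 0)); last first.
  by rewrite [in RHS]scalerBr scalerA mulVf// scale1r.
by rewrite normrZ normfV ler_pdivrMl ?normr_gt0// mulrC key.
Unshelve. all: by end_near. Qed.

Lemma limit_is_derive (V : normedModType R) (T : Type) (F : set_system T)
    {FF : ProperFilter F} (S dS : T -> V -> Cl) (f D : V -> Cl) (U : set V)
    (x v : V) : open U -> U x ->
  (forall j y, U y -> is_derive y v (S j) (dS j y)) ->
  (forall y, U y -> (S ^~ y) @ F --> f y) ->
  (forall e, 0 < e -> \forall j \near F, forall y, U y ->
    `|dS j y - D y| <= e) ->
  {for x, continuous D} -> is_derive x v f (D x).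
Proof.
move=> oU Ux SdS Sf dSD Dc.
have lc : (fun t : R => t *: v + x) @ (0 : R) --> x.
  rewrite -[X in _ --> X]add0r -(scale0r v).
  by apply: cvgD; [apply: cvgZl; exact: cvg_id|exact: cvg_cst].
have : \forall t \near (0 : R), U (t *: v + x).
  by apply: lc; exact: open_nbhs_nbhs.
move=> /nbhs_ballP[d /= d0 dU].
have {}dU t : `|t| < d -> U (t *: v + x).
  by move=> td; apply: dU; rewrite /ball/= sub0r normrN.
apply: line_is_derive.
have := @limit_is_derive1 T F FF (fun j t => S j (t *: v + x))
  (fun j t => dS j (t *: v + x)) (fun t => f (t *: v + x))
  (fun t => D (t *: v + x)) d d0.
rewrite scale0r add0r; apply.
- by move=> j t td; apply: is_derive_line; exact/SdS/dU.
- by move=> t td; exact/Sf/dU.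
- by move=> e e0; near=> j => t td; move: (dU t td); move: (_ + _); near: j; exact: dSD.
- rewrite /prop_for /continuous_at scale0r add0r; apply: cvg_trans Dc.
  exact: (@cvg_comp _ _ _ (fun t : R => t *: v + x) D _ _ _ lc).
Unshelve. all: by end_near. Qed.

End clifford_derive.

(** * Normally convergent series *)

Section normal_series.
Variables (R : realType) (n : nat).
Local Notation Cl := (clifford R n).

Lemma limit_continuous (V : topologicalType) (T : Type) (F : set_system T)
    {FF : ProperFilter F} (S : T -> V -> Cl) (f : V -> Cl) (U : set V) (x : V) :
  nbhs x U ->
  (forall j, {for x, continuous (S j)}) ->
  (forall e, 0 < e -> \forall j \near F, forall y, U y ->
    `|S j y - f y| <= e) ->
  {for x, continuous f}.
Proof.
move=> nU Sc Sf; apply/cvgrPdist_le => e e0.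
have e30 : 0 < e / 3 by rewrite divr_gt0.
have [j Sj] := filter_ex (Sf _ e30).
have /cvgrPdist_le/(_ _ e30) Sjc := Sc j.
near=> y.
have -> : f x - f y = (S j y - f y) + (S j x - S j y) - (S j x - f x).
  by rewrite [X in _ = X - _]addrC addrA subrK opprB [RHS]addrC addrA subrK.
rewrite (_ : e = e / 3 + e / 3 + e / 3); last by lra.
apply: le_trans (ler_normB _ _) _; apply: lerD; last first.
  by apply: Sj; exact: nbhs_singleton.
apply: le_trans (ler_normD _ _) _; apply: lerD.
  by apply: Sj; near: y.
by near: y.
Unshelve. all: by end_near. Qed.

Lemma half_sum_le N k : \sum_(N <= i < N + k) (2^-1 : R) ^+ i <= 2 * 2^-1 ^+ N.
Proof.
suff -> : \sum_(N <= i < N + k) (2^-1 : R) ^+ i = 2 * 2^-1 ^+ N - 2 * 2^-1 ^+ (N + k).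
  by rewrite gerBl mulr_ge0// exprn_ge0// invr_ge0.
elim: k => [|k IH]; first by rewrite addn0 big_geq// subrr.
rewrite addnS big_nat_recr ?leq_addr//= IH exprS.
by rewrite mulrA divff// mul1r; lra.
Qed.

Lemma half_expn_cvg0 (C : R) : (fun k => C * 2^-1 ^+ k) @ \oo --> (0 : R).
Proof.
rewrite -[X in _ --> X](mulr0 C); apply: cvgM; first exact: cvg_cst.
by apply: cvg_expr; rewrite ger0_norm ?invr_ge0// invf_lt1// ltr1n.
Qed.

Lemma half_series_cvg (C : R) : cvgn (series (fun k => C * 2^-1 ^+ k)).
Proof.
apply: is_cvg_geometric_series.
by rewrite ger0_norm ?invr_ge0// invf_lt1// ltr1n.
Qed.

(** Weierstrass test. All series below are compared with the same geometric series of ratio 1/2, and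
    only the constant varies. *)
Lemma normal_cvg (u : nat -> Cl) (C : R) :
  (forall k, `|u k| <= C * 2^-1 ^+ k) -> cvgn (series u).
Proof.
move=> uC; apply: normed_cvg.
apply: (@series_le_cvg _ _ (fun k => C * 2^-1 ^+ k)) => [k|k|k|] //=.
  exact: le_trans (uC k).
exact: half_series_cvg.
Qed.

Lemma normal_tail (u : nat -> Cl) (C : R) N :
  (forall k, `|u k| <= C * 2^-1 ^+ k) ->
  `|series u N - limn (series u)| <= 2 * C * 2^-1 ^+ N.
Proof.
move=> uC.
have C0 : 0 <= C by have := le_trans (normr_ge0 _) (uC 0%N); rewrite mulr1.
have cv : (fun M => `|series u N - series u M|) @ \oo -->
    `|series u N - limn (series u)|.
  apply: cvg_norm; apply: cvgB; first exact: cvg_cst.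
  exact: normal_cvg uC.
apply: (@closed_cvg _ _ \oo _ _ [set y : R | y <= 2 * C * 2^-1 ^+ N] _ _ _ cv).
  exact: closed_le.
exists N => // M /= NM; rewrite distrC /series/= (big_cat_nat (leq0n N) NM)/= addrAC subrr add0r.
apply: le_trans (ler_norm_sum _ _ _) _.
apply: le_trans (ler_sum _ (fun k _ => uC k)) _.
rewrite -big_distrr/= -(subnKC NM) [2 * C]mulrC -mulrA ler_wpM2l//.
exact: half_sum_le.
Qed.

Lemma normal_unif (V : Type) (U : set V) (g : nat -> V -> Cl) (C : R) :
  (forall k y, U y -> `|g k y| <= C * 2^-1 ^+ k) ->
  forall e, 0 < e -> \forall N \near \oo, forall y, U y ->
    `|series (g ^~ y) N - limn (series (g ^~ y))| <= e.
Proof.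
move=> gC e e0; near=> N => y Uy.
apply: le_trans (normal_tail N (gC ^~ y ^~ Uy)) _.
near: N; have /cvgr0_norm_le/(_ _ e0) := half_expn_cvg0 (2 * C).
by apply: filterS => N; exact: le_trans (ler_norm _).
Unshelve. all: by end_near. Qed.

Lemma series_continuous (V : topologicalType) (g : nat -> V -> Cl) (x : V) N :
  (forall k, {for x, continuous (g k)}) ->
  {for x, continuous (fun y => series (g ^~ y) N)}.
Proof.
move=> gc; elim: N => [|N IH].
  rewrite (_ : (fun _ => _) = fun=> 0); first exact: cvg_cst.
  by apply/funext => y; rewrite /series/= big_geq.
rewrite (_ : (fun _ => _) = fun y => series (g ^~ y) N + g N y).
  by apply: cvgD; [exact: IH|exact: gc].
by apply/funext => y; rewrite /series/= big_nat_recr.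
Qed.

Lemma normal_continuous (V : topologicalType) (U : set V) (g : nat -> V -> Cl)
    (C : R) (x : V) : nbhs x U ->
  (forall k y, U y -> `|g k y| <= C * 2^-1 ^+ k) ->
  (forall k, {for x, continuous (g k)}) ->
  {for x, continuous (fun y => limn (series (g ^~ y)))}.
Proof.
move=> nU gC gc; apply: (@limit_continuous _ _ \oo _ (fun N y => series (g ^~ y) N)
   _ U x nU) => [N|]; first exact: series_continuous.
exact: normal_unif gC.
Qed.

Lemma is_derive_series (V : normedModType R) (g dg : nat -> V -> Cl) (x v : V) N :
  (forall k, is_derive x v (g k) (dg k x)) ->
  is_derive x v (fun y => series (g ^~ y) N) (series (dg ^~ x) N).
Proof.
move=> gd; elim: N => [|N IH].
  rewrite (_ : (fun _ => _) = cst 0); last first.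
    by apply/funext => y; rewrite /series/= big_geq.
  by rewrite /series/= big_geq//; exact: is_derive_cst.
rewrite (_ : (fun _ => _) = (fun y => series (g ^~ y) N) + g N); last first.
  by apply/funext => y; rewrite /series/= big_nat_recr.
have -> : series (dg ^~ x) N.+1 = series (dg ^~ x) N + dg N x.
  by rewrite /series/= big_nat_recr.
have H := @is_deriveD _ _ _ (fun y => series (g ^~ y) N) (g N) x v _ _ IH (gd N).
exact: H.
Qed.

(** The bound on [g] gives pointwise convergence, the bound on [dg] uniform convergence of the
    derivatives; one constant [C] serves for both. *)
Lemma normal_is_derive (V : normedModType R) (U : set V) (g dg : nat -> V -> Cl)
    (C : R) (x v : V) : open U -> U x ->
  (forall k y, U y -> is_derive y v (g k) (dg k y)) ->
  (forall k y, U y -> `|g k y| <= C * 2^-1 ^+ k) ->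
  (forall k y, U y -> `|dg k y| <= C * 2^-1 ^+ k) ->
  (forall k, {for x, continuous (dg k)}) ->
  is_derive x v (fun y => limn (series (g ^~ y))) (limn (series (dg ^~ x))).
Proof.
move=> oU Ux gd gC dgC dgc.
apply: (@limit_is_derive _ _ _ _ \oo _ (fun N y => series (g ^~ y) N)
  (fun N y => series (dg ^~ y) N) _ (fun y => limn (series (dg ^~ y))) U) => //.
- by move=> N y Uy; apply: is_derive_series => k; exact: gd.
- by move=> y Uy; apply: normal_cvg (gC ^~ y ^~ Uy).
- exact: normal_unif dgC.
- by apply: normal_continuous dgC dgc; exact: open_nbhs_nbhs.
Qed.

End normal_series.

(** * Power series in several variables *)

Section scale_derive.
Variables (R : realType).

Lemma is_derive_scalel (V W : normedModType R) (f : V -> R) (x v : V) (df : R) (c : W) :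
  is_derive x v f df -> is_derive x v (fun y => f y *: c) (df *: c).
Proof.
move=> /cvg_is_derive K; apply: is_derive_cvg.
have : (fun h => (h^-1 *: (f (h *: v + x) - f x)) *: c) @ 0^' --> df *: c.
  exact: cvgZl.
apply: cvg_trans; apply: near_eq_cvg; near=> h.
by rewrite -scalerBl scalerA.
Unshelve. all: by end_near. Qed.

Lemma is_derive_big (V W : normedModType R) (J : Type) (s : seq J) (f : J -> V -> W)
    (x v : V) (df : J -> W) :
  (forall j, is_derive x v (f j) (df j)) ->
  is_derive x v (fun y => \sum_(j <- s) f j y) (\sum_(j <- s) df j).
Proof.
move=> fd; elim: s => [|j s IH].
  rewrite big_nil (_ : (fun _ => _) = cst 0); first exact: is_derive_cst.
  by apply/funext => y; rewrite big_nil.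
rewrite big_cons (_ : (fun _ => _) = f j + (fun y => \sum_(j <- s) f j y)).
  have H := @is_deriveD _ _ _ (f j) (fun y => \sum_(j <- s) f j y) x v _ _ (fd j) IH.
  exact: H.
by apply/funext => y; rewrite big_cons.
Qed.

Lemma big_continuous (V : topologicalType) (W : normedModType R) (J : Type)
    (s : seq J) (f : J -> V -> W) (x : V) :
  (forall j, {for x, continuous (f j)}) ->
  {for x, continuous (fun y => \sum_(j <- s) f j y)}.
Proof.
move=> fd; elim: s => [|j s IH].
  rewrite (_ : (fun _ => _) = cst 0); first exact: cvg_cst.
  by apply/funext => y; rewrite big_nil.
rewrite /prop_for /continuous_at big_cons.
rewrite (_ : (fun _ => _) = f j + (fun y => \sum_(j <- s) f j y)).
  apply: (@cvgD _ _ _ _ _ (f j) (fun y => \sum_(j <- s) f j y)); [exact: fd|exact: IH].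
by apply/funext => y; rewrite big_cons.
Qed.

End scale_derive.

(** * Multi-indices and monomials *)

Section multi_index.
Variables (R : realType) (m : nat).
Local Notation I := {ffun 'I_m -> nat}.
Implicit Types (al be : I).

Definition mdeg al : nat := \sum_(i < m) al i.

(** A finite family lies in a box of side [N], where the sum factors into [m] geometric sums, each
    at most 2. *)
Lemma half_mdeg_sum (s : seq I) : uniq s ->
  \sum_(al <- s) (2^-1 : R) ^+ mdeg al <= 2 ^+ m.
Proof.
move=> us; pose N := (\max_(al <- s) mdeg al).+1.
pose emb (f : {ffun 'I_m -> 'I_N}) : I := [ffun i => val (f i)].
have emb_inj : injective emb.
  by move=> f g /ffunP fg; apply/ffunP => i; apply/val_inj;
    have := fg i; rewrite !ffunE.
pose t := [seq emb f | f <- enum {: {ffun 'I_m -> 'I_N}}].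
have ut : uniq t by rewrite map_inj_uniq// enum_uniq.
have st : {subset s <= t}.
  move=> al als; apply/mapP.
  have alN i : (al i < N)%N.
    rewrite ltnS; apply: leq_trans (leq_bigmax_seq _ als isT).
    by rewrite /mdeg (bigD1 i)//= leq_addr.
  exists [ffun i => Ordinal (alN i)]; first by rewrite mem_enum.
  by apply/ffunP => i; rewrite !ffunE.
have -> : \sum_(al <- s) (2^-1 : R) ^+ mdeg al =
    \sum_(al <- t | al \in s) 2^-1 ^+ mdeg al.
  rewrite -[RHS]big_filter; apply: perm_big; apply: uniq_perm => //.
    exact: filter_uniq.
  move=> al; rewrite mem_filter; apply/idP/andP => [als|[]//].
  by split=> //; exact: st.
apply: le_trans (_ : \sum_(al <- t) 2^-1 ^+ mdeg al <= _).
  rewrite big_mkcond; apply: ler_sum => al _; case: ifP => // _.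
rewrite big_map big_enum/=.
under eq_bigr => f _ do (rewrite /mdeg expr_sum; under eq_bigr => i _ do
  rewrite ffunE).
rewrite -(bigA_distr_bigA (fun (i : 'I_m) (j : 'I_N) => (2^-1 : R) ^+ j)).
apply: le_trans (_ : \prod_(i < m) 2 <= _); last by rewrite prodr_const card_ord.
apply: ler_prod => i _; apply/andP; split.
  by apply: sumr_ge0 => j _; rewrite exprn_ge0// invr_ge0.
have := half_sum_le R 0 N.
by rewrite add0n big_mkord mulr1.
Qed.

(** A box is directly the image of a finite type; what matters is that it contains all multi-indices
    of degree less than [N]. *)
Definition mbox (N : nat) : {fset I} :=
  [fset x in [seq [ffun i => val (f i)] | f : {ffun 'I_m -> 'I_N}]]%fset.

Lemma mem_mbox N al : (mdeg al < N)%N -> al \in mbox N.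
Proof.
move=> alN; rewrite /mbox !inE; apply/mapP.
have {}alN i : (al i < N)%N.
  by apply: leq_ltn_trans alN; rewrite /mdeg (bigD1 i)//= leq_addr.
exists [ffun i => Ordinal (alN i)]; first by rewrite mem_enum.
by apply/ffunP => i; rewrite !ffunE.
Qed.

Definition madd (i : 'I_m) be : I := [ffun j => (be j + (j == i))%N].
(** The subtraction is truncated. When [be i] is zero the result is [be], which is harmless because
    the derivative of the monomial carries the factor [be i]. *)
Definition msub (i : 'I_m) be : I := [ffun j => (be j - (j == i))%N].

Lemma maddK i : cancel (madd i) (msub i).
Proof. by move=> be; apply/ffunP => j; rewrite !ffunE addnK. Qed.

Lemma msubK i al : (0 < al i)%N -> madd i (msub i al) = al.
Proof.
move=> ali; apply/ffunP => j; rewrite !ffunE.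
by case: eqP => [->|_]; rewrite ?subnK// subn0 addn0.
Qed.

Lemma mdeg_madd i be : mdeg (madd i be) = (mdeg be).+1.
Proof.
rewrite /mdeg -addn1; under eq_bigr do rewrite ffunE.
rewrite big_split/=; congr addn; rewrite (bigD1 i)//= eqxx big1// => j.
by move=> /negbTE ->.
Qed.

Lemma monomial_norm al (y : 'rV[R]_m) : `|monomial al y| <= `|y| ^+ mdeg al.
Proof.
rewrite /monomial normr_prod /mdeg expr_sum; apply: ler_prod => i _.
rewrite normr_ge0 normrX/= lerXn2r ?nnegrE//.
by rewrite [leRHS]mx_normrE; apply/bigmax_geP; right; exists (ord0, i).
Qed.

Lemma monomial_continuous al (a : 'rV[R]_m) :
  continuous (fun x : 'rV[R]_m => monomial al (x - a)).
Proof.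
move=> x; rewrite /monomial.
elim: (index_enum _) => [|i s IH].
  rewrite (_ : (fun _ => _) = fun=> 1); first exact: cst_continuous.
  by apply/funext => y; rewrite big_nil.
rewrite /continuous_at big_cons; under eq_fun do rewrite big_cons.
apply: (@cvgM _ _ _ _ (fun x : 'rV[R]_m => (x - a) ord0 i ^+ al i)) IH.
apply: (@cvg_comp _ _ _ (fun x : 'rV[R]_m => (x - a) ord0 i) (fun t => t ^+ al i)).
  apply: (@cvg_comp _ _ _ (fun x : 'rV[R]_m => x - a) (fun x : 'rV[R]_m => x ord0 i)).
    by apply: cvgB; [exact: cvg_id|exact: cvg_cst].
  exact: coord_continuous.
exact: exprn_continuous.
Qed.

Lemma is_derive_monomial al (a x : 'rV[R]_m) (i : 'I_m) :
  is_derive x (delta_mx ord0 i) (fun y => monomial al (y - a))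
    ((al i)%:R * monomial (msub i al) (x - a)).
Proof.
apply: line_is_derive.
pose c := \prod_(j < m | j != i) (x - a) ord0 j ^+ al j.
rewrite (_ : (fun _ => _) = fun h : R => (h + (x - a) ord0 i) ^+ al i * c); last first.
  apply/funext => h; rewrite /monomial (bigD1 i)//= !mxE !eqxx mulr1 addrA.
  congr (_ * _); apply: eq_bigr => j ji.
  by rewrite !mxE eqxx (negbTE ji) mulr0 add0r.
rewrite (_ : _ * _ = ((al i)%:R * (0 + (x - a) ord0 i) ^+ (al i).-1 *: (1 : R)) *: c :> R); last first.
  rewrite /monomial (bigD1 i)//= ffunE eqxx subn1 add0r.
  rewrite [_ *: 1]mulr1 [RHS]/( _ *: _)/= mulrA; congr (_ * _).
  by apply: eq_bigr => j ji; rewrite ffunE (negbTE ji) subn0.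
have H : is_derive (0 : R) 1 (fun h : R => h + (x - a) ord0 i) (1 : R).
  by apply: is_derive_affine => h; rewrite addr0 [h *: 1]mulr1 add0r.
have := is_derive_scalel c (is_deriveX (al i) H).
by rewrite exprfctE.
Qed.

End multi_index.

(** * Unordered sums over multi-indices *)

Section summable_family.
Variables (R : realType) (n m : nat).
Local Notation Cl := (clifford R n).
Local Notation I := {ffun 'I_m -> nat}.
Local Notation psum := summability.partial_sum.
Local Notation totally := summability.totally.
Local Existing Instance summability.totally_filter.

Lemma psumE (u : I -> Cl) (J : {fset I}) : psum u J = \sum_(al <- J) u al.
Proof. by rewrite /summability.partial_sum big_seq_fsetE. Qed.

(** Split 1/4 as 1/2 times 1/2: one factor yields the gain [2^-1 ^+ N], the other makes the family
    of multi-indices summable. *)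
Lemma quarter_sum_norm (u : I -> Cl) (B : R) N (s : seq I) : uniq s ->
  (forall al, `|u al| <= B * 4^-1 ^+ mdeg al) ->
  (forall al, al \in s -> (N <= mdeg al)%N) ->
  `|\sum_(al <- s) u al| <= B * 2 ^+ m * 2^-1 ^+ N.
Proof.
move=> us uB sN.
have B0 : 0 <= B.
  have := le_trans (normr_ge0 _) (uB [ffun=> 0%N]).
  by rewrite pmulr_lge0// exprn_gt0// invr_gt0.
apply: le_trans (ler_norm_sum _ _ _) _.
rewrite mulrAC.
apply: le_trans (_ : B * 2^-1 ^+ N * (\sum_(al <- s) 2^-1 ^+ mdeg al) <= _).
  rewrite mulr_sumr big_seq [leRHS]big_seq; apply: ler_sum => al als.
  apply: le_trans (uB al) _; rewrite -mulrA ler_wpM2l//.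
  rewrite (_ : 4^-1 = 2^-1 * 2^-1 :> R); last by rewrite -invfM -natrM.
  rewrite exprMn ler_wpM2r ?exprn_ge0 ?invr_ge0//.
  by rewrite ler_wiXn2l ?invr_ge0// ?invf_le1// ?ler1n// sN.
rewrite ler_wpM2l ?half_mdeg_sum// mulr_ge0// exprn_ge0// invr_ge0//.
Qed.

(** A finite set larger than [s] adds only terms of degree at least [N]; the bound on their sum then
    passes to the limit. *)
Lemma psum_tail (u : I -> Cl) (B : R) N (s : seq I) (S : Cl) : uniq s ->
  (forall al, `|u al| <= B * 4^-1 ^+ mdeg al) ->
  (forall al, (mdeg al < N)%N -> al \in s) ->
  psum u @ totally --> S ->
  `|\sum_(al <- s) u al - S| <= B * 2 ^+ m * 2^-1 ^+ N.
Proof.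
move=> us uB sN uS.
have cv : (fun J => `|\sum_(al <- s) u al - psum u J|) @ totally -->
    `|\sum_(al <- s) u al - S|.
  by apply: cvg_norm; apply: cvgB; [exact: cvg_cst|exact: uS].
apply: (@closed_cvg _ _ totally _ _ [set y : R | y <= B * 2 ^+ m * 2^-1 ^+ N] _ _ _ cv).
  exact: closed_le.
exists [fset x in s]%fset => // J /= /fsubsetP sJ.
have -> : psum u J = \sum_(al <- s) u al + \sum_(al <- J | al \notin s) u al.
  rewrite psumE (bigID (mem s))/=; congr (_ + _).
  rewrite -big_filter; apply: perm_big; apply: uniq_perm => //.
    by apply: filter_uniq; exact: fset_uniq.
  move=> al; rewrite mem_filter; apply/andP/idP => [[]//|als]; split => //.
  by apply: sJ; rewrite inE.
rewrite opprD addrA subrr sub0r normrN -big_filter.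
apply: quarter_sum_norm => //; first by apply: filter_uniq; exact: fset_uniq.
move=> al; rewrite mem_filter => /andP[als _]; rewrite leqNgt.
by apply: contra als; exact: sN.
Qed.

Lemma psum_cvg (u : I -> Cl) (B : R) :
  (forall al, `|u al| <= B * 4^-1 ^+ mdeg al) -> cvg (psum u @ totally).
Proof.
move=> uB; apply: (@cauchy_cvg Cl); apply: (@cauchy_exP R Cl) => e e0.
have e20 : 0 < e / 2 by rewrite divr_gt0.
have /cvgr0_norm_le/(_ _ e20)[N _ /(_ N (leqnn N))/= Ne] :=
  half_expn_cvg0 (B * 2 ^+ m).
exists (psum u (mbox m N)); exists (mbox m N) => // J /= /fsubsetP NJ.
rewrite -ball_normE/= !psumE.
rewrite [X in _ - X](bigID (fun al => al \in mbox m N))/=.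
rewrite -[X in _ - (X + _)]big_filter.
rewrite [X in _ - (X + _)](perm_big (mbox m N : seq I)); last first.
  apply: uniq_perm; [by apply: filter_uniq; exact: fset_uniq|exact: fset_uniq|].
  move=> al; rewrite mem_filter; apply/andP/idP => [[]//|als]; split => //.
  exact: NJ.
rewrite opprD addrA subrr sub0r normrN -big_filter.
apply: (@le_lt_trans _ _ (e / 2)); last by rewrite gtr_pMr// invf_lt1// ltr1n.
apply: le_trans Ne; apply: le_trans (ler_norm _).
apply: quarter_sum_norm => //; first by apply: filter_uniq; exact: fset_uniq.
move=> al; rewrite mem_filter => /andP[als _]; rewrite leqNgt.
by apply: contra als; exact: mem_mbox.
Qed.

End summable_family.

(** * Derivatives of power series with explicit bounds *)

Section power_series.
Variables (R : realType) (n m : nat).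
Local Notation Cl := (clifford R n).
Local Notation Rm := 'rV[R]_m.
Local Notation I := {ffun 'I_m -> nat}.
Local Notation psum := summability.partial_sum.
Local Notation totally := summability.totally.
Local Existing Instance summability.totally_filter.

(* The coefficients of a k-th order derivative of a power series whose
   coefficients are bounded by [C * M ^ |al|]. *)
Definition pser_bound (M C : R) (k : nat) (c : I -> Cl) : Prop :=
  forall al, `|c al| <= C * M ^+ (mdeg al + k) * ((mdeg al + k)`!%:R / (mdeg al)`!%:R).

(** Differentiation raises [k] by one and keeps [a], [rho], [M] and [C]. Iterated derivatives are
    thus controlled on one fixed ball. *)
Definition pser_at (a : Rm) (rho M C : R) (k : nat) (f : Rm -> Cl) : Prop :=
  exists2 c : I -> Cl, pser_bound M C k c &
    forall x, `|x - a| < rho ->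
      psum (fun al => monomial al (x - a) *: c al) @ totally --> f x.

(** The ratio is [k!] times a binomial coefficient, which is one summand of (1 + 1)^(N + k). *)
Lemma fact_ratio_le N k : ((N + k)`!%:R / N`!%:R : R) <= 2 ^+ (N + k) * k`!%:R.
Proof.
rewrite ler_pdivrMr ?ltr0n ?fact_gt0// -mulrA -natrX -!natrM ler_nat.
rewrite -(@bin_fact (N + k) k) ?leq_addl// addnK leq_mul//.
have := Pascal 1 1 (N + k); rewrite addn1 => ->.
have kN : (k < (N + k).+1)%N by rewrite ltnS leq_addl.
by rewrite (bigD1 (Ordinal kN))//= !exp1n !muln1 leq_addr.
Qed.

Variables (a : Rm) (rho M : R).
Hypotheses (M0 : 0 < M) (rhoM : rho * (8 * M) <= 1).

(** The binomial bound costs a factor 2 per degree; the 8 in [rhoM] leaves 2 M rho <= 1/4, the ratio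
    required by the summation lemmas. *)
Lemma pser_term_le C k (c : I -> Cl) x al : pser_bound M C k c -> `|x - a| < rho ->
  `|monomial al (x - a) *: c al| <= C * (2 * M) ^+ k * k`!%:R * 4^-1 ^+ mdeg al.
Proof.
move=> cC xa; rewrite normrZ.
have C0 : 0 <= C.
  have := le_trans (normr_ge0 _) (cC al); rewrite -mulrA pmulr_lge0//.
  by rewrite mulr_gt0 ?exprn_gt0// divr_gt0// ltr0n fact_gt0.
apply: le_trans (_ : rho ^+ mdeg al * (C * M ^+ (mdeg al + k) *
    (2 ^+ (mdeg al + k) * k`!%:R)) <= _).
  rewrite ler_pM//.
    apply: le_trans (monomial_norm _ _) _.
    by rewrite lerXn2r ?nnegrE ?(ltW xa)// (le_trans _ (ltW xa)).
  apply: le_trans (cC al) _; rewrite ler_wpM2l ?fact_ratio_le//.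
  by rewrite mulr_ge0// exprn_ge0// ltW.
rewrite (_ : _ * _ = C * (2 * M) ^+ k * k`!%:R * (rho * (2 * M)) ^+ mdeg al); last first.
  by rewrite !exprMn !exprD; ring.
have rho0 : 0 <= rho by rewrite (le_trans _ (ltW xa)).
rewrite ler_wpM2l ?mulr_ge0 ?exprn_ge0 ?mulr_ge0 ?(ltW M0)//.
rewrite lerXn2r ?nnegrE ?mulr_ge0 ?invr_ge0 ?(ltW M0)//.
have -> : rho * (2 * M) = 4^-1 * (rho * (8 * M)) by field.
by rewrite -[leRHS]mulr1 ler_wpM2l// invr_ge0.
Qed.

Lemma pser_norm C k f x : pser_at a rho M C k f -> `|x - a| < rho ->
  `|f x| <= C * (2 * M) ^+ k * k`!%:R * 2 ^+ m.
Proof.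
move=> [c cC cf] xa.
(* The tail after the empty partial sum is the whole sum. *)
have := psum_tail (s := [::]) (N := 0) isT (fun al => pser_term_le al cC xa)
  (fun al => False_ind _ \o elimF idP (ltn0 _)) (cf x xa).
by rewrite big_nil sub0r normrN mulr1.
Qed.

Lemma pser_open : open [set x : Rm | `|x - a| < rho].
Proof.
rewrite (_ : [set _ | _] = ball a rho); first exact: ball_open.
by apply/seteqP; split => x; rewrite -ball_normE/= distrC.
Qed.

Lemma pser_unif C k (c : I -> Cl) f :
  pser_bound M C k c ->
  (forall x, `|x - a| < rho ->
      psum (fun al => monomial al (x - a) *: c al) @ totally --> f x) ->
  forall e, 0 < e -> exists N, forall s : seq I, uniq s ->
    (forall al, (mdeg al < N)%N -> al \in s) ->
    forall x, `|x - a| < rho ->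
    `|\sum_(al <- s) monomial al (x - a) *: c al - f x| <= e.
Proof.
move=> cC cf e e0.
have /cvgr0_norm_le/(_ _ e0)[N _ /(_ N (leqnn N))/= Ne] :=
  half_expn_cvg0 (C * (2 * M) ^+ k * k`!%:R * 2 ^+ m).
exists N => s us Ns x xa; apply: le_trans (le_trans (ler_norm _) Ne).
exact: (psum_tail us (fun al => pser_term_le al cC xa) Ns (cf x xa)).
Qed.

Lemma pser_continuous C k f x : pser_at a rho M C k f -> `|x - a| < rho ->
  {for x, continuous f}.
Proof.
move=> [c cC cf] xa.
apply: (@limit_continuous R n Rm _ totally _
  (fun J y => \sum_(al <- (J : {fset I})) monomial al (y - a) *: c al) f
  [set y : Rm | `|y - a| < rho]).
- by apply: open_nbhs_nbhs; split => //; exact: pser_open.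
- move=> J; apply: big_continuous => al;
  apply: (@cvgZr_tmp _ _ _ (nbhs x) _ (fun y => monomial al (y - a))).
  exact: monomial_continuous.
- move=> e e0; have [N HN] := pser_unif cC cf e0.
  exists (mbox m N) => // J /= /fsubsetP NJ y ya.
  apply: HN => //; first exact: fset_uniq.
  by move=> al alN; apply: NJ; exact: mem_mbox.
Qed.

Definition dcoef (i : 'I_m) (c : I -> Cl) (be : I) : Cl := (be i).+1%:R *: c (madd i be).

(** The coefficients of the derivative are exposed, and not merely their existence, so that two
    mixed derivatives can be compared coefficient by coefficient. *)
Lemma coef_derive C k f (i : 'I_m) (c : I -> Cl) : pser_bound M C k c ->
  (forall x, `|x - a| < rho ->
      psum (fun al => monomial al (x - a) *: c al) @ totally --> f x) ->
  [/\ forall x, `|x - a| < rho -> derivable f x (delta_mx ord0 i),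
    pser_bound M C k.+1 (dcoef i c) &
    forall x, `|x - a| < rho ->
      psum (fun al => monomial al (x - a) *: dcoef i c al) @ totally -->
        'D_(delta_mx ord0 i) f x].
Proof.
move=> cC cf.
pose c' := dcoef i c.
have C0 : 0 <= C.
  have := le_trans (normr_ge0 _) (cC [ffun=> 0%N]); rewrite -mulrA pmulr_lge0//.
  by rewrite mulr_gt0 ?exprn_gt0// divr_gt0// ltr0n fact_gt0.
have cC' : pser_bound M C k.+1 c'.
  move=> be; rewrite /c' normrZ ger0_norm//.
  have := cC (madd i be); rewrite mdeg_madd addSnnS => H.
  (* The factor [be i + 1] is at most [mdeg be + 1], which cancels against the factorial in the
     denominator; this is why [C] does not grow. *)
  apply: le_trans (_ : (mdeg be).+1%:R * (C * M ^+ (mdeg be + k.+1) *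
    ((mdeg be + k.+1)`!%:R / (mdeg be).+1`!%:R)) <= _).
    rewrite ler_pM// ler_nat ltnS /mdeg (bigD1 i)//= leq_addr//.
  rewrite mulrCA ler_wpM2l ?mulr_ge0 ?exprn_ge0 ?(ltW M0)//.
  by rewrite factS natrM invfM mulrCA mulVKf// pnatr_eq0.
pose u x be := monomial be (x - a) *: c' be.
pose D x : Cl := lim (psum (u x) @ totally).
have uD x : `|x - a| < rho -> psum (u x) @ totally --> D x.
  by move=> xa; apply: (psum_cvg (fun al => pser_term_le al cC' xa)).
have pD : pser_at a rho M C k.+1 D by exists c'.
have main x : `|x - a| < rho -> is_derive x (delta_mx ord0 i) f (D x).
  move=> xa.
  apply: (@limit_is_derive R n Rm _ totally _
    (fun J y => \sum_(al <- (J : {fset I})) monomial al (y - a) *: c al)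
    (fun J y => \sum_(al <- (J : {fset I}))
       ((al i)%:R * monomial (msub i al) (y - a)) *: c al) f D
    [set y : Rm | `|y - a| < rho]).
  - exact: pser_open.
  - exact: xa.
  - move=> J y ya; apply: is_derive_big => al; apply: is_derive_scalel.
    exact: is_derive_monomial.
  - by move=> y ya; under eq_fun do rewrite -psumE; exact: cf.
  - move=> e e0; have [N HN] := pser_unif cC' uD e0.
    (* Differentiating shifts degrees down by one: a set [J] containing the degrees up to [N] is
       reindexed into a set [s] containing the degrees below [N], and indices with [al i = 0] drop
       out. *)
    exists (mbox m N.+1) => // J /= /fsubsetP NJ y ya.
    pose s := [seq msub i al | al : I <- J & (0 < al i)%N].
    have -> : \sum_(al <- J) ((al i)%:R * monomial (msub i al) (y - a)) *: c al =
        \sum_(be <- s) monomial be (y - a) *: c' be.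
      rewrite /s big_map big_filter (bigID (fun al : I => (0 < al i)%N))/=.
      rewrite [X in _ + X]big1 ?addr0; last first.
        by move=> al; rewrite -eqn0Ngt => /eqP ->; rewrite mul0r scale0r.
      apply: eq_bigr => al ali; rewrite /c' scalerA mulrC msubK//.
      by rewrite ffunE eqxx subn1 prednK.
    apply: HN => //.
      rewrite map_inj_in_uniq ?filter_uniq ?fset_uniq// => al be.
      rewrite !mem_filter => /andP[ali _] /andP[bei _] ab.
      by rewrite -(msubK ali) ab msubK.
    move=> be beN; apply/mapP; exists (madd i be); last by rewrite maddK.
    rewrite mem_filter ffunE eqxx addn1/=; apply: NJ; apply: mem_mbox.
    by rewrite mdeg_madd.
  - exact: pser_continuous pD xa.
split.
- by move=> x xa; have [] := main x xa.
- exact: cC'.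
- by move=> x xa; have [_ ->] := main x xa; exact: uD.
Qed.

Lemma pser_derive C k f (i : 'I_m) : pser_at a rho M C k f ->
  (forall x, `|x - a| < rho -> derivable f x (delta_mx ord0 i)) /\
  pser_at a rho M C k.+1 ('D_(delta_mx ord0 i) f).
Proof.
move=> [c cC cf]; have [df dC dc] := coef_derive i cC cf.
by split => //; exists (dcoef i c).
Qed.

Lemma dcoefC i j c : dcoef i (dcoef j c) = dcoef j (dcoef i c).
Proof.
have [->//|ij] := eqVneq i j.
apply/funext => be; rewrite /dcoef !scalerA !ffunE eq_sym (negbTE ij) !addn0.
rewrite mulrC; congr (_ *: c _); apply/ffunP => l; rewrite !ffunE.
by rewrite addnAC.
Qed.

(** Both mixed derivatives are sums of power series with the same coefficients. *)
Lemma pser_deriveC C k f (i j : 'I_m) x : pser_at a rho M C k f -> `|x - a| < rho ->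
  'D_(delta_mx ord0 i) ('D_(delta_mx ord0 j) f) x =
  'D_(delta_mx ord0 j) ('D_(delta_mx ord0 i) f) x.
Proof.
move=> [c cC cf] xa.
have [_ iC ic] := coef_derive i cC cf; have [_ jC jc] := coef_derive j cC cf.
have [_ _ /(_ x xa) ijc] := coef_derive j iC ic.
have [_ _ /(_ x xa) jic] := coef_derive i jC jc.
rewrite dcoefC in ijc; apply: cvg_unique jic ijc.
exact: norm_hausdorff.
Qed.

Lemma pserD C C' k f g : pser_at a rho M C k f -> pser_at a rho M C' k g ->
  pser_at a rho M (C + C') k (fun x => f x + g x).
Proof.
move=> [c cC cf] [d dC dg]; exists (fun al => c al + d al) => [al|x xa].
  rewrite 2!mulrDl; apply: le_trans (ler_normD _ _) _.
  by apply: lerD; [exact: cC|exact: dC].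
rewrite (_ : psum _ = psum (fun al => monomial al (x - a) *: c al) \+
    psum (fun al => monomial al (x - a) *: d al)).
  by apply: cvgD; [exact: cf|exact: dg].
apply/funext => J; rewrite /= !psumE -big_split; apply: eq_bigr => al _ /=.
by rewrite scalerDr.
Qed.

Lemma pser0 k : pser_at a rho M 0 k (fun=> 0).
Proof.
exists (fun=> 0) => [al|x xa]; first by rewrite normr0 !mul0r.
rewrite (_ : psum _ = cst 0); first exact: cvg_cst.
by apply/funext => J; rewrite /= psumE big1// => al _; rewrite scaler0.
Qed.

Lemma pser_sum C k (J : Type) (s : seq J) (f : J -> Rm -> Cl) :
  (forall j, pser_at a rho M C k (f j)) ->
  pser_at a rho M (C *+ size s) k (fun x => \sum_(j <- s) f j x).
Proof.
move=> fC; elim: s => [|j s IH].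
  rewrite mulr0n (_ : (fun _ => _) = fun=> 0); first exact: pser0.
  by apply/funext => x; rewrite big_nil.
rewrite (_ : (fun _ => _) = fun x => f j x + \sum_(j <- s) f j x).
  by rewrite mulrS; exact: pserD.
by apply/funext => x; rewrite big_cons.
Qed.

Lemma pserMl C k (b : Cl) f : pser_at a rho M C k f ->
  pser_at a rho M (cl_kappa R n * `|b| * C) k (fun x => b * f x).
Proof.
move=> [c cC cf]; exists (fun al => b * c al) => [al|x xa].
  apply: le_trans (cl_normM _ _) _; rewrite -(mulrA _ C) -(mulrA (_ * `|b|)).
  apply: ler_wpM2l; first by rewrite mulr_ge0 ?cl_kappa_ge0.
  exact: cC.
rewrite (_ : psum _ = fun J => b * psum (fun al => monomial al (x - a) *: c al) J).
  by apply: cl_cvgM; [exact: cvg_cst|exact: cf].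
apply/funext => J; rewrite /= !psumE mulr_sumr; apply: eq_bigr => al _ /=.
by rewrite scalerAr.
Qed.

Lemma pser_le C C' k f : C <= C' -> pser_at a rho M C k f -> pser_at a rho M C' k f.
Proof.
move=> CC [c cC cf]; exists c => // al; apply: le_trans (cC al) _.
by rewrite !ler_wpM2r ?exprn_ge0 ?(ltW M0)// divr_ge0.
Qed.

End power_series.

(** * Real analytic functions *)

Section analytic.
Variables (R : realType) (n m : nat).
Local Notation Cl := (clifford R n).
Local Notation Rm := 'rV[R]_m.
Local Notation I := {ffun 'I_m -> nat}.
Local Notation psum := summability.partial_sum.
Local Existing Instance summability.totally_filter.

(* Convergence at the diagonal point [a + (t, .., t)] bounds all but finitely
   many coefficients. *)
Lemma analytic_pser (U : set Rm) (f : Rm -> Cl) (a : Rm) :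
  real_analytic_on U f -> U a ->
  exists M C, 0 < M /\ exists2 rho0, 0 < rho0 &
    forall rho, rho <= rho0 -> pser_at a rho M C 0 f.
Proof.
move=> /[apply] -[c /nbhs_ballP[d/= d0 dc]].
pose t := d / 2; have t0 : 0 < t by rewrite divr_gt0.
pose x := a + const_mx t.
have xa : x - a = const_mx t by rewrite /x addrAC subrr add0r.
have mono al : monomial al (x - a) = t ^+ mdeg al.
  by rewrite xa /monomial /mdeg expr_sum; apply: eq_bigr => i _; rewrite mxE.
have xd : ball a d x.
  rewrite -ball_normE/= distrC xa.
  apply: (@le_lt_trans _ _ t); last by rewrite /t gtr_pMr// invf_lt1// ltr1n.
  rewrite [leLHS]mx_normrE; apply/bigmax_leP; split; first exact: ltW.
  by move=> -[i j] _ /=; rewrite mxE gtr0_norm.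
have [K [_ Kb]] : exists K : {fset I}, setT K /\
    forall J, (K `<=` J)%fset -> `|f x - psum (fun al => monomial al (x - a) *: c al) J| <= 1.
  have /cvgrPdist_le/(_ 1 ltr01)[K _ HK] := dc x xd.
  by exists K; split.
(* The finite sum takes care of the coefficients in [K]. Outside [K], a single term is the
   difference of two partial sums within 1 of [f x], whence the 2. *)
pose B := 2 + \sum_(al <- K) `|c al| * t ^+ mdeg al.
have B0 : 0 <= B.
  by rewrite addr_ge0// sumr_ge0// => al _; rewrite mulr_ge0// exprn_ge0// ltW.
have cB al : `|c al| <= B * t^-1 ^+ mdeg al.
  rewrite exprVn ler_pdivlMr ?exprn_gt0//.
  have [alK|alK] := boolP (al \in K).
    rewrite /B (big_fsetD1 al)//= addrCA lerDl addr_ge0// sumr_ge0// => be _.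
    by rewrite mulr_ge0// exprn_ge0// ltW.
  apply: (@le_trans _ _ 2); last first.
    by rewrite lerDl sumr_ge0// => be _; rewrite mulr_ge0// exprn_ge0// ltW.
  have K1 := Kb _ (fsubset_refl K).
  have K2 := Kb _ (fsubsetU1 al K).
  have -> : `|c al| * t ^+ mdeg al = `|monomial al (x - a) *: c al|.
    by rewrite normrZ mono ger0_norm ?exprn_ge0 ?(ltW t0)// mulrC.
  have -> : monomial al (x - a) *: c al =
     (f x - psum (fun al => monomial al (x - a) *: c al) K) -
     (f x - psum (fun al => monomial al (x - a) *: c al) (al |` K)%fset).
    by rewrite !psumE big_fsetU1//= opprB [RHS]addrC addrA subrK addrK.
  by apply: le_trans (ler_normB _ _) _; exact: lerD.
exists t^-1, B; split; first by rewrite invr_gt0.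
exists d => // rho rd; exists c => [al|y ya].
  by rewrite addn0 divff ?mulr1// pnatr_eq0 -lt0n fact_gt0.
by apply: dc; rewrite -ball_normE/= distrC; exact: lt_le_trans rd.
Qed.

Lemma pser_analytic (U : set Rm) (f : Rm -> Cl) :
  (forall a, U a -> exists rho M C k, 0 < rho /\ pser_at a rho M C k f) ->
  real_analytic_on U f.
Proof.
move=> Uf a /Uf[rho [M [C [k [rho0 [c _ cf]]]]]]; exists c.
apply/nbhs_ballP; exists rho => //= x; rewrite -ball_normE/= distrC.
exact: cf.
Qed.

Lemma analytic_local (U : set Rm) (f : Rm -> Cl) (a : Rm) : open U ->
  real_analytic_on U f -> U a ->
  exists M C rho, [/\ 0 < M, 0 < rho, rho * (8 * M) <= 1, pser_at a rho M C 0 f &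
    forall x, `|x - a| < rho -> U x].
Proof.
move=> oU fU Ua; have [M [C [M0 [rho0 rho00 rhof]]]] := analytic_pser fU Ua.
have /nbhs_ballP[r/= r0 rU] : nbhs a U by exact: open_nbhs_nbhs.
(* Three constraints: validity of the expansion, inclusion in [U], and the smallness condition
   [rhoM]. *)
pose rho := Num.min (Num.min rho0 r) (8 * M)^-1.
have M8 : 0 < (8 * M)^-1 by rewrite invr_gt0 mulr_gt0.
exists M, C, rho; split => //.
- by rewrite !lt_min rho00 r0 M8.
- by rewrite -ler_pdivlMr ?mulr_gt0// mul1r ge_min lexx orbT.
- by apply: rhof; rewrite !ge_min lexx.
- move=> x xa; apply: rU; rewrite -ball_normE/= distrC; apply: lt_le_trans xa _.
  by rewrite !ge_min lexx orbT.
Qed.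

Lemma analytic_derivable (U : set Rm) (f : Rm -> Cl) (i : 'I_m) x : open U ->
  real_analytic_on U f -> U x -> derivable f x (delta_mx ord0 i).
Proof.
move=> oU fU Ux; have [M [C [rho [M0 rho0 rhoM pf _]]]] := analytic_local oU fU Ux.
by have [+ _] := pser_derive M0 rhoM i pf; apply; rewrite subrr normr0.
Qed.

Lemma analytic_derive (U : set Rm) (f : Rm -> Cl) (i : 'I_m) : open U ->
  real_analytic_on U f -> real_analytic_on U ('D_(delta_mx ord0 i) f).
Proof.
move=> oU fU; apply: pser_analytic => a Ua.
have [M [C [rho [M0 rho0 rhoM pf _]]]] := analytic_local oU fU Ua.
by have [_ pdf] := pser_derive M0 rhoM i pf; exists rho, M, C, 1%N.
Qed.

Lemma analytic_deriveC (U : set Rm) (f : Rm -> Cl) (i j : 'I_m) x : open U ->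
  real_analytic_on U f -> U x ->
  'D_(delta_mx ord0 i) ('D_(delta_mx ord0 j) f) x =
  'D_(delta_mx ord0 j) ('D_(delta_mx ord0 i) f) x.
Proof.
move=> oU fU Ux; have [M [C [rho [M0 rho0 rhoM pf _]]]] := analytic_local oU fU Ux.
by apply: (pser_deriveC M0 rhoM i j pf); rewrite subrr normr0.
Qed.

Lemma analytic_continuous (U : set Rm) (f : Rm -> Cl) x : open U ->
  real_analytic_on U f -> U x -> {for x, continuous f}.
Proof.
move=> oU fU Ux; have [M [C [rho [M0 rho0 rhoM pf _]]]] := analytic_local oU fU Ux.
by apply: (pser_continuous M0 rhoM pf); rewrite subrr normr0.
Qed.

Lemma analytic_add (U : set Rm) (f g : Rm -> Cl) :
  real_analytic_on U f -> real_analytic_on U g -> real_analytic_on U (fun x => f x + g x).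
Proof.
move=> fU gU a Ua; have [c cf] := fU a Ua; have [d dg] := gU a Ua.
exists (fun al => c al + d al); near=> x.
rewrite (_ : psum _ = psum (fun al => monomial al (x - a) *: c al) \+
    psum (fun al => monomial al (x - a) *: d al)).
  by apply: cvgD; [near: x|near: x].
apply/funext => J; rewrite /= !psumE -big_split; apply: eq_bigr => al _ /=.
by rewrite scalerDr.
Unshelve. all: by end_near. Qed.

Lemma analytic0 (U : set Rm) : real_analytic_on U (fun=> 0 : Cl).
Proof.
move=> a Ua; exists (fun=> 0); near=> x.
rewrite (_ : psum _ = cst 0); first exact: cvg_cst.
by apply/funext => J; rewrite /= psumE big1// => al _; rewrite scaler0.
Unshelve. all: by end_near. Qed.

Lemma analytic_sum (U : set Rm) (J : Type) (s : seq J) (f : J -> Rm -> Cl) :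
  (forall j, real_analytic_on U (f j)) ->
  real_analytic_on U (fun x => \sum_(j <- s) f j x).
Proof.
move=> fU; elim: s => [|j s IH].
  rewrite (_ : (fun _ => _) = fun=> 0); first exact: analytic0.
  by apply/funext => x; rewrite big_nil.
rewrite (_ : (fun _ => _) = fun x => f j x + \sum_(j <- s) f j x).
  exact: analytic_add.
by apply/funext => x; rewrite big_cons.
Qed.

Lemma analytic_Ml (U : set Rm) (b : Cl) (f : Rm -> Cl) :
  real_analytic_on U f -> real_analytic_on U (fun x => b * f x).
Proof.
move=> fU a Ua; have [c cf] := fU a Ua; exists (fun al => b * c al); near=> x.
rewrite (_ : psum _ = fun J => b * psum (fun al => monomial al (x - a) *: c al) J).
  by apply: cl_cvgM; [exact: cvg_cst|near: x].
apply/funext => J; rewrite /= !psumE mulr_sumr; apply: eq_bigr => al _ /=.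
by rewrite scalerAr.
Unshelve. all: by end_near. Qed.

End analytic.

(** * Moments of the sphere *)

Section sphere_integrals.
Variable R : realType.
Local Notation mR := (measurableTypeR R).
Local Notation leb := (@lebesgue_measure R).
Local Notation L n := (@lebesgue_tup R n).
Local Notation T n := (n.-tuple mR).

Lemma bounded_integrable d (X : measurableType d) (mu : {measure set X -> \bar R})
    (D : set X) (f : X -> R) : measurable D -> (mu D < +oo)%E -> measurable_fun D f ->
  (exists C : R, forall t, D t -> `|f t| <= C) -> mu.-integrable D (EFin \o f).
Proof.
move=> mD Df mf [C fC]; apply: measurable_bounded_integrable => //.
exists C; split; first exact: num_real.
by move=> E CE t Dt; exact: le_trans (fC t Dt) (ltW CE).
Qed.

(** * Cubes and Fubini for Lebesgue measure on tuples *)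

Definition box_tup (n : nat) (c : R) : set (T n) :=
  [set t | forall i, - c <= tnth t i <= c].

Arguments box_tup n c : clear implicits.

Lemma measurable_box_tup n c : measurable (@box_tup n c).
Proof.
have -> : @box_tup n c = \bigcap_(i in [set: 'I_n]) ((fun t => tnth t i : mR) @^-1` `[- c, c]).
  apply/seteqP; split => t /=; first by move=> H i _ /=; rewrite in_itv/=; exact: H.
  by move=> H i; have := H i I; rewrite /= in_itv.
apply: fin_bigcap_measurable => // i _.
rewrite -[X in measurable X]setTI; apply: measurable_tnth => //.
Qed.

Lemma cons_tup_box n c : @cons_tup R n @^-1` box_tup n.+1 c =
  `[- c, c]%classic `*` box_tup n c.
Proof.
apply/seteqP; split => -[z t] /=.
  move=> H; split => /=.
    by have := H ord0; rewrite in_itv/= tnth0.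
  by move=> i; have := H (lift ord0 i); rewrite tnthS.
move=> [/= zc tc] i; case: (unliftP ord0 i) => [j|] ->.
  by rewrite tnthS; exact: tc.
by rewrite tnth0; move: zc; rewrite in_itv.
Qed.

Lemma lebesgue_segment (c : R) : 0 <= c -> leb `[- c, c]%classic = (2 * c)%:E.
Proof.
move=> c0; rewrite lebesgue_measure_itv/= lte_fin; case: ltP => [_|c1].
  by rewrite -EFinD opprK mulr_natl mulr2n.
have c0' : c <= 0 by lra.
by rewrite (le_anti (introT andP (conj c0' c0))) mulr0.
Qed.

Lemma lebesgue_tupS n (A : set (T n.+1)) :
  L n.+1 A = (leb \x L n)%E (@cons_tup R n @^-1` A).
Proof. by []. Qed.

Lemma lebesgue_box n (c : R) : 0 <= c -> L n (box_tup n c) = ((2 * c) ^+ n)%:E.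
Proof.
move=> c0; elim: n => [|n IH].
  rewrite /= diracE mem_set// => i; by case: i.
rewrite lebesgue_tupS cons_tup_box product_measure1E; last 2 first.
- exact: measurable_itv.
- exact: measurable_box_tup.
transitivity ((2 * c)%:E * ((2 * c) ^+ n)%:E)%E; last by rewrite -EFinM exprS.
congr (_ * _)%E; [exact: lebesgue_segment|exact: IH].
Qed.

(** A class of integrable functions stable under freezing the first coordinate, so that Fubini can
    be used by induction on the dimension. *)
Definition box_supported n (F : T n -> R) : Prop :=
  [/\ measurable_fun setT F, exists C : R, forall t, `|F t| <= C &
      forall t, ~ box_tup n 1 t -> F t = 0].

Lemma box_supported_integrable n (F : T n -> R) : box_supported F -> (L n).-integrable setT (EFin \o F).
Proof.
move=> [mF [C FC] F0].
have mB := @measurable_box_tup n 1.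
have : (L n).-integrable (box_tup n 1) (EFin \o F).
  apply: bounded_integrable => //; last by exists C.
    exact: (eq_ind_r (fun x => (x < +oo)%E) (ltry _) (@lebesgue_box n 1 ler01)).
  exact: measurable_funTS.
move/(integrable_mkcond _ mB); congr (integrable _ _ _).
apply/funext => t; rewrite /patch; case: ifPn => // /negP tB.
have tB' : ~ box_tup n 1 t by move=> tb; apply: tB; exact: mem_set.
by rewrite /= F0.
Qed.

Lemma box_supported_cons n (F : T n.+1 -> R) (z : mR) : box_supported F ->
  box_supported (fun t => F (cons_tup (z, t))).
Proof.
move=> [mF [C FC] F0]; split.
- apply: (measurableT_comp mF).
  apply: (measurableT_comp (@measurable_cons_tup R n)).
  exact: measurable_pair1.
- by exists C => t.
- move=> t tB; apply: F0 => tB'; apply: tB => i.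
  by have := tB' (lift ord0 i); rewrite tnthS.
Qed.

Lemma integral_lebesgue_cons n (F : T n.+1 -> R) : box_supported F ->
  (\int[L n.+1]_t (F t)%:E = \int[leb]_z \int[L n]_t (F (cons_tup (z, t)))%:E)%E /\
  (\int[L n.+1]_t (F t)%:E = \int[L n]_t \int[leb]_z (F (cons_tup (z, t)))%:E)%E.
Proof.
move=> nF; have iF := box_supported_integrable nF; have [mF _ _] := nF.
have iF' : (leb \x L n)%E.-integrable setT ((EFin \o F) \o @cons_tup R n).
  apply/integrableP; split.
    apply/measurable_EFinP; apply: (measurableT_comp mF).
    exact: measurable_cons_tup.
  have /integrableP[_] := iF; apply: le_lt_trans.
  have := @ge0_integral_pushforward _ _ _ _ _ _ (@measurable_cons_tup R n)
    (leb \x L n)%E setT (fun t => `|(F t)%:E|)%E measurableT.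
  rewrite preimage_setT => <- //.
  by apply: measurableT_comp => //; exact/measurable_EFinP.
have -> : (\int[L n.+1]_t (F t)%:E =
    \int[(leb \x L n)%E]_w (F (@cons_tup R n w))%:E)%E.
  have -> := @integral_pushforward _ _ _ _ _ _ (@measurable_cons_tup R n)
    (leb \x L n)%E setT (EFin \o F).
  - by rewrite preimage_setT.
  - exact/measurable_EFinP.
  - by rewrite preimage_setT; exact: iF'.
  - exact: measurableT.
split; [rewrite -(integral12_prod_meas1 iF')|rewrite -(integral21_prod_meas1 iF')];
  by rewrite /fubini_F /fubini_G.
Qed.

Definition set_tup n (i : 'I_n) (s : mR) (t : T n) : T n :=
  [tuple if j == i then s else tnth t j | j < n].

(** The [i]-th coordinate is integrated innermost: for [i = 0] by exchanging the two integrals,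
    otherwise by freezing the first coordinate and inducting. *)
Lemma integral_coord_eq0 n (i : 'I_n) (F : T n -> R) : box_supported F ->
  (forall t, \int[leb]_s (F (set_tup i s t))%:E = 0)%E ->
  (\int[L n]_t (F t)%:E = 0)%E.
Proof.
elim: n i F => [[]//|n IH] i F nF F0.
have [E1 E2] := integral_lebesgue_cons nF.
case: (unliftP ord0 i) F0 => [j|] -> F0.
  rewrite E1; apply: integral0_eq => z _; apply: (IH j); first exact: box_supported_cons.
  move=> t; rewrite -(F0 (cons_tup (z, t))); apply: eq_integral => s _.
  congr (F _)%:E; apply: eq_from_tnth => k; rewrite tnth_mktuple.
  case: (unliftP ord0 k) => [k'|] ->.
    by rewrite (inj_eq lift_inj) !tnthS tnth_mktuple.
  by rewrite !tnth0.
rewrite E2; apply: integral0_eq => t _.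
(* The entry 0 is a dummy that [set_tup] overwrites. *)
rewrite -[RHS](F0 (cons_tup (0, t))); apply: eq_integral => s _.
congr (F _)%:E; apply: eq_from_tnth => k; rewrite tnth_mktuple.
case: (unliftP ord0 k) => [k'|] ->; first by rewrite !tnthS.
by rewrite !tnth0.
Qed.

(** * Scaling of Lebesgue measure *)

Definition scale_tup n (s : R) (t : T n) : T n := [tuple (s * tnth t i : mR) | i < n].

Lemma measurable_scale_tup n s : measurable_fun setT (@scale_tup n s).
Proof.
apply/measurable_fun_tnthP => i.
rewrite (_ : _ \o _ = fun t => s * tnth t i); last first.
  by apply/funext => t /=; rewrite tnth_mktuple.
by apply: measurable_funM => //; exact: measurable_tnth.
Qed.

Lemma lebesgue_scale1 (s : R) (A : set mR) : 0 < s -> measurable A ->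
  leb ((fun z : mR => s * z : mR) @^-1` A) = (s^-1%:E * leb A)%E.
Proof.
move=> s0 mA.
have ms : measurable_fun setT (fun z : mR => s * z : mR) by exact: measurable_funM.
have sp : 0 <= s by exact: ltW.
(* By uniqueness it is enough to compare the measures on half-open intervals. Measurability of the
   map, on which the measure structure of the pushforward depends, is left open in [E] and becomes
   its premise. *)
have E : leb A = mscale (NngNum sp) (pushforward leb (fun z : mR => s * z : mR)) A.
  move=> ms'; apply: lebesgue_measure_unique => // X [[a b] /= ab <-].
  rewrite /mscale/= /pushforward lebesgue_measure_itv/=.
  rewrite (_ : _ @^-1` _ = `]a / s, b / s]%classic); last first.
    apply/seteqP; split => z /=; rewrite !in_itv/= ltr_pdivrMr// ler_pdivlMr//;
      by rewrite mulrC.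
  rewrite lebesgue_measure_itv/= !lte_fin ltr_pM2r ?invr_gt0//.
  case: ifP => _; last by rewrite mule0.
  by rewrite -!EFinD -EFinM -mulrBl mulrC mulfVK// gt_eqF.
rewrite (E ms) /mscale/= /pushforward muleA -EFinM mulVf ?mul1e//.
by rewrite gt_eqF.
Qed.

Lemma lebesgue_scale n (s : R) (A : set (T n)) : 0 < s -> measurable A ->
  L n (@scale_tup n s @^-1` A) = (((s ^+ n)^-1)%:E * L n A)%E.
Proof.
move=> s0; elim: n A => [|n IH] A mA.
  rewrite expr0 invr1 mul1e; congr (L 0 _); apply/seteqP.
  by split => t /=; rewrite (tuple0 t) (tuple0 (scale_tup _ _)).
pose S (w : mR * T n) : mR * T n := (s * w.1 : mR, scale_tup s w.2).
have mS : measurable_fun setT S.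
  apply: measurable_fun_pair; first by apply: measurable_funM => //; exact: measurable_fst.
  by apply: measurableT_comp measurable_snd; exact: measurable_scale_tup.
have sp : 0 <= s ^+ n.+1 by rewrite exprn_ge0// ltW.
have sne k : s ^+ k != 0 by rewrite gt_eqF// exprn_gt0.
(* Uniqueness of the product measure: rectangles suffice, and there the one-dimensional case and the
   induction hypothesis multiply. *)
have E : forall X, measurable X -> (leb \x L n)%E X =
    mscale (NngNum sp) (pushforward (leb \x L n)%E S) X.
  move=> mS' X mX; apply: product_measure_unique => // B C mB mC.
  rewrite /mscale/= /pushforward.
  transitivity ((s ^+ n.+1)%:E * (leb \x L n)%E
     (((fun z : mR => (s * z)%R : mR) @^-1` B) `*` (@scale_tup n s @^-1` C)))%E; first by [].
  rewrite product_measure1E; last 2 first.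
  - rewrite -[X in measurable X]setTI.
    by apply: (_ : measurable_fun setT (fun z : mR => s * z : mR)) => //;
      exact: measurable_funM.
  - by rewrite -[X in measurable X]setTI; apply: measurable_scale_tup.
  transitivity ((s ^+ n.+1)%:E * ((s^-1)%:E * leb B * (((s ^+ n)^-1)%:E * L n C)))%E.
    congr (_ * (_ * _))%E; [exact: lebesgue_scale1|exact: IH].
  have K (a b c : R) (x y : \bar R) : a * (b * c) = 1 ->
      (a%:E * (b%:E * x * (c%:E * y)) = x * y)%E.
    by move=> abc; rewrite muleA (muleA a%:E) -EFinM muleA (muleAC _ x) -EFinM -mulrA abc mul1e.
  by apply: K; rewrite exprS -invfM divff// mulf_neq0// gt_eqF.
have mcA : measurable (@cons_tup R n @^-1` A).
  by rewrite -[X in measurable X]setTI; exact: measurable_cons_tup.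
rewrite !lebesgue_tupS.
have -> : (leb \x L n)%E (@cons_tup R n @^-1` A) =
    ((s ^+ n.+1)%:E * (leb \x L n)%E (S @^-1` (@cons_tup R n @^-1` A)))%E.
  exact: (E mS _ mcA).
rewrite muleA -EFinM mulVf// mul1e; congr (_ _); apply/seteqP.
suff H w : scale_tup s (cons_tup w) = cons_tup (S w).
  by split => w /=; rewrite H.
apply: eq_from_tnth => i; rewrite tnth_mktuple.
by case: (unliftP ord0 i) => [j|] ->; rewrite ?tnth0// !tnthS tnth_mktuple.
Qed.

Local Notation N t := (enorm (row_of_tup t)).

Definition dtup n (t : T n) (x : 'rV[R]_n) : R := \sum_(i < n) tnth t i * x ord0 i.

Lemma enorm_sqr n (x : 'rV[R]_n) : enorm x ^+ 2 = \sum_(i < n) x ord0 i ^+ 2.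
Proof.
rewrite /enorm sqr_sqrtr /dot; first by apply: eq_bigr => i _; rewrite expr2.
by apply: sumr_ge0 => i _; rewrite -expr2 sqr_ge0.
Qed.

Lemma enorm_tup_sqr n (t : T n) : N t ^+ 2 = \sum_(i < n) tnth t i ^+ 2.
Proof. by rewrite enorm_sqr; apply: eq_bigr => i _; rewrite mxE. Qed.

Lemma enorm_ge0 n (x : 'rV[R]_n) : 0 <= enorm x.
Proof. exact: sqrtr_ge0. Qed.

Lemma enorm_scale n (s : R) (t : T n) : 0 <= s -> N (scale_tup s t) = s * N t.
Proof.
move=> s0; apply/eqP; rewrite -(@eqrXn2 _ 2) ?enorm_ge0 ?mulr_ge0 ?enorm_ge0//.
rewrite exprMn !enorm_tup_sqr mulr_sumr; apply/eqP; apply: eq_bigr => i _.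
by rewrite tnth_mktuple exprMn.
Qed.

Lemma coord_le_enorm_row n (x : 'rV[R]_n) i : `|x ord0 i| <= enorm x.
Proof.
rewrite /enorm -sqrtr_sqr ler_wsqrtr// expr2 /dot (bigD1 i)//= lerDl.
by rewrite sumr_ge0// => j _; rewrite -expr2 sqr_ge0.
Qed.

Lemma coord_le_enorm n (t : T n) i : `|tnth t i| <= N t.
Proof. by have := coord_le_enorm_row (row_of_tup t) i; rewrite mxE. Qed.

Lemma tup_normalize n (t : T n) i : tnth t i = N t * tnth (normalize_tup t) i.
Proof.
rewrite tnth_mktuple; have [N0|N0] := eqVneq (N t) 0; last by rewrite mulrCA divff// mulr1.
by have := coord_le_enorm t i; rewrite N0 normr_le0 => /eqP ->; rewrite mul0r.
Qed.

Lemma normalize_scale n (s : R) (t : T n) : 0 < s ->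
  normalize_tup (scale_tup s t) = normalize_tup t.
Proof.
move=> s0; apply: eq_from_tnth => i; rewrite !tnth_mktuple enorm_scale ?(ltW s0)//.
by rewrite invfM mulrACA divff ?mul1r// gt_eqF.
Qed.

Lemma ball_box n : @ball_tup R n `<=` box_tup n 1.
Proof.
by move=> t tB i; rewrite -ler_norml; exact: le_trans (coord_le_enorm _ _) tB.
Qed.

Lemma lebesgue_ball_fin n : (L n (@ball_tup R n) < +oo)%E.
Proof.
apply: (@le_lt_trans _ _ (L n (box_tup n 1))).
  apply: le_measure; [apply: mem_set; exact: (@measurable_ball_tup R n)|
    apply: mem_set; exact: (@measurable_box_tup n 1)|exact: ball_box].
exact: (eq_ind_r (fun x => (x < +oo)%E) (ltry _) (@lebesgue_box n 1 ler01)).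
Qed.

(** * Radial integrals over the ball *)

Section homogeneous.
Variables (n : nat) (h : T n -> R).
Hypotheses (mh : measurable_fun setT h) (h0 : forall t, 0 <= h t).
Hypothesis hs : forall s t, 0 < s -> h (scale_tup s t) = h t.
Hypothesis hb : exists C : R, forall t, `|h t| <= C.

Let G : R := fine (\int[L n]_(t in @ball_tup R n) (h t)%:E).

Lemma ball_integrable : (L n).-integrable (@ball_tup R n) (EFin \o h).
Proof.
have [C hC] := hb; apply: bounded_integrable; last by exists C.
- exact: measurable_ball_tup.
- exact: lebesgue_ball_fin.
- exact: measurable_funTS.
Qed.

Lemma ball_integralE : (\int[L n]_(t in @ball_tup R n) (h t)%:E = G%:E)%E.
Proof. by rewrite /G fineK//; apply: integrable_fin_num ball_integrable; exact: measurable_ball_tup. Qed.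

Lemma measurable_enorm_le (r : R) : measurable [set t : T n | (N t <= r)%R].
Proof.
rewrite (_ : [set _ | _] = setT `&` (fun t => N t) @^-1` `]-oo, r]).
  by apply: measurable_enorm_tup => //; exact: measurable_itv.
by rewrite setTI; apply/seteqP; split => t /=; rewrite in_itv.
Qed.

Lemma measurable_shell (r : R) : measurable [set t : T n | (r < N t <= 1)%R].
Proof.
rewrite (_ : [set _ | _] = @ball_tup R n `\` [set t : T n | (N t <= r)%R]).
  by apply: measurableD; [exact: measurable_ball_tup|exact: measurable_enorm_le].
apply/seteqP; split => t /=.
  by move=> /andP[rt t1]; split => //; apply/negP; rewrite -ltNge.
by move=> [t1 /negP]; rewrite -ltNge => ->.
Qed.

(** Change of variables t -> r t: Lebesgue measure is r^n times its image under this map, and [h] is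
    invariant. *)
Lemma small_ball_integral (r : R) : 0 < r ->
  (\int[L n]_(t in [set t : T n | (N t <= r)%R]) (h t)%:E = (r ^+ n * G)%:E)%E.
Proof.
move=> r0; have rp : 0 <= r ^+ n by rewrite exprn_ge0// ltW.
have E : forall A, measurable A -> L n A =
    mscale (NngNum rp) (pushforward (L n) (@scale_tup n r)) A.
  move=> ms' A mA; rewrite /mscale/= /pushforward lebesgue_scale//.
  by rewrite muleA -EFinM divff ?mul1e// gt_eqF// exprn_gt0.
have ms := @measurable_scale_tup n r.
have mf : measurable_fun setT (fun t => (h t)%:E) by exact/measurable_EFinP.
rewrite (@eq_measure_integral _ _ _ _
  (mscale (NngNum rp) (pushforward (L n) (@scale_tup n r))) (L n)); last first.
  by move=> A mA _; exact: (E ms).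
rewrite ge0_integral_mscale//; last 3 first.
- exact: measurable_enorm_le.
- exact: measurable_funTS.
- by move=> t _; rewrite lee_fin.
rewrite ge0_integral_pushforward//; last 3 first.
- exact: measurable_enorm_le.
- exact: measurable_funTS.
- by move=> t _; rewrite lee_fin.
rewrite EFinM -ball_integralE; congr (_ * _)%E.
rewrite (_ : _ @^-1` _ = @ball_tup R n); last first.
  apply/seteqP; split => t; rewrite /ball_tup/= enorm_scale ?(ltW r0)//;
    by rewrite -{2}(mulr1 r) ler_pM2l.
by apply: eq_integral => t _ /=; rewrite hs.
Qed.

Lemma shell_integral (r : R) : 0 < r <= 1 ->
  (\int[L n]_(t in [set t : T n | (r < N t <= 1)%R]) (h t)%:E = ((1 - r ^+ n) * G)%:E)%E.
Proof.
move=> /andP[r0 r1].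
have mS := measurable_shell r; have mB := measurable_enorm_le r.
have Bu : [set t : T n | (N t <= r)%R] `|` [set t : T n | (r < N t <= 1)%R] = @ball_tup R n.
  apply/seteqP; split => t /=.
    by move=> [tr|/andP[_ //]]; exact: le_trans r1.
  by rewrite /ball_tup/= => t1; case: (leP (N t) r) => rt; [left|right].
have := ball_integralE.
rewrite -{1}Bu ge0_integral_setU//; last 3 first.
- by apply/measurable_EFinP; exact: measurable_funTS.
- by move=> t _; rewrite lee_fin.
- apply/disj_setPS => t [/= tr /andP[rt _]].
  by move: (lt_le_trans rt tr); rewrite ltxx.
rewrite small_ball_integral//.
set X := (\int[_]_(_ in _) _)%E => XG.
have : X = (G%:E - (r ^+ n * G)%:E)%E by rewrite -XG addeC addeK.
by move=> ->; rewrite -EFinB mulrBl mul1r.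
Qed.

Lemma FTC_itv (a b : R) (f F : R -> R) : a <= b ->
  (forall x : R, is_derive x 1 F (f x)) -> continuous f ->
  (\int[leb]_(x in `[a, b]) (f x)%:E = (F b - F a)%:E)%E.
Proof.
move=> ab Ff cf; move: ab; rewrite le_eqVlt => /predU1P[->|ab].
  by rewrite set_itv1 integral_set1 subrr.
rewrite (@continuous_FTC2 R f F a b)//.
- exact: continuous_subspaceT.
- have cF : continuous F.
    by move=> x; apply: differentiable_continuous; apply/derivable1_diffP; have [] := Ff x.
  split.
  + by move=> x _; have [] := Ff x.
  + by apply: cvg_at_right_filter; exact: cF.
  + by apply: cvg_at_left_filter; exact: cF.
- by move=> x _; rewrite derive1E; have [_ ->] := Ff x.
Qed.

Lemma is_derive_expr k (c x : R) :
  is_derive x 1 (fun s : R => s ^+ k.+1 * c) (k.+1%:R * x ^+ k * c).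
Proof.
have := is_derive_scalel c (is_deriveX k.+1 (is_derive_id x (1 : R))).
by rewrite exprfctE /= [_ *: 1]mulr1.
Qed.

Lemma expr_continuous k (c : R) : continuous (fun s : R => k.+1%:R * s ^+ k * c).
Proof.
move=> x; apply: cvgM; last exact: cvg_cst.
by apply: cvgM; [exact: cvg_cst|exact: exprn_continuous].
Qed.

(* Layer cake: [N t ^+ k] is the integral of [k s ^+ (k - 1)] over [0 < s < N t],
   and the integral of [h] over a shell is known by homogeneity. *)
Lemma radial_integral k : (0 < k)%N -> (0 < n)%N ->
  (\int[L n]_(t in @ball_tup R n) (N t ^+ k * h t)%:E =
    (n%:R / (n + k)%:R * G)%:E)%E.
Proof.
case: k => // k _ n0.
(* The layer-cake integrand on pairs (t, s), where the exponent of [N t] is now [k.+1]. Integrating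
   in [s] first gives the left-hand side, in [t] first the shells. *)
pose f (w : T n * mR) : \bar R :=
  (if (0 < w.2 :> R) && (w.2 < N w.1) && (N w.1 <= 1) then k.+1%:R * (w.2 : R) ^+ k * h w.1
   else 0)%:E.
have mN : measurable_fun setT (fun w : T n * mR => N w.1).
  by apply: (measurableT_comp (@measurable_enorm_tup R n)); exact: measurable_fst.
have m2 : measurable_fun setT (fun w : T n * mR => w.2 : R) by exact: measurable_snd.
have mf : measurable_fun setT f.
  apply/measurable_EFinP; apply: measurable_fun_ifT => //.
    apply: measurable_and; last by apply: measurable_fun_ler.
    by apply: measurable_and; apply: measurable_fun_ltr.
  apply: measurable_funM; last by apply: (measurableT_comp mh); exact: measurable_fst.
  by apply: measurable_funM => //; exact: measurable_funX.
have f0 w : (0 <= f w)%E.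
  rewrite lee_fin; case: ifP => // /andP[/andP[w0 _] _].
  by rewrite !mulr_ge0// exprn_ge0// ltW.
have := @fubini_tonelli _ _ _ _ _ (L n) leb f mf f0.
have -> : (\int[L n]_t \int[leb]_s f (t, s) =
    \int[L n]_(t in @ball_tup R n) (N t ^+ k.+1 * h t)%:E)%E.
  rewrite [RHS]integral_mkcond; apply: eq_integral => t _; rewrite /patch /f/=.
  case: ifPn => [/set_mem|/negP tB]; last first.
    rewrite integral0_eq// => s _; case: ifP => // /andP[_ t1].
    by exfalso; apply: tB; exact: mem_set.
  rewrite /ball_tup/= => t1.
  transitivity (\int[leb]_(s in `]0%R, N t[) (k.+1%:R * s ^+ k * h t)%:E)%E.
    rewrite [RHS]integral_mkcond; apply: eq_integral => s _; rewrite /patch.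
    rewrite t1 andbT; case: ifPn => [st|/negP st]; first by rewrite mem_set//= in_itv.
    by case: ifPn => // /set_mem/=; rewrite in_itv.
  have mc D : measurable_fun D (fun s : R => (k.+1%:R * s ^+ k * h t)%:E).
    by apply/measurable_EFinP; apply: measurable_funTS;
      apply: continuous_measurable_fun; exact: expr_continuous.
  rewrite integral_itv_bndo_bndc// integral_itv_obnd_cbnd//.
  transitivity ((N t ^+ k.+1 * h t - 0 ^+ k.+1 * h t)%:E); last first.
    by rewrite expr0n/= mul0r subr0.
  apply: (@FTC_itv _ _ _ (fun s => s ^+ k.+1 * h t)).
  - exact: enorm_ge0.
  - by move=> x; exact: is_derive_expr.
  - exact: expr_continuous.
move=> ->.
(* The shell contributes (k + 1) s^k (1 - s^n) G, arranged as a difference of two exact derivatives.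
   Integration gives 1 - (k + 1) / (n + k + 1) = n / (n + k + 1). *)
transitivity (\int[leb]_(s in `]0%R, 1%R]) (k.+1%:R * s ^+ k * G -
     k.+1%:R / (n + k.+1)%:R * ((n + k).+1%:R * s ^+ (n + k) * G))%:E)%E.
  rewrite [RHS]integral_mkcond; apply: eq_integral => s _; rewrite /patch /f/=.
  case: ifPn => [/set_mem/=|/negP s01]; last first.
    rewrite integral0_eq// => t _; case: ifP => // /andP[/andP[s0 st] t1].
    exfalso; apply: s01; apply: mem_set; rewrite /= in_itv/= s0/=.
    by rewrite ltW// (lt_le_trans st).
  rewrite in_itv/= => /[dup] s01 /andP[s0 s1].
  transitivity (\int[L n]_(t in [set t : T n | ((s : R) < N t <= 1)%R])
      ((k.+1%:R * (s : R) ^+ k)%:E * (h t)%:E))%E.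
    rewrite [RHS]integral_mkcond; apply: eq_integral => t _; rewrite /patch.
    rewrite s0/=; case: ifPn => [st|/negP st]; first by rewrite mem_set// EFinM.
    by case: ifPn => // /set_mem.
  rewrite ge0_integralZl//; last 4 first.
  - exact: measurable_shell.
  - by apply/measurable_EFinP; exact: measurable_funTS.
  - by move=> t _; rewrite lee_fin.
  - by rewrite lee_fin mulr_ge0// exprn_ge0// ltW.
  rewrite shell_integral// -EFinM addnS; congr EFin.
  by rewrite exprD; field; rewrite -natrD nat1r pnatr_eq0.
have cF : continuous (fun s : R => k.+1%:R * s ^+ k * G -
     k.+1%:R / (n + k.+1)%:R * ((n + k).+1%:R * s ^+ (n + k) * G)).
  move=> x; apply: cvgB; first exact: expr_continuous.
  by apply: cvgM; [exact: cvg_cst|exact: expr_continuous].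
rewrite integral_itv_obnd_cbnd; last first.
  by apply/measurable_EFinP; apply: measurable_funTS; exact: continuous_measurable_fun.
transitivity ((1 ^+ k.+1 * G - 1 ^+ (n + k).+1 * (G * (k.+1%:R / (n + k.+1)%:R))
   - (0 ^+ k.+1 * G - 0 ^+ (n + k).+1 * (G * (k.+1%:R / (n + k.+1)%:R))))%:E : \bar R); last first.
  rewrite !expr1n !expr0n/= !mul1r !mul0r subr0 subr0; congr EFin.
  by rewrite addnS -addnS natrD; field; rewrite ?nat1r -?natrD ?nat1r pnatr_eq0 ?addnS.
apply: (@FTC_itv _ _ _ (fun s => s ^+ k.+1 * G - s ^+ (n + k).+1 *
    (G * (k.+1%:R / (n + k.+1)%:R)))).
- exact: ler01.
- move=> x; apply: is_derive_eq.
    by apply: is_deriveB; exact: is_derive_expr.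
  by rewrite /=; ring.
- exact: cF.
Qed.

End homogeneous.

Local Notation B n := (@ball_tup R n).

(** Tonelli was applied to nonnegative functions; a bounded [h] is the difference of the nonnegative
    functions [h + C] and [C], both homogeneous of degree 0. *)
Lemma radial_Rintegral n k (h : T n -> R) : (0 < n)%N -> measurable_fun setT h ->
  (forall s t, 0 < s -> h (scale_tup s t) = h t) ->
  (exists C : R, forall t, `|h t| <= C) ->
  \int[L n]_(t in B n) (N t ^+ k * h t) =
    n%:R / (n + k)%:R * \int[L n]_(t in B n) h t.
Proof.
move=> n0 mh hs [C hC]; case: k => [|k].
  rewrite addn0 divff ?pnatr_eq0 -?lt0n// mul1r.
  by apply: eq_Rintegral => t _; rewrite mul1r.
have C0 : 0 <= C by exact: le_trans (hC [tuple (0 : mR) | i < n]).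
have mB := @measurable_ball_tup R n.
have Bf := @lebesgue_ball_fin n.
have mN : measurable_fun (B n) (fun t => N t ^+ k.+1).
  by apply: measurable_funX; apply: measurable_funTS; exact: measurable_enorm_tup.
have N1 t : B n t -> `|N t ^+ k.+1| <= 1.
  move=> tB; rewrite ger0_norm ?exprn_ge0 ?enorm_ge0//.
  by rewrite exprn_ile1 ?enorm_ge0.
have hi (g : T n -> R) : measurable_fun setT g -> (exists C : R, forall t, `|g t| <= C) ->
    (L n).-integrable (B n) (EFin \o g) /\
    (L n).-integrable (B n) (EFin \o (fun t => N t ^+ k.+1 * g t)).
  move=> mg [D gD]; split; apply: bounded_integrable => //.
  - exact: measurable_funTS.
  - by exists D.
  - by apply: measurable_funM => //; exact: measurable_funTS.
  - exists (1 * D) => t tB; rewrite normrM ler_pM//; exact: N1.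
pose g t := h t + C.
have mg : measurable_fun setT g by exact: measurable_funD.
have gb : exists C : R, forall t, `|g t| <= C.
  by exists (C + C) => t; rewrite (le_trans (ler_normD _ _))// lerD// ger0_norm.
have g0 t : 0 <= g t.
  by rewrite /g -lerBlDr sub0r; have := hC t; rewrite ler_norml => /andP[].
have cb : exists D : R, forall t : T n, `|cst C t| <= D by exists C => t; rewrite ger0_norm.
have Rg : \int[L n]_(t in B n) (N t ^+ k.+1 * g t) =
    n%:R / (n + k.+1)%:R * \int[L n]_(t in B n) g t.
  rewrite {1}/Rintegral radial_integral//.
  by move=> s t s0; rewrite /g hs.
have RC : \int[L n]_(t in B n) (N t ^+ k.+1 * cst C t) =
    n%:R / (n + k.+1)%:R * \int[L n]_(t in B n) cst C t.
  by rewrite {1}/Rintegral (@radial_integral _ (cst C)).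
have [i1 i2] := hi _ mg gb.
have [i3 i4] := hi (cst C) (measurable_cst _) cb.
have -> : \int[L n]_(t in B n) (N t ^+ k.+1 * h t) =
    \int[L n]_(t in B n) (N t ^+ k.+1 * g t) -
    \int[L n]_(t in B n) (N t ^+ k.+1 * cst C t).
  rewrite -RintegralB//; apply: eq_Rintegral => t _.
  by rewrite -mulrBr /g addrK.
have -> : \int[L n]_(t in B n) h t =
    \int[L n]_(t in B n) g t - \int[L n]_(t in B n) cst C t.
  by rewrite -RintegralB//; apply: eq_Rintegral => t _; rewrite /g addrK.
by rewrite Rg RC mulrBr.
Qed.

(** * Integration by parts on the ball *)

Lemma line_integral_eq0 (al be rho : R) k :
  (\int[leb]_s (if s ^+ 2 + rho <= 1 then
     k.+1%:R * al * (s * al + be) ^+ k * (1 - (s ^+ 2 + rho)) -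
     2 * s * (s * al + be) ^+ k.+1 else 0)%:E = 0)%E.
Proof.
have [rho1|rho1] := ltP 1 rho.
  apply: integral0_eq => s _; case: ifPn => // s1.
  have : rho <= 1 by apply: le_trans s1; rewrite lerDr sqr_ge0.
  by rewrite leNgt rho1.
(* The line meets the ball in the chord from -h to h. The integrand there is the derivative of [F],
   which vanishes at both ends. *)
pose h := Num.sqrt (1 - rho).
have h2 : h ^+ 2 = 1 - rho by rewrite sqr_sqrtr// subr_ge0.
have h0 : 0 <= h by exact: sqrtr_ge0.
pose F s : R := (s * al + be) ^+ k.+1 * (1 - rho - s ^+ 2).
pose f s : R := k.+1%:R * al * (s * al + be) ^+ k * (1 - (s ^+ 2 + rho)) -
     2 * s * (s * al + be) ^+ k.+1.
transitivity (\int[leb]_(s in `[(- h)%R, h]) (f s)%:E)%E.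
  rewrite [RHS]integral_mkcond; apply: eq_integral => s _; rewrite /patch.
  have sE : (s ^+ 2 + rho <= 1) = (- h <= s <= h).
    rewrite -ler_norml -[RHS](@ler_pXn2r _ 2) ?nnegrE// h2 lerBrDr.
    by rewrite real_normK ?num_real.
  rewrite sE; case: ifPn => sh; first by rewrite mem_set//= in_itv.
  by case: ifPn => // /set_mem/=; rewrite in_itv/= (negbTE sh).
have da (x : R) : is_derive x 1 (fun s : R => s * al + be) al.
  by apply: is_derive_affine => t; rewrite [t *: 1]mulr1 mulrDl addrA.
have daX m (x : R) : is_derive x 1 (fun s : R => (s * al + be) ^+ m.+1)
    (m.+1%:R * (x * al + be) ^+ m * al).
  by have := is_deriveX m.+1 (da x); rewrite exprfctE.
have db (x : R) : is_derive x 1 (fun s : R => 1 - rho - s ^+ 2) (- (2 * x)).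
  have := is_deriveB (is_derive_cst (1 - rho) x 1) (is_deriveX 2 (is_derive_id x (1 : R))).
  by rewrite exprfctE /= [_ *: 1]mulr1 expr1 sub0r.
transitivity ((F h - F (- h))%:E); last first.
  by rewrite /F sqrrN h2 subrr !mulr0 subrr.
apply: (@FTC_itv (- h) h f F).
- by rewrite ge0_cp.
- move=> x; have H := is_deriveM (daX k x) (db x); apply: (is_derive_eq H).
  by rewrite /f /GRing.scale/=; ring.
- have ca : continuous (fun s : R => s * al + be).
    by move=> x; apply: cvgD; [apply: cvgM; [exact: cvg_id|exact: cvg_cst]|exact: cvg_cst].
  have caX m : continuous (fun s : R => (s * al + be) ^+ m).
    by move=> x; apply: (@cvg_comp _ _ _ _ (fun t : R => t ^+ m) _ _ _ (ca x));
      exact: exprn_continuous.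
  move=> x; apply: cvgB; apply: cvgM.
  + by apply: cvgM; [exact: cvg_cst|exact: caX].
  + apply: cvgB; first exact: cvg_cst.
    by apply: cvgD; [exact: exprn_continuous|exact: cvg_cst].
  + by apply: cvgM; [exact: cvg_cst|exact: cvg_id].
  + exact: caX.
Qed.

Lemma measurable_dtup n (x : 'rV[R]_n) : measurable_fun setT (fun t : T n => dtup t x).
Proof.
by apply: measurable_sum => i; apply: measurable_funM => //; exact: measurable_tnth.
Qed.

Lemma dtup_norm n (t : T n) (x : 'rV[R]_n) :
  `|dtup t x| <= N t * \sum_(i < n) `|x ord0 i|.
Proof.
apply: le_trans (ler_norm_sum _ _ _) _; rewrite mulr_sumr; apply: ler_sum => i _.
by rewrite normrM ler_wpM2r// coord_le_enorm.
Qed.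

Lemma ball_by_parts n (x : 'rV[R]_n) (j : 'I_n) k :
  \int[L n]_(t in B n)
    (k.+1%:R * x ord0 j * dtup t x ^+ k * (1 - N t ^+ 2) -
     2 * tnth t j * dtup t x ^+ k.+1) = 0.
Proof.
pose f (t : T n) : R := k.+1%:R * x ord0 j * dtup t x ^+ k * (1 - N t ^+ 2) -
     2 * tnth t j * dtup t x ^+ k.+1.
pose F (t : T n) : R := if N t ^+ 2 <= 1 then f t else 0.
have NB (t : T n) : (N t ^+ 2 <= 1) = (N t <= 1).
  by rewrite -[in LHS](@expr1n R 2) ler_pXn2r ?nnegrE ?enorm_ge0.
have nF : box_supported F.
  split.
  - apply: measurable_fun_ifT => //.
      by apply: measurable_fun_ler => //; apply: measurable_funX; exact: measurable_enorm_tup.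
    apply: measurable_funB; apply: measurable_funM.
    + by apply: measurable_funM => //; apply: measurable_funX; exact: measurable_dtup.
    + by apply: measurable_funB => //; apply: measurable_funX; exact: measurable_enorm_tup.
    + by apply: measurable_funM => //; exact: measurable_tnth.
    + by apply: measurable_funX; exact: measurable_dtup.
  - pose X := \sum_(i < n) `|x ord0 i|.
    have X0 : 0 <= X by exact: sumr_ge0.
    exists (`|k.+1%:R * x ord0 j| * X ^+ k * 1 + 2 * 1 * X ^+ k.+1) => t.
    rewrite /F NB; case: ifPn => t1; last first.
      by rewrite normr0 addr_ge0// !mulr_ge0// exprn_ge0.
    have aX m : `|dtup t x ^+ m| <= X ^+ m.
      rewrite normrX lerXn2r ?nnegrE//; apply: le_trans (dtup_norm _ _) _.
      by rewrite ler_piMl.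
    apply: le_trans (ler_normB _ _) _; rewrite lerD// normrM ler_pM//.
    + by rewrite normrM ler_wpM2l.
    + by rewrite ger0_norm ?subr_ge0 ?NB// gerBl sqr_ge0.
    + rewrite normrM ger0_norm// ler_wpM2l//.
      exact: le_trans (coord_le_enorm _ _) t1.
  - move=> t tB; rewrite /F NB; case: ifPn => // t1.
    by case: tB; exact: ball_box.
have E : (\int[L n]_t (F t)%:E = 0)%E.
  apply: (integral_coord_eq0 (i := j)) => // t.
  (* On the line through [t] parallel to the [j]-th axis, [rho] and [be] are the parts of |t|^2 and
     <t, x> that do not vary. *)
  pose rho := \sum_(i < n | i != j) tnth t i ^+ 2.
  pose be := \sum_(i < n | i != j) tnth t i * x ord0 i.
  rewrite -[RHS](line_integral_eq0 (x ord0 j) be rho k).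
  apply: eq_integral => s _.
  have Ns : N (set_tup j s t) ^+ 2 = (s : R) ^+ 2 + rho.
    rewrite enorm_tup_sqr (bigD1 j)//= tnth_mktuple eqxx; congr (_ + _).
    by apply: eq_bigr => i ij; rewrite tnth_mktuple (negbTE ij).
  have as_ : dtup (set_tup j s t) x = (s : R) * x ord0 j + be.
    rewrite /dtup (bigD1 j)//= tnth_mktuple eqxx; congr (_ + _).
    by apply: eq_bigr => i ij; rewrite tnth_mktuple (negbTE ij).
  by rewrite /F /f Ns as_ tnth_mktuple eqxx.
rewrite /Rintegral integral_mkcond -[RHS]/(fine 0%E) -E; congr fine.
apply: eq_integral => t _; rewrite /patch /F NB.
case: ifPn => [/set_mem|/negP tB]; first by rewrite /ball_tup/= => ->.
by case: ifPn => // t1; exfalso; apply: tB; exact: mem_set.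
Qed.

Local Notation nrm t := (normalize_tup t).

Lemma dtup_normalize n (t : T n) x : dtup t x = N t * dtup (nrm t) x.
Proof.
rewrite /dtup mulr_sumr; apply: eq_bigr => i _.
by rewrite {1}(tup_normalize t i) mulrA.
Qed.

Lemma normalize_coord_le n (t : T n) i : `|tnth (nrm t) i| <= 1.
Proof.
rewrite tnth_mktuple normrM normfV (ger0_norm (enorm_ge0 _)).
have [->|N0] := eqVneq (N t) 0; first by rewrite invr0 mulr0 ler01.
by rewrite ler_pdivrMr ?mul1r ?coord_le_enorm// lt_neqAle eq_sym N0 enorm_ge0.
Qed.

Lemma measurable_coord_normalize n (j : 'I_n) :
  measurable_fun setT (fun t : T n => tnth (nrm t) j).
Proof.
exact: (measurableT_comp (@measurable_tnth _ mR n j) (@measurable_normalize_tup R n)).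
Qed.

Lemma measurable_dtup_normalize n (x : 'rV[R]_n) k :
  measurable_fun setT (fun t : T n => dtup (nrm t) x ^+ k).
Proof.
apply: measurable_funX.
exact: (measurableT_comp (measurable_dtup x) (@measurable_normalize_tup R n)).
Qed.

Lemma dtup_normalize_norm n (t : T n) (x : 'rV[R]_n) k :
  `|dtup (nrm t) x ^+ k| <= (\sum_(i < n) `|x ord0 i|) ^+ k.
Proof.
rewrite normrX lerXn2r ?nnegrE ?sumr_ge0//.
apply: le_trans (ler_norm_sum _ _ _) _; apply: ler_sum => i _.
by rewrite normrM ler_piMl// normalize_coord_le.
Qed.

(** Writing t = |t| times its normalization turns the integration by parts into radial weights times
    functions homogeneous of degree 0; these weights become the factors n / (n + k) and n / (n + k +
    2). *)
Lemma ball_moment n (x : 'rV[R]_n) (j : 'I_n) k :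
  (n + k)%:R * \int[L n]_(t in B n) (tnth (nrm t) j * dtup (nrm t) x ^+ k.+1) =
  k.+1%:R * x ord0 j * \int[L n]_(t in B n) (dtup (nrm t) x ^+ k).
Proof.
have n0 : (0 < n)%N by apply: leq_trans (ltn_ord j).
pose a (t : T n) : R := dtup (nrm t) x.
pose u (t : T n) : R := tnth (nrm t) j.
have ma m : measurable_fun setT (fun t : T n => a t ^+ m).
  exact: measurable_dtup_normalize.
have aX m : exists C : R, forall t, `|a t ^+ m| <= C.
  by exists ((\sum_(i < n) `|x ord0 i|) ^+ m) => t; exact: dtup_normalize_norm.
have mua m : measurable_fun setT (fun t : T n => u t * a t ^+ m).
  by apply: measurable_funM; [exact: measurable_coord_normalize|exact: ma].
have uaX m : exists C : R, forall t, `|u t * a t ^+ m| <= C.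
  have [C aC] := aX m; exists (1 * C) => t.
  by rewrite normrM ler_pM// normalize_coord_le.
have mB := @measurable_ball_tup R n.
have Bf := @lebesgue_ball_fin n.
have mN m : measurable_fun setT (fun t : T n => N t ^+ m).
  by apply: measurable_funX; exact: measurable_enorm_tup.
have Ni m (h : T n -> R) : measurable_fun setT h -> (exists C : R, forall t, `|h t| <= C) ->
    (L n).-integrable (B n) (EFin \o (fun t => N t ^+ m * h t)).
  move=> mh [C hC]; apply: bounded_integrable => //.
    by apply: measurable_funTS; exact: measurable_funM.
  exists (1 * C) => t tB; rewrite normrM ler_pM// ger0_norm ?exprn_ge0 ?enorm_ge0//.
  by rewrite exprn_ile1 ?enorm_ge0.
have as_ s t m : 0 < s -> a (scale_tup s t) ^+ m = a t ^+ m.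
  by move=> s0; rewrite /a normalize_scale.
have us s t m : 0 < s -> u (scale_tup s t) * a (scale_tup s t) ^+ m = u t * a t ^+ m.
  by move=> s0; rewrite /u /a normalize_scale.
have := ball_by_parts x j k.
have -> : \int[L n]_(t in B n)
    (k.+1%:R * x ord0 j * dtup t x ^+ k * (1 - N t ^+ 2) -
     2 * tnth t j * dtup t x ^+ k.+1) =
    k.+1%:R * x ord0 j * (\int[L n]_(t in B n) (N t ^+ k * a t ^+ k) -
      \int[L n]_(t in B n) (N t ^+ (k + 2) * a t ^+ k)) -
    2 * \int[L n]_(t in B n) (N t ^+ (k + 2) * (u t * a t ^+ k.+1)).
  rewrite -RintegralB//; [|exact: Ni|exact: Ni].
  have iB := integrableB mB (Ni k _ (ma k) (aX k)) (Ni (k + 2)%N _ (ma k) (aX k)).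
  have iU := Ni (k + 2)%N _ (mua k.+1) (uaX k.+1).
  rewrite -!RintegralZl// -RintegralB//; last 2 first.
  - exact: (integrableZl mB (k.+1%:R * x ord0 j) iB).
  - exact: (integrableZl mB 2 iU).
  apply: eq_Rintegral => t _.
  rewrite (dtup_normalize t x) -/(a t) (tup_normalize t j) -/(u t) !exprMn exprD [N t ^+ k.+1]exprS.
  by ring.
rewrite !radial_Rintegral//; [|by move=> s t s0; exact: us|by move=> s t s0; exact: as_
  |by move=> s t s0; exact: as_].
set J := \int[L n]_(t in B n) (u t * _); set I := \int[L n]_(t in B n) _.
have nk : ((n + k)%:R : R) != 0 by rewrite pnatr_eq0 -lt0n addn_gt0 n0.
have nk2 : ((n + (k + 2))%:R : R) != 0 by rewrite pnatr_eq0 -lt0n addn_gt0 n0.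
have nn : (n%:R : R) != 0 by rewrite pnatr_eq0 -lt0n.
move=> H; apply/eqP; rewrite -subr_eq0.
(* The two weights of the first term differ by 2 n / ((n + k) (n + k + 2)); multiplying the identity
   by -(n + k) leaves a common nonzero factor. *)
have : 2 * n%:R / (n + (k + 2))%:R * ((n + k)%:R * J - k.+1%:R * x ord0 j * I) = 0.
  rewrite -[RHS](mulr0 (- (n + k)%:R)) -H.
  move: nk nk2; rewrite !natrD => nk nk2; field.
  by rewrite nk nk2.
move/eqP; rewrite mulf_eq0 => /orP[|//].
by rewrite !mulf_eq0 invr_eq0 (negbTE nk2) (negbTE nn) pnatr_eq0.
Qed.

(** * From the ball to the sphere *)

Local Notation sph n := (@sphere_tup R n).
Local Notation smu n := (@sphere_measure R n).

Lemma measurable_sphere_tup n : measurable (sph n).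
Proof.
rewrite (_ : sph n = setT `&` (fun t => N t) @^-1` [set 1]); last by rewrite setTI.
by apply: measurable_enorm_tup => //; exact: measurable_set1.
Qed.

Lemma enorm_normalize n (t : T n) : N (nrm t) = N t / N t.
Proof.
apply/eqP; rewrite -(@eqrXn2 _ 2) ?divr_ge0 ?enorm_ge0//.
rewrite exprMn exprVn !enorm_tup_sqr mulr_suml; apply/eqP; apply: eq_bigr => i _.
by rewrite tnth_mktuple exprMn exprVn enorm_tup_sqr.
Qed.

(** Division by zero gives 0, so the origin is normalized to itself, of norm 0; it is the only point
    not sent to the sphere. *)
Lemma preimage_sphere n : @normalize_tup R n @^-1` sph n = [set t : T n | N t != 0].
Proof.
apply/seteqP; split => t; rewrite /sphere_tup/= enorm_normalize.
  by move=> H; apply/eqP => N0; move: H; rewrite N0 mul0r => /esym/eqP; rewrite oner_eq0.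
by move=> N0; rewrite divff.
Qed.

Lemma lebesgue_origin n : (0 < n)%N -> L n [set t : T n | N t == 0] = 0.
Proof.
move=> n0; have -> : [set t : T n | N t == 0] = box_tup n 0.
  apply/seteqP; split => t /=.
    move=> /eqP N0 i; rewrite -ler_norml.
    by apply: le_trans (coord_le_enorm _ _) _; rewrite N0.
  move=> t0; rewrite -(@eqrXn2 _ 2) ?enorm_ge0// enorm_tup_sqr expr0n/=.
  rewrite big1// => i _; have := t0 i; rewrite oppr0 -eq_le => /eqP <-.
  by rewrite expr0n.
by rewrite lebesgue_box// mulr0 expr0n gtn_eqF.
Qed.

Lemma measurable_origin n : measurable [set t : T n | N t == 0].
Proof.
rewrite (_ : [set _ | _] = setT `&` (fun t => N t) @^-1` [set 0]).
  by apply: measurable_enorm_tup => //; exact: measurable_set1.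
by rewrite setTI; apply/seteqP; split => t /= /eqP.
Qed.

(** Pushforward, scaling and restriction are undone in turn. The domain becomes the punctured ball,
    which differs from the ball by a null set. *)
Lemma sphere_integral_ge0 n (h : T n -> R) : (0 < n)%N -> measurable_fun setT h ->
  (forall t, 0 <= h t) ->
  (\int[smu n]_(t in sph n) (h t)%:E = n%:R%:E * \int[L n]_(t in B n) (h (nrm t))%:E)%E.
Proof.
move=> n0 mh h0.
have mB := @measurable_ball_tup R n.
have mS := @measurable_sphere_tup n.
have mn := @measurable_normalize_tup R n.
have mg : measurable_fun setT (fun t => (h (nrm t))%:E).
  by apply/measurable_EFinP; exact: measurableT_comp.
have mO := @measurable_origin n.
have mD : measurable [set t : T n | N t != 0].
  rewrite (_ : [set _ | _] = ~` [set t : T n | N t == 0]); first exact: measurableC.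
  by apply/seteqP; split => t /= /negP.
rewrite ge0_integral_pushforward//; last 2 first.
- by apply/measurable_EFinP; exact: measurable_funTS.
- by move=> t _; rewrite lee_fin.
rewrite preimage_sphere ge0_integral_mscale//; last 2 first.
- exact: measurable_funTS.
- by move=> t _; rewrite lee_fin.
congr (_ * _)%E.
pose m := mrestr (L n) mB.
have mDB : measurable ([set t : T n | N t != 0] `&` B n) by exact: measurableI.
have mDC : measurable ([set t : T n | N t != 0] `\` B n) by exact: measurableD.
have -> : (\int[m]_(t in [set t : T n | (N t != 0)%R]) (h (nrm t))%:E =
    \int[L n]_(t in [set t : T n | (N t != 0)%R] `&` B n) (h (nrm t))%:E)%E.
  rewrite -{1}(setUIDK [set t : T n | N t != 0] (B n)) ge0_integral_setU//; last 3 first.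
  - exact: measurable_funTS.
  - by move=> t _; rewrite lee_fin.
  - by apply/disj_setPS => t [[_ tB] [_]].
  rewrite [X in (_ + X)%E]null_set_integral ?adde0//.
  - by apply: eq_measure_integral => A mA AB; transitivity (L n (A `&` B n));
      [by []|by rewrite setIidl// => t /AB[]].
  - exact: measurable_funTS.
  - transitivity (L n (([set t : T n | N t != 0] `\` B n) `&` B n)); first by [].
    by rewrite (_ : _ `&` _ = set0) ?measure0//; apply/seteqP; split => t // -[[_ ?]].
rewrite -[in RHS](setUIDK (B n) [set t : T n | N t != 0]) ge0_integral_setU//; last 5 first.
- exact: measurableI.
- exact: measurableD.
- exact: measurable_funTS.
- by move=> t _; rewrite lee_fin.
- by apply/disj_setPS => t [[_ tB] [_]].
rewrite [X in (_ + X)%E]null_set_integral ?adde0//; first by rewrite setIC.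
- exact: measurableD.
- exact: measurable_funTS.
- apply/eqP; rewrite eq_le measure_ge0 andbT -(lebesgue_origin n0).
  apply: le_measure; [apply: mem_set; exact: measurableD|exact: mem_set|].
  by move=> t [_ /negP]; rewrite negbK.
Qed.

Lemma ball_measure_fin_num n : L n (B n) \is a fin_num.
Proof. by rewrite ge0_fin_numE ?lebesgue_ball_fin// measure_ge0. Qed.

Lemma sphere_measureE n : (0 < n)%N -> smu n (sph n) = (n%:R * fine (L n (B n)))%:E.
Proof.
move=> n0; have := @sphere_integral_ge0 n (cst 1) n0 (measurable_cst _) (fun=> ler01).
have -> : (\int[smu n]_(t in sph n) (cst 1 t)%:E = 1%:E * smu n (sph n))%E.
  exact: (integral_cst _ (@measurable_sphere_tup n) 1%:E).
have -> : (\int[L n]_(t in B n) (cst 1 (nrm t))%:E = 1%:E * L n (B n))%E.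
  exact: (integral_cst _ (@measurable_ball_tup R n) 1%:E).
rewrite !mul1e => ->; rewrite EFinM fineK//.
exact: ball_measure_fin_num.
Qed.

Lemma sphere_measure_fin n : (0 < n)%N -> (smu n (sph n) < +oo)%E.
Proof. by move=> n0; rewrite sphere_measureE// ltry. Qed.

(** The ball contains the cube of half-side 1/n, of positive volume. *)
Lemma sphere_area_gt0 n : (0 < n)%N -> 0 < sphere_area R n.
Proof.
move=> n0; rewrite /sphere_area sphere_measureE//= mulr_gt0 ?ltr0n//.
rewrite -lte_fin fineK; last exact: ball_measure_fin_num.
have ni : 0 < n%:R^-1 :> R by rewrite invr_gt0 ltr0n.
apply: (@lt_le_trans _ _ ((2 * n%:R^-1) ^+ n)%:E).
  by rewrite lte_fin exprn_gt0// mulr_gt0.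
rewrite -(lebesgue_box n (ltW ni)).
apply: le_measure; [apply: mem_set; exact: (@measurable_box_tup n)|
    apply: mem_set; exact: (@measurable_ball_tup R n)|].
move=> t tB; rewrite /ball_tup/= -(@ler_pXn2r _ 2) ?nnegrE ?enorm_ge0//.
rewrite enorm_tup_sqr expr1n.
apply: (@le_trans _ _ (\sum_(i < n) n%:R^-1)).
  apply: ler_sum => i _; rewrite -real_normK ?num_real// expr2.
  have ti : `|tnth t i| <= n%:R^-1 by rewrite ler_norml; exact: tB.
  apply: (le_trans _ ti); rewrite ler_piMl//; apply: (le_trans ti).
  by rewrite invf_le1 ?ler1n ?ltr0n.
by rewrite sumr_const card_ord -[_ *+ _]mulr_natl divff// pnatr_eq0 -lt0n.
Qed.

Lemma sphere_integrable n (h : T n -> R) : (0 < n)%N -> measurable_fun setT h ->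
  (exists C : R, forall t, sph n t -> `|h t| <= C) ->
  (smu n).-integrable (sph n) (EFin \o h).
Proof.
move=> n0 mh hC; apply: bounded_integrable => //.
- exact: measurable_sphere_tup.
- exact: sphere_measure_fin.
- exact: measurable_funTS.
Qed.

Lemma sphere_Rintegral n (h : T n -> R) : (0 < n)%N -> measurable_fun setT h ->
  (exists C : R, forall t, `|h t| <= C) ->
  \int[smu n]_(t in sph n) h t = n%:R * \int[L n]_(t in B n) h (nrm t).
Proof.
move=> n0 mh [C hC].
have mB := @measurable_ball_tup R n.
have mS := @measurable_sphere_tup n.
have mn := @measurable_normalize_tup R n.
have C0 : 0 <= C by exact: le_trans (hC [tuple (0 : mR) | i < n]).
have pos (g : T n -> R) : measurable_fun setT g -> (forall t, 0 <= g t) ->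
    (exists D : R, forall t, `|g t| <= D) ->
    [/\ (smu n).-integrable (sph n) (EFin \o g),
      (L n).-integrable (B n) (EFin \o (fun t => g (nrm t))) &
      \int[smu n]_(t in sph n) g t = n%:R * \int[L n]_(t in B n) g (nrm t)].
  move=> mg g0 [D gD]; have iB : (L n).-integrable (B n) (EFin \o (fun t => g (nrm t))).
    apply: bounded_integrable => //; first exact: lebesgue_ball_fin.
      by apply: measurable_funTS; exact: measurableT_comp.
    by exists D.
  split=> //; first by apply: sphere_integrable => //; exists D.
  rewrite /Rintegral sphere_integral_ge0// fineM//.
  exact: (integrable_fin_num mB iB).
pose g t := h t + C.
have mg : measurable_fun setT g by exact: measurable_funD.
have [i1 i2 Eg] : [/\ (smu n).-integrable (sph n) (EFin \o g),
      (L n).-integrable (B n) (EFin \o (fun t => g (nrm t))) &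
      \int[smu n]_(t in sph n) g t = n%:R * \int[L n]_(t in B n) g (nrm t)].
  apply: pos => // [t|].
    by rewrite /g -lerBlDr sub0r; have := hC t; rewrite ler_norml => /andP[].
  by exists (C + C) => t; rewrite (le_trans (ler_normD _ _))// lerD// ger0_norm.
have [i3 i4 EC] := pos (cst C) (measurable_cst _) (fun=> C0)
  (ex_intro _ C (fun t => eq_ind_r (fun x => x <= C) (lexx C) (ger0_norm C0))).
have -> : \int[smu n]_(t in sph n) h t =
    \int[smu n]_(t in sph n) g t - \int[smu n]_(t in sph n) cst C t.
  by rewrite -RintegralB//; apply: eq_Rintegral => t _; rewrite /g addrK.
have -> : \int[L n]_(t in B n) h (nrm t) =
    \int[L n]_(t in B n) g (nrm t) - \int[L n]_(t in B n) cst C (nrm t).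
  by rewrite -RintegralB//; apply: eq_Rintegral => t _; rewrite /g addrK.
by rewrite Eg EC mulrBr.
Qed.

Lemma sphere_moment n (x : 'rV[R]_n) (j : 'I_n) k :
  (n + k)%:R * \int[smu n]_(t in sph n) (tnth t j * dtup t x ^+ k.+1) =
  k.+1%:R * x ord0 j * \int[smu n]_(t in sph n) (dtup t x ^+ k).
Proof.
have n0 : (0 < n)%N by apply: leq_trans (ltn_ord j).
(* On the sphere [t] may be replaced by its normalization, which makes the integrands bounded on the
   whole space, as [sphere_Rintegral] requires. *)
have nS (t : T n) : sph n t -> nrm t = t.
  by move=> tS; apply: eq_from_tnth => i; rewrite tnth_mktuple tS divr1.
have nn (t : T n) : nrm (nrm t) = nrm t.
  apply: eq_from_tnth => i; rewrite tnth_mktuple enorm_normalize tnth_mktuple.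
  have [->|N0] := eqVneq (N t) 0; first by rewrite invr0 mulr0 mul0r.
  by rewrite divff// divr1.
have -> : \int[smu n]_(t in sph n) (tnth t j * dtup t x ^+ k.+1) =
    \int[smu n]_(t in sph n) (tnth (nrm t) j * dtup (nrm t) x ^+ k.+1).
  by apply: eq_Rintegral => t /set_mem tS; rewrite nS.
have -> : \int[smu n]_(t in sph n) (dtup t x ^+ k) =
    \int[smu n]_(t in sph n) (dtup (nrm t) x ^+ k).
  by apply: eq_Rintegral => t /set_mem tS; rewrite nS.
have md m := @measurable_dtup_normalize n x m.
have dX m t := @dtup_normalize_norm n t x m.
rewrite !sphere_Rintegral//; last 3 first.
- by eexists => t; exact: dX.
- by apply: measurable_funM; [exact: measurable_coord_normalize|exact: md].
- by eexists => t; rewrite normrM; apply: ler_pM (normalize_coord_le t j) (dX k.+1 t).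
under [X in _ * (_ * X)]eq_Rintegral do rewrite nn.
under [X in _ = _ * (_ * X)]eq_Rintegral do rewrite nn.
by rewrite mulrCA ball_moment mulrCA.
Qed.

End sphere_integrals.

(** * The Gamma function *)

Section gamma_function.
Variable R : realType.
Local Notation leb := (@lebesgue_measure R).

Definition gamma_fun (s t : R) : R := t `^ (s - 1) * expR (- t).
Definition gamma_int (s : R) : \bar R :=
  (\int[leb]_(t in `]0%R, +oo[) (gamma_fun s t)%:E)%E.
(** The boundary term in the integration by parts for the functional equation. *)
Definition gamma_prim (s t : R) : R := t `^ s * expR (- t).

Lemma gamma_fun_ge0 s t : 0 <= gamma_fun s t.
Proof. by rewrite mulr_ge0 ?powR_ge0 ?expR_ge0. Qed.

Lemma measurable_gamma_fun s D : measurable_fun D (fun t => (gamma_fun s t)%:E).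
Proof.
apply/measurable_EFinP; apply: measurable_funTS; apply: measurable_funM.
  exact: measurable_powR.
by apply: (measurableT_comp (@measurable_expR R)); exact: oppr_measurable.
Qed.

Lemma is_derive_gamma_prim s (t : R) : 0 < t ->
  is_derive t 1 (gamma_prim s) (s * gamma_fun s t - gamma_fun (s + 1) t).
Proof.
move=> t0.
have de : is_derive t 1 (fun u : R => expR (- u)) (- expR (- t)).
  have dN : is_derive t 1 (fun u : R => - u) (-1 : R).
    by apply: is_derive_affine => h; rewrite opprD scalerN [h *: 1]mulr1.
  have := is_derive1_comp (is_derive_expR (- t)) dN.
  by move=> H; apply: (is_derive_eq H); rewrite /GRing.scale/= mulrN1.
have H := is_deriveM (is_derive1_powR s t0) de; apply: (is_derive_eq H).
by rewrite /gamma_fun addrK /GRing.scale/=; ring.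
Qed.

Lemma gamma_fun_continuous s (a b : R) : 0 < a ->
  {within `[a, b], continuous (gamma_fun s)}.
Proof.
move=> a0; apply: derivable_within_continuous => t; rewrite in_itv/= => /andP[ta _].
have t0 := lt_le_trans a0 ta.
(* [gamma_fun s] is [gamma_prim (s - 1)]. *)
by have [] := is_derive_gamma_prim (s - 1) t0.
Qed.

(** The segments from [lo n] to [hi n] exhaust the open half-line and stay away from the singularity
    at 0. The shift in [hi] makes the first one, from 1 to 2, nondegenerate. *)
Let lo n : R := n.+1%:R^-1.
Let hi n : R := n.+2%:R.

Let lo_gt0 n : 0 < lo n. Proof. by rewrite invr_gt0 ltr0n. Qed.

Let lo_hi n : lo n < hi n.
Proof.
rewrite (@le_lt_trans _ _ 1)//; first by rewrite invf_le1 ?ler1n ?ltr0n.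
by rewrite ltr1n.
Qed.

Lemma gamma_int_cvg s :
  (\int[leb]_(t in `[lo n, hi n]) (gamma_fun s t)%:E)%E @[n --> \oo] --> gamma_int s.
Proof.
have -> : gamma_int s = (\int[leb]_(t in \bigcup_n `[lo n, hi n]%classic) (gamma_fun s t)%:E)%E.
  congr (integral _ _ _); apply/seteqP; split => t /=; rewrite in_itv/= ?andbT.
    move=> t0.
    exists (maxn (Num.bound t^-1) (Num.bound t)) => //=; rewrite in_itv/=; apply/andP; split.
      rewrite /lo -[leRHS]invrK lef_pV2 ?posrE ?invr_gt0//.
      have := archi_boundP (ltW (_ : 0 < t^-1)); rewrite invr_gt0 => /(_ t0) /ltW H.
      by apply: le_trans H _; rewrite ler_nat ltnW// ltnS leq_maxl.
    have /ltW H := archi_boundP (ltW t0).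
    by apply: le_trans H _; rewrite ler_nat 2?ltnW// 2!ltnS leq_maxr.
  move=> [n _] /=; rewrite in_itv/= => /andP[+ _]; exact: lt_le_trans.
apply: ge0_nondecreasing_set_cvg_integral.
- move=> n m nm; apply/subsetPset => t /=; rewrite !in_itv/= => /andP[t1 t2].
  apply/andP; split.
    by apply: le_trans t1; rewrite /lo lef_pV2 ?posrE ?ltr0n// ler_nat.
  by apply: le_trans t2 _; rewrite ler_nat.
- by move=> i; exact: measurable_itv.
- by move=> i; exact: measurable_gamma_fun.
- by move=> i t _; rewrite lee_fin gamma_fun_ge0.
Qed.

Lemma gamma_integrable s (a b : R) : 0 < a ->
  leb.-integrable `[a, b] (EFin \o gamma_fun s).
Proof.
move=> a0; apply: continuous_compact_integrable; first exact: segment_compact.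
exact: gamma_fun_continuous.
Qed.

Lemma gamma_by_parts s (a b : R) : 0 < a -> a < b ->
  (s%:E * \int[leb]_(t in `[a, b]) (gamma_fun s t)%:E =
   \int[leb]_(t in `[a, b]) (gamma_fun (s + 1) t)%:E +
     (gamma_prim s b - gamma_prim s a)%:E)%E.
Proof.
move=> a0 ab.
have gp t : t \in `[a, b] -> 0 < t.
  by rewrite in_itv/= => /andP[ta _]; exact: lt_le_trans ta.
have cp : {within `[a, b], continuous (gamma_prim s)}.
  apply: derivable_within_continuous => t /gp t0.
  by have [] := is_derive_gamma_prim s t0.
have cf : {within `[a, b], continuous (fun t => s * gamma_fun s t - gamma_fun (s + 1) t)}.
  move=> t; apply: cvgB; last exact: gamma_fun_continuous.
  by apply: cvgM; [exact: cvg_cst|exact: gamma_fun_continuous].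
have cpt t : 0 < t -> {for t, continuous (gamma_prim s)}.
  move=> t0; apply: differentiable_continuous; apply/derivable1_diffP.
  by have [] := is_derive_gamma_prim s t0.
have := @continuous_FTC2 R _ (gamma_prim s) a b ab cf.
rewrite EFinB => <-; last 2 first.
- split.
  + by move=> t tab; have [] := is_derive_gamma_prim s (gp t (subset_itv_oo_cc tab)).
  + by apply: cvg_at_right_filter; exact: cpt.
  + by apply: cvg_at_left_filter; apply: cpt; exact: lt_trans ab.
- by move=> t tab; rewrite derive1E;
    have [_ ->] := is_derive_gamma_prim s (gp t (subset_itv_oo_cc tab)).
have mI : measurable (`[a, b]%classic : set (measurableTypeR R)) by exact: measurable_itv.
have i1 := gamma_integrable s b a0.
have i2 := gamma_integrable (s + 1) b a0.
have i3 := integrableZl mI s i1.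
rewrite -integralZl// -integralD//; last first.
  exact: (integrableB mI i3 i2).
by apply: eq_integral => t _; rewrite -EFinD addrCA subrr addr0.
Qed.

Lemma gamma_prim_lo s : 0 < s -> gamma_prim s (lo n) @[n --> \oo] --> (0 : R).
Proof.
move=> s0; have H0 : lo n @[n --> \oo] --> (0 : R) by exact: cvg_harmonic.
have H : lo n @[n --> \oo] --> 0^'+.
  move=> P HP; have [M _ HM] := H0 _ HP; exists M => // n Mn.
  exact: HM n Mn (lo_gt0 n).
have cp : (lo n) `^ s @[n --> \oo] --> (0 : R) by exact: (cvg_comp _ _ H (powR_cvg0 s0)).
apply: (@squeeze_cvgr _ _ _ _ (fun=> 0) (fun n => (lo n) `^ s)) => //; last exact: cvg_cst.
near=> n; rewrite mulr_ge0 ?powR_ge0 ?expR_ge0//= ler_piMr ?powR_ge0//.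
by rewrite -expR0 ler_expR oppr_le0 ltW.
Unshelve. all: by end_near. Qed.

(** With an integer k >= s and exp t >= t^(k + 1) / (k + 1)!, the quantity is at most (k + 1)! / t
    for t >= 1. *)
Lemma gamma_prim_hi s : 0 < s -> gamma_prim s (hi n) @[n --> \oo] --> (0 : R).
Proof.
move=> s0; pose k := Num.bound s.
apply: (@squeeze_cvgr _ _ _ _ (fun=> 0) (fun n => k.+1`!%:R * lo n)) => //; last 2 first.
- exact: cvg_cst.
- rewrite -[X in _ --> X](mulr0 (k.+1`!%:R)).
  by apply: cvgM; [exact: cvg_cst|exact: cvg_harmonic].
near=> n; rewrite mulr_ge0 ?powR_ge0 ?expR_ge0//=.
have h1 : 1 <= hi n by rewrite ler1n.
have h0 : 0 < hi n by exact: lt_le_trans h1.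
apply: (@le_trans _ _ (hi n ^+ k * expR (- hi n))).
  rewrite ler_wpM2r ?expR_ge0// -powR_mulrn ?(ltW h0)// ler_powR//.
  by rewrite ltW// archi_boundP// ltW.
apply: (@le_trans _ _ (k.+1`!%:R / hi n)); last first.
  by rewrite ler_wpM2l// /lo lef_pV2 ?posrE ?ltr0n// ler_nat.
rewrite expRN ler_pdivrMr ?expR_gt0// mulrAC ler_pdivlMr// -exprSr.
have := expR_ge1Dxn k (ltW h0).
rewrite -ler_pdivrMl ?ltr0n ?fact_gt0// mulrC; apply: le_trans.
by rewrite ler_wpDl.
Unshelve. all: by end_near. Qed.

Lemma gamma_int_ge0 s : (0 <= gamma_int s)%E.
Proof. by apply: integral_ge0 => t _; rewrite lee_fin gamma_fun_ge0. Qed.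

(** Stated in the extended reals, because finiteness and positivity for small [s] are deduced from
    it. *)
Lemma gamma_intS s : 0 < s -> gamma_int (s + 1) = (s%:E * gamma_int s)%E.
Proof.
move=> s0.
have sf : s%:E \is a fin_num by [].
have c1 := cvgeZl sf (@gamma_int_cvg s).
have c2 : ((gamma_prim s (hi n) - gamma_prim s (lo n))%:E @[n --> \oo] --> 0%E)%E.
  apply: cvg_EFin; first by near=> n.
  rewrite -[X in _ --> X](subrr 0).
  by apply: cvgB; [exact: gamma_prim_hi|exact: gamma_prim_lo].
have c3 : (\int[leb]_(t in `[lo n, hi n]) (gamma_fun (s + 1) t)%:E +
    (gamma_prim s (hi n) - gamma_prim s (lo n))%:E @[n --> \oo] --> gamma_int (s + 1) + 0)%E.
  apply: cvgeD; [by rewrite fin_num_adde_defl|exact: gamma_int_cvg|exact: c2].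
rewrite adde0 in c3.
have -> : (s%:E * gamma_int s)%E =
   (lim ((s%:E * \int[leb]_(t in `[lo n, hi n]) (gamma_fun s t)%:E)%E @[n --> \oo])).
  by apply/esym/cvg_lim.
under eq_fun do rewrite gamma_by_parts//.
by apply/esym/cvg_lim.
Unshelve. all: by end_near. Qed.

Lemma gamma_int1 : gamma_int 1 = 1%E.
Proof.
have -> : gamma_int 1 = (\int[leb]_(t in `[0%R, +oo[) (expR (- t))%:E)%E.
  rewrite -integral_itv_obnd_cbnd; last first.
    apply/measurable_EFinP; apply: measurable_funTS.
    by apply: (measurableT_comp (@measurable_expR R)); exact: oppr_measurable.
  apply: eq_integral => t /set_mem; rewrite /= in_itv/= andbT => t0.
  by rewrite /gamma_fun subrr powRr0 mul1r.
have dE (x : R) : is_derive x 1 (fun t : R => - expR (- t)) (expR (- x)).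
  have dN : is_derive x 1 (fun u : R => - u) (-1 : R).
    by apply: is_derive_affine => h; rewrite opprD scalerN [h *: 1]mulr1.
  have := is_deriveN (is_derive1_comp (is_derive_expR (- x)) dN).
  by move=> H; apply: (is_derive_eq H); rewrite /GRing.scale/= mulrN1 opprK.
have cE : continuous (fun t : R => expR (- t)).
  by move=> x; apply: continuous_comp; [exact: opp_continuous|exact: continuous_expR].
rewrite (@ge0_continuous_FTC2y R (fun t => expR (- t)) (fun t => - expR (- t)) 0 0).
- by rewrite oppr0 expR0 -EFinB sub0r opprK.
- by move=> x _; exact: expR_ge0.
- exact: continuous_subspaceT.
- by rewrite -[X in _ --> X]oppr0; apply: cvgN; exact: cvgr_expR.
- by move=> x _; have [] := dE x.
- by apply: cvg_at_right_filter; apply: cvgN; exact: cE.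
- by move=> x _; rewrite derive1E; have [_ ->] := dE x.
Qed.

Lemma gamma_int_nat n : (gamma_int n.+1%:R < +oo)%E.
Proof.
elim: n => [|n IH]; first by rewrite gamma_int1 ltry.
by rewrite -natr1 gamma_intS// lte_mul_pinfty// lee_fin.
Qed.

(** For r >= 1, t^(r - 1) <= 1 + t^k with an integer k >= r compares with two integer values. For
    smaller [s] an infinite value would make the value at [s + 1] infinite. *)
Lemma gamma_int_fin s : 0 < s -> (gamma_int s < +oo)%E.
Proof.
have ge1 r : 1 <= r -> (gamma_int r < +oo)%E.
  move=> r1; pose k := Num.bound r.
  apply: (@le_lt_trans _ _ (gamma_int 1 + gamma_int k.+1%:R)%E); last first.
    apply: lte_add_pinfty; last exact: gamma_int_nat.
    by rewrite gamma_int1 ltry.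
  rewrite /gamma_int -ge0_integralD//; last 4 first.
  - by move=> t _; rewrite lee_fin gamma_fun_ge0.
  - exact: measurable_gamma_fun.
  - by move=> t _; rewrite lee_fin gamma_fun_ge0.
  - exact: measurable_gamma_fun.
  apply: ge0_le_integral => //.
  - by move=> t _; rewrite lee_fin gamma_fun_ge0.
  - exact: measurable_gamma_fun.
  - by apply: emeasurable_funD; exact: measurable_gamma_fun.
  move=> t; rewrite /= in_itv/= andbT => t0; rewrite -EFinD lee_fin -mulrDl.
  rewrite ler_wpM2r ?expR_ge0// subrr powRr0.
  have [t1|t1] := leP 1 t.
    rewrite -[leLHS]add0r lerD// ler_powR// lerD2r.
    apply: (@le_trans _ _ k%:R); last by rewrite ler_nat.
    by rewrite ltW// archi_boundP// (le_trans ler01).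
  rewrite -[leLHS]addr0 lerD ?powR_ge0//.
  have p1 : 1 `^ (r - 1) = 1 :> R by rewrite powR1.
  rewrite -[leRHS]p1; apply: ge0_ler_powR; rewrite ?nnegrE ?subr_ge0//; exact: ltW.
move=> s0.
have := ge1 (s + 1); rewrite lerDr => /(_ (ltW s0)); rewrite gamma_intS//.
have := gamma_int_ge0 s; case: (gamma_int s) => [r _ _|_|//]; first exact: ltry.
by rewrite gt0_muley ?lte_fin// ltxx.
Qed.

(** For r >= 1 the integrand is at least exp(-2) between 1 and 2; the functional equation extends
    positivity to every [s > 0]. *)
Lemma gamma_int_gt0 s : 0 < s -> (0 < gamma_int s)%E.
Proof.
have ge1 r : 1 <= r -> (0 < gamma_int r)%E.
  move=> r1; apply: (@lt_le_trans _ _ (\int[leb]_(t in `[1%R, 2%R]) (expR (- 2))%:E)%E).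
    rewrite integral_cst; last exact: measurable_itv.
    have l12 : leb `[1%R, 2%R]%classic = 1%:E.
      rewrite lebesgue_measure_itv/= lte_fin ltr1n -EFinB; congr EFin; lra.
    have := mule_gt0 (_ : (0 < (expR (- 2 : R))%:E)%E) (@lte01 R).
    by rewrite lte_fin expR_gt0 -{1}l12; apply.
  apply: (@le_trans _ _ (\int[leb]_(t in `[1%R, 2%R]) (gamma_fun r t)%:E)%E).
    apply: ge0_le_integral => //.
    - exact: measurable_gamma_fun.
    move=> t; rewrite /= in_itv/= => /andP[t1 t2]; rewrite lee_fin.
    rewrite -[leLHS]mul1r ler_pM ?expR_ge0//; last by rewrite ler_expR lerN2.
    apply: (@le_trans _ _ (t `^ 0)); first by rewrite powRr0.
    by apply: ler_powR => //; rewrite subr_ge0.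
  apply: ge0_subset_integral => //.
  - exact: measurable_gamma_fun.
  - by move=> t _; rewrite lee_fin gamma_fun_ge0.
  - move=> t /=; rewrite !in_itv/= andbT => /andP[t1 _]; exact: lt_le_trans t1.
move=> s0; have := ge1 (s + 1); rewrite lerDr => /(_ (ltW s0)); rewrite gamma_intS//.
by rewrite pmule_rgt0 ?lte_fin.
Qed.

Lemma GammaE (s : R) : Gamma s = fine (gamma_int s).
Proof. by []. Qed.

Lemma Gamma_gt0 (s : R) : 0 < s -> 0 < Gamma s.
Proof. by move=> s0; rewrite GammaE fine_gt0// gamma_int_gt0// gamma_int_fin. Qed.

Lemma GammaS (s : R) : 0 < s -> Gamma (s + 1) = s * Gamma s.
Proof.
move=> s0; rewrite !GammaE gamma_intS// fineM// ge0_fin_numE ?gamma_int_fin//.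
exact: gamma_int_ge0.
Qed.

End gamma_function.

(** * Paravectors and powers of the Dirac operator *)

Section paravectors.
Variables (R : realType) (p q : nat).
Local Notation Cl := (clifford R (p + q)).
Local Notation vec := (@vecq R p q).
Implicit Types (y z w : 'rV[R]_q).

Lemma para_e0 (i : 'I_(p.+1 + q)) : i = 0%N :> nat -> para_e R i = 1.
Proof.
move=> i0; rewrite /para_e; case: unliftP => [j ij|//].
by move: i0; rewrite ij.
Qed.

Lemma para_e_gen (i : 'I_(p.+1 + q)) : (0 < i)%N ->
  exists2 j, i = lift (@ord0 (p + q)) j & para_e R i = cl_gen R j.
Proof.
move=> i0; rewrite /para_e; case: unliftP => [j ij|i0']; first by exists j.
by move: i0; rewrite i0'.
Qed.

Lemma para_eC (i j : 'I_(p.+1 + q)) : (0 < i)%N -> (0 < j)%N ->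
  para_e R i * para_e R j + para_e R j * para_e R i = - (2 *+ (i == j)) *: 1.
Proof.
move=> /para_e_gen[i' -> ->] /para_e_gen[j' -> ->].
by rewrite cl_genC (inj_eq lift_inj).
Qed.

Lemma cl_norm1 : `|1 : Cl| <= 1.
Proof. exact: cl_norm_blade. Qed.

Lemma para_e_norm (i : 'I_(p.+1 + q)) : `|para_e R i| <= 1.
Proof. by rewrite /para_e; case: unlift => [j|]; exact: cl_norm_blade. Qed.

Definition para_conj (i : 'I_p.+1) : Cl :=
  if i == ord0 then 1 else - para_e R (lshift q i).

Lemma para_conj_norm i : `|para_conj i| <= 1.
Proof.
rewrite /para_conj; case: ifP => _; first exact: cl_norm1.
by rewrite normrN para_e_norm.
Qed.

(** Polarized form of the identity that a paravector times its conjugate is its squared norm. It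
    cancels the mixed second derivatives in the factorization of the Laplacian. *)
Lemma para_conjM (i j : 'I_p.+1) :
  para_conj i * para_e R (lshift q j) + para_conj j * para_e R (lshift q i) =
  (2 *+ (i == j)) *: 1.
Proof.
rewrite /para_conj; have [->|i0] := eqVneq i ord0.
  have [->|j0] := eqVneq j ord0.
    by rewrite para_e0// mul1r scaler_nat.
  by rewrite [para_e _ (lshift q ord0)]para_e0// mul1r mulr1 subrr scale0r.
have [->|j0] := eqVneq j ord0.
  by rewrite [para_e _ (lshift q ord0)]para_e0// mul1r mulr1 addNr (negbTE i0) scale0r.
rewrite !mulNr -opprD para_eC; first by rewrite scaleNr opprK (inj_eq (@lshift_inj _ _)).
- by rewrite lt0n.
- by rewrite lt0n.
Qed.

Lemma vecqD y z : vec (y + z) = vec y + vec z.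
Proof.
rewrite /vecq -big_split; apply: eq_bigr => j _ /=.
by rewrite mxE scalerDl.
Qed.

Lemma vecqZ a y : vec (a *: y) = a *: vec y.
Proof.
rewrite /vecq scaler_sumr; apply: eq_bigr => j _ /=.
by rewrite mxE scalerA.
Qed.

Lemma vecq_delta j : vec (delta_mx ord0 j) = para_e R (rshift p.+1 j).
Proof.
rewrite /vecq (bigD1 j)//= big1 ?addr0; last first.
  by move=> k kj; rewrite mxE eqxx (negbTE kj) scale0r.
by rewrite mxE !eqxx scale1r.
Qed.

Lemma para_e_vecq j y :
  para_e R (rshift p.+1 j) * vec y + vec y * para_e R (rshift p.+1 j) =
  - (2 * y ord0 j) *: 1.
Proof.
rewrite /vecq mulr_sumr mulr_suml -big_split/=.
rewrite (eq_bigr (fun k => (y ord0 k * - (2 *+ (j == k))) *: (1 : Cl))); last first.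
  move=> k _; rewrite -scalerAr -scalerAl -scalerDr para_eC//.
  by rewrite scalerA (inj_eq (@rshift_inj _ _)).
rewrite (bigD1 j)//= big1 ?addr0; last first.
  by move=> k kj; rewrite eq_sym (negbTE kj) mulr0n oppr0 mulr0 scale0r.
by rewrite eqxx mulr1n mulrN mulrC.
Qed.

Lemma vecq_sqr y : vec y * vec y = - dot y y *: 1.
Proof.
have H : vec y * vec y + vec y * vec y = - (2 * dot y y) *: 1.
  (* The left factor is expanded in one copy and the right factor in the other, so that every
     summand is an anticommutator. *)
  rewrite [X in X + _ = _]mulr_suml [X in _ + X]mulr_sumr -big_split/=.
  rewrite (eq_bigr (fun j => (y ord0 j * - (2 * y ord0 j)) *: (1 : Cl))); last first.
    move=> j _; rewrite -scalerAr -scalerAl -scalerDr para_e_vecq.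
    by rewrite scalerA.
  rewrite -scaler_suml; congr (_ *: _); rewrite /dot mulr_sumr -sumrN.
  by apply: eq_bigr => j _; ring.
apply: (@scalerI R Cl 2); first by rewrite pnatr_eq0.
by rewrite scaler_nat mulr2n H scalerA mulrN.
Qed.

Lemma vecq_norm y : `|vec y| <= q%:R * enorm y.
Proof.
apply: le_trans (ler_norm_sum _ _ _) _.
have -> : q%:R * enorm y = \sum_(j < q) enorm y by rewrite sumr_const card_ord mulr_natl.
apply: ler_sum => j _; rewrite normrZ -[leRHS]mulr1.
by rewrite ler_pM// ?coord_le_enorm_row// para_e_norm.
Qed.

Lemma para_e_vecqC i y : para_e R (lshift q i) * vec y = vec y * para_conj i.
Proof.
rewrite /para_conj; case: eqP => [->|/eqP i0].
  by rewrite para_e0// mul1r mulr1.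
rewrite /vecq mulr_sumr mulr_suml; apply: eq_bigr => j _.
rewrite -scalerAr -scalerAl; congr (_ *: _).
apply/eqP; rewrite mulrN -addr_eq0 para_eC//; last by rewrite lt0n.
by rewrite eq_lrshift mulr0n oppr0 scale0r.
Qed.

Lemma para_conj_vecqC i y : para_conj i * vec y = vec y * para_e R (lshift q i).
Proof.
have := para_e_vecqC i y; rewrite /para_conj; case: eqP => [->|_ H].
  by move=> _; rewrite para_e0// mul1r mulr1.
by rewrite mulNr H mulrN opprK.
Qed.

Definition para_alt (k : nat) (i : 'I_p.+1) : Cl :=
  if odd k then para_conj i else para_e R (lshift q i).

Lemma para_alt_norm k i : `|para_alt k i| <= 1.
Proof.
by rewrite /para_alt; case: odd; [exact: para_conj_norm|exact: para_e_norm].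
Qed.

Lemma para_e_pow i y k : para_e R (lshift q i) * vec y ^+ k = vec y ^+ k * para_alt k i.
Proof.
rewrite /para_alt; elim: k => [|k IH]; first by rewrite expr0 mul1r mulr1.
rewrite [X in _ * X]exprSr mulrA IH -mulrA exprSr -mulrA /=.
by case: (odd k) => /=; rewrite ?para_e_vecqC ?para_conj_vecqC.
Qed.

End paravectors.

(** * The functions U_k and their growth *)

Section alternating_dirac.
Variables (R : realType) (p q : nat).
Local Notation Cl := (clifford R (p + q)).
Local Notation Rp := 'rV[R]_p.+1.
Local Notation vec := (@vecq R p q).
Variables (Omega0 : set Rp) (f0 : Rp -> Cl).
Hypotheses (oO : open Omega0) (f0O : real_analytic_on Omega0 f0).

(* [alt_dirac k] is [D (D^* D) ^ (k/2) f0] or [(D^* D) ^ (k/2) f0], with [D] the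
   operator [D_(x_p)] and [D^*] its conjugate: since [e_i x_q = x_q e_i^*],
   the operator [x_q D] satisfies [(x_q D) ^ k f0 = x_q ^ k * alt_dirac k]. *)
Fixpoint alt_dirac (k : nat) : Rp -> Cl :=
  if k is k'.+1 then
    fun y => \sum_(i < p.+1) para_alt R q k' i * 'D_(delta_mx ord0 i) (alt_dirac k') y
  else f0.

Lemma alt_dirac_analytic k : real_analytic_on Omega0 (alt_dirac k).
Proof.
elim: k => [//|k IH] /=; apply: analytic_sum => i; apply: analytic_Ml.
exact: analytic_derive.
Qed.

Lemma alt_dirac_is_derive k i y : Omega0 y ->
  is_derive y (delta_mx ord0 i) (alt_dirac k) ('D_(delta_mx ord0 i) (alt_dirac k) y).
Proof.
by move=> Oy; apply: derivableP; apply: analytic_derivable Oy => //; exact: alt_dirac_analytic.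
Qed.

Lemma near_Omega0 (P : Rp -> Prop) y : (forall z, Omega0 z -> P z) -> Omega0 y -> \near y, P y.
Proof.
move=> OP Oy; have : nbhs y Omega0 by exact: open_nbhs_nbhs.
by apply: filterS.
Qed.

Lemma eq_on_is_derive (f g : Rp -> Cl) y v df : (forall z, Omega0 z -> f z = g z) ->
  Omega0 y -> is_derive y v g df -> is_derive y v f df.
Proof.
move=> fg Oy; apply: near_eq_is_derive.
by apply: (near_Omega0 (P := fun z => g z = f z)) => // z Oz; rewrite fg.
Qed.

Lemma iter_vecq_Dxp k w y : Omega0 y ->
  iter k (fun (g : Rp -> Cl) y => vec w * Dxp g y) f0 y = vec w ^+ k * alt_dirac k y.
Proof.
elim: k y => [|k IH] y Oy; first by rewrite expr0 mul1r.
rewrite iterS exprS -mulrA; congr (_ * _); rewrite /Dxp /= mulr_sumr.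
apply: eq_bigr => i _.
rewrite mulrA -para_e_pow -mulrA; congr (_ * _).
(* The induction hypothesis holds on [Omega0] only; as this set is open, it may be
   differentiated. *)
have [_ E] := eq_on_is_derive IH Oy (is_derive_clMl (vec w ^+ k)
  (alt_dirac_is_derive k i Oy)).
exact: E.
Qed.

Lemma alt_diracSS k y : Omega0 y -> ~~ odd k ->
  alt_dirac k.+2 y = laplacian (alt_dirac k) y.
Proof.
move=> Oy ek.
pose H i j : Cl := 'D_(delta_mx ord0 i) ('D_(delta_mx ord0 j) (alt_dirac k)) y.
have HC i j : H i j = H j i by apply: analytic_deriveC Oy => //; exact: alt_dirac_analytic.
have E : alt_dirac k.+2 y = \sum_i \sum_j para_conj R q i * para_e R (lshift q j) * H i j.
  rewrite [LHS]/=; apply: eq_bigr => i _; rewrite {1}/para_alt /= ek.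
  under eq_fun => z do under eq_bigr => j _ do rewrite /para_alt (negbTE ek).
  have H' j : is_derive y (delta_mx ord0 i)
      (fun z => para_e R (lshift q j) * 'D_(delta_mx ord0 j) (alt_dirac k) z)
      (para_e R (lshift q j) * H i j).
    apply: is_derive_clMl; apply: derivableP.
    exact: (analytic_derivable oO (analytic_derive _ oO (alt_dirac_analytic k)) Oy).
  have [_ ->] := is_derive_big (index_enum _) H'.
  by rewrite mulr_sumr; apply: eq_bigr => j _; rewrite mulrA.
(* Twice the double sum is symmetrized in [i] and [j]; since second derivatives commute, the
   polarized identity leaves the diagonal. *)
apply: (@scalerI R Cl 2); first by rewrite pnatr_eq0.
rewrite E [LHS]scaler_nat mulr2n [X in X + _]exchange_big -big_split /laplacian scaler_sumr.
apply: eq_bigr => i _; rewrite -big_split/=.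
rewrite (eq_bigr (fun j => (2 *+ (i == j)) *: H i j)); last first.
  move=> j _; rewrite [in X in _ + X]HC -mulrDl para_conjM.
  by rewrite -scalerAl mul1r (HC j i) eq_sym; reflexivity.
rewrite (bigD1 i)//= big1 ?addr0; first by rewrite eqxx.
by move=> j ji; rewrite eq_sym (negbTE ji) scale0r.
Qed.

Lemma iter_laplacian k y : Omega0 y ->
  iter k (@laplacian R p.+1 Cl) f0 y = alt_dirac k.*2 y.
Proof.
elim: k y => [//|k IH] y Oy.
rewrite doubleS alt_diracSS; [|exact: Oy|by rewrite odd_double].
rewrite iterS /laplacian; apply: eq_bigr => i _.
have H : is_derive y (delta_mx ord0 i) ('D_(delta_mx ord0 i) (alt_dirac k.*2))
   ('D_(delta_mx ord0 i) ('D_(delta_mx ord0 i) (alt_dirac k.*2)) y).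
  apply: derivableP.
  exact: (analytic_derivable oO (analytic_derive _ oO (alt_dirac_analytic k.*2)) Oy).
have [_ E] := eq_on_is_derive (fun z Oz => @derive_val _ _ _ _ _ _ _
  (eq_on_is_derive IH Oz (alt_dirac_is_derive k.*2 i Oz))) Oy H.
exact: E.
Qed.

Lemma alt_dirac_bound a : Omega0 a -> exists rho C K, [/\ 0 < rho, 0 < K,
  forall y, `|y - a| < rho -> Omega0 y,
  forall k y, `|y - a| < rho -> `|alt_dirac k y| <= C * K ^+ k * k`!%:R &
  forall k i y, `|y - a| < rho ->
    `|'D_(delta_mx ord0 i) (alt_dirac k) y| <= C * K ^+ k * k`!%:R].
Proof.
move=> Oa; have [M [C [rho [M0 rho0 rhoM pf rhoO]]]] := analytic_local oO f0O Oa.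
(* The cost of one Dirac step: a Clifford product for each of the [p.+1] summands. *)
pose L : R := cl_kappa R (p + q) * p.+1%:R.
have L0 : 0 < L by rewrite mulr_gt0// (lt_le_trans ltr01 (cl_kappa_ge1 _ _)).
have C0 : 0 <= C.
  have := pser_norm M0 rhoM pf (x := a); rewrite subrr normr0 => /(_ rho0).
  rewrite expr0 mulr1 fact0 mulr1 => /(le_trans (normr_ge0 _)).
  by rewrite pmulr_lge0// exprn_gt0.
have pU k : pser_at a rho M (C * L ^+ k) k (alt_dirac k).
  elim: k => [|k IH]; first by rewrite mulr1.
  rewrite [alt_dirac _]/=.
  have H i : pser_at a rho M (cl_kappa R (p + q) * (C * L ^+ k)) k.+1
      (fun y => para_alt R q k i * 'D_(delta_mx ord0 i) (alt_dirac k) y).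
    have [_ Hi] := pser_derive M0 rhoM i IH.
    apply: (pser_le M0 _ (pserMl (para_alt R q k i) Hi)).
    rewrite ler_wpM2r ?mulr_ge0 ?exprn_ge0 ?(ltW L0)//.
    by rewrite -[leRHS]mulr1 ler_wpM2l ?cl_kappa_ge0 ?para_alt_norm.
  apply: (pser_le M0 _ (pser_sum (index_enum _) H)).
  rewrite /index_enum -enumT size_enum_ord exprSr -mulr_natl /L.
  rewrite le_eqVlt; apply/orP; left; apply/eqP; ring.
clearbody L; pose m := p.+1.
(* One more derivative costs 2 M (k + 1). The factor 2 M goes into [1 + 2 * M], and k + 1 <= 2^k is
   absorbed by taking 4 M L in place of 2 M L. *)
exists rho, (C * 2 ^+ m * (1 + 2 * M)), (4 * M * L); split => //.
- by rewrite mulr_gt0// mulr_gt0// ltr0n.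
- move=> k y ya; apply: le_trans (pser_norm M0 rhoM (pU k) ya) _.
  have -> : C * L ^+ k * (2 * M) ^+ k * k`!%:R * 2 ^+ p.+1 =
     C * 2 ^+ m * (2 * M * L) ^+ k * k`!%:R by rewrite /m !exprMn; ring.
  rewrite ler_wpM2r// ler_pM ?mulr_ge0 ?exprn_ge0 ?mulr_ge0 ?(ltW M0) ?(ltW L0)//.
    by rewrite ler_peMr ?mulr_ge0 ?exprn_ge0// lerDl mulr_ge0 ?(ltW M0).
  rewrite lerXn2r ?nnegrE ?mulr_ge0 ?(ltW M0) ?(ltW L0)//.
  by rewrite !ler_wpM2r ?(ltW M0) ?(ltW L0)// ler_nat.
- move=> k i y ya; have [_ Hi] := pser_derive M0 rhoM i (pU k).
  apply: le_trans (pser_norm M0 rhoM Hi ya) _.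
  have -> : C * L ^+ k * (2 * M) ^+ k.+1 * k.+1`!%:R * 2 ^+ p.+1 =
     C * 2 ^+ m * (2 * M) * (k.+1%:R * (2 * M * L) ^+ k) * k`!%:R.
    by rewrite /m factS natrM exprS !exprMn; ring.
  have M2 : 0 <= 2 * M by rewrite mulr_ge0 ?(ltW M0).
  rewrite ler_wpM2r// ler_pM ?mulr_ge0 ?exprn_ge0 ?mulr_ge0 ?(ltW M0) ?(ltW L0)//.
    by rewrite ler_wpM2l ?mulr_ge0 ?exprn_ge0// lerDr.
  have -> : 4 * M * L = 2 * (2 * M * L) by ring.
  rewrite [leRHS]exprMn ler_wpM2r ?exprn_ge0 ?mulr_ge0 ?(ltW M0) ?(ltW L0)//.
  by rewrite -natrX ler_nat ltn_expl.
Qed.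

End alternating_dirac.

(** * Derivatives of Clifford powers *)

Section power_derivative.
Variables (R : realType) (n : nat).
Local Notation Cl := (clifford R n).
Implicit Types (b z : Cl).

Lemma cl_cvgZ (T : Type) (F : set_system T) {FF : Filter F} (f : T -> Cl) (c : R) (l : Cl) :
  f @ F --> l -> (fun t => c *: f t) @ F --> c *: l.
Proof.
move=> fl; have H : (fun t => (c *: 1 : Cl) * f t) @ F --> (c *: 1 : Cl) * l.
  by apply: cl_cvgM; [exact: cvg_cst|exact: fl].
rewrite -scalerAl mul1r in H.
by under eq_fun => t do rewrite -[f t]mul1r scalerAl.
Qed.

Lemma near_eq_continuous (V : topologicalType) (f g : V -> Cl) (x : V) :
  (\near x, f x = g x) -> {for x, continuous g} -> {for x, continuous f}.
Proof.
move=> fg gx; have fgx : f x = g x by exact: nbhs_singleton fg.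
suff H : f @ x --> g x by rewrite /prop_for /continuous_at fgx.
by apply: cvg_trans gx; apply: near_eq_cvg; apply: filterS fg => y ->.
Qed.

(* The derivative of [z |-> z ^ k] in the direction [b]. *)
Fixpoint cl_dpow b z (k : nat) : Cl :=
  if k is k'.+1 then b * z ^+ k' + z * cl_dpow b z k' else 0.

(** Euler's identity: in the direction of [z] itself all factors commute. *)
Lemma cl_dpow_self z k : cl_dpow z z k = k%:R *: z ^+ k.
Proof.
elim: k => [|k IH] /=; first by rewrite scale0r.
by rewrite IH -scalerAr -exprS -addn1 natrD scalerDl scale1r addrC.
Qed.

Lemma cl_dpow_sum (J : finType) (s : J -> R) (b : J -> Cl) z k :
  \sum_j s j *: cl_dpow (b j) z k = cl_dpow (\sum_j s j *: b j) z k.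
Proof.
elim: k => [|k IH] /=; first by rewrite big1// => j _; rewrite scaler0.
rewrite -IH mulr_suml mulr_sumr -big_split; apply: eq_bigr => j _ /=.
by rewrite scalerDr scalerAl scalerAr.
Qed.

Lemma cl_pow_norm z k (e : R) : `|z| <= e -> `|z ^+ k| <= (cl_kappa R n * e) ^+ k.
Proof.
move=> ze; elim: k => [|k IH]; first exact: cl_norm_blade.
rewrite exprS; apply: le_trans (cl_normM _ _) _; rewrite exprS.
by rewrite ler_pM ?mulr_ge0 ?cl_kappa_ge0// ler_wpM2l ?cl_kappa_ge0.
Qed.

(** The factor [e] on the left avoids the exponent k - 1, which would be truncated at [k = 0]. *)
Lemma cl_dpow_norm b z k (e : R) : `|z| <= e ->
  `|cl_dpow b z k| * e <= `|b| * k%:R * (cl_kappa R n * e) ^+ k.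
Proof.
move=> ze; have e0 : 0 <= e by exact: le_trans ze.
elim: k => [|k IH] /=; first by rewrite normr0 mul0r mulr0 mul0r.
apply: le_trans (_ : (cl_kappa R n * `|b| * (cl_kappa R n * e) ^+ k +
   cl_kappa R n * e * `|cl_dpow b z k|) * e <= _).
  rewrite ler_wpM2r//; apply: le_trans (ler_normD _ _) _; apply: lerD.
    apply: le_trans (cl_normM _ _) _.
    by rewrite ler_wpM2l ?mulr_ge0 ?cl_kappa_ge0// cl_pow_norm.
  apply: le_trans (cl_normM _ _) _; rewrite ler_wpM2r//.
  by rewrite ler_wpM2l ?cl_kappa_ge0.
have -> : `|b| * k.+1%:R * (cl_kappa R n * e) ^+ k.+1 =
  cl_kappa R n * `|b| * (cl_kappa R n * e) ^+ k * e +
  cl_kappa R n * e * (`|b| * k%:R * (cl_kappa R n * e) ^+ k).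
  by rewrite exprS -addn1 natrD; ring.
by rewrite mulrDl lerD2l -mulrA ler_wpM2l ?mulr_ge0 ?cl_kappa_ge0.
Qed.

Lemma cl_pow_continuous (V : topologicalType) (g : V -> Cl) x k :
  {for x, continuous g} -> {for x, continuous (fun y => g y ^+ k)}.
Proof.
move=> gx; elim: k => [|k IH].
  exact: (@cst_continuous _ _ (1 : Cl)).
rewrite (_ : (fun y => _) = fun y => g y * g y ^+ k); first exact: cl_cvgM.
by apply/funext => y; rewrite exprS.
Qed.

Lemma cl_dpow_continuous (V : topologicalType) b (g : V -> Cl) x k :
  {for x, continuous g} -> {for x, continuous (fun y => cl_dpow b (g y) k)}.
Proof.
move=> gx; elim: k => [|k IH] /=; first exact: cst_continuous.
have H1 : (fun y => b * g y ^+ k) @ x --> b * g x ^+ k.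
  by apply: cl_cvgM; [exact: cvg_cst|exact: cl_pow_continuous].
have H2 : (fun y => g y * cl_dpow b (g y) k) @ x --> g x * cl_dpow b (g x) k.
  by apply: cl_cvgM; [exact: gx|exact: IH].
exact: (cvgD H1 H2).
Qed.

Lemma is_derive_cl_pow (V : normedModType R) (g : V -> Cl) (x v : V) b k :
  is_derive x v g b -> is_derive x v (fun y => g y ^+ k) (cl_dpow b (g x) k).
Proof.
move=> gx; elim: k => [|k IH] /=.
  by under eq_fun do rewrite expr0; exact: is_derive_cst.
by under eq_fun do rewrite exprS; exact: is_derive_clM.
Qed.

Lemma is_derive_clZ (V : normedModType R) (g : V -> Cl) (x v : V) (dg : Cl) (c : R) :
  is_derive x v g dg -> is_derive x v (fun y => c *: g y) (c *: dg).
Proof. by move=> gx; have H := is_deriveZ c gx; exact: H. Qed.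

Lemma cl_series_sum_cvg (J : Type) (s : seq J) (b : J -> Cl) (u : J -> nat -> Cl) :
  (forall j, cvgn (series (u j))) ->
  series (fun k => \sum_(j <- s) b j * u j k) @ \oo -->
    \sum_(j <- s) b j * limn (series (u j)).
Proof.
move=> ucvg.
rewrite (_ : series _ = fun k => \sum_(j <- s) b j * series (u j) k); last first.
  apply/funext => k; rewrite /series/= exchange_big/=; apply: eq_bigr => j _.
  by rewrite mulr_sumr.
elim: s => [|j s IH].
  rewrite big_nil; under eq_fun do rewrite big_nil; exact: cvg_cst.
rewrite big_cons; under eq_fun do rewrite big_cons.
have H1 : (fun k => b j * series (u j) k) @ \oo --> b j * limn (series (u j)).
  by apply: cl_cvgM; [exact: cvg_cst|exact: ucvg].
exact: (cvgD H1 IH).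
Qed.

End power_derivative.

(** * The Dirac operator on powers of x_q *)

Section vector_dirac.
Variables (R : realType) (p q : nat).
Local Notation Cl := (clifford R (p + q)).
Local Notation vec := (@vecq R p q).

(* [D_(x_q)] applied to [x_q ^ k] is [- dirac_coef k * x_q ^ (k - 1)]. *)
Fixpoint dirac_coef (k : nat) : R :=
  if k is k'.+1 then q%:R + 2 * k'%:R - dirac_coef k' else 0.

Lemma dirac_coef_double m : dirac_coef m.*2 = m.*2%:R.
Proof.
elim: m => [//|m IH]; rewrite doubleS /= IH -addn2 natrD -addn1 natrD; ring.
Qed.

Lemma dirac_coef_doubleS m : dirac_coef m.*2.+1 = q%:R + m.*2%:R.
Proof. rewrite /= dirac_coef_double; ring. Qed.

Lemma sum_vecq_dpow (y : 'rV[R]_q) k :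
  \sum_(j < q) para_e R (rshift p.+1 j) * cl_dpow (para_e R (rshift p.+1 j)) (vec y) k.+1 =
  - dirac_coef k.+1 *: vec y ^+ k.
Proof.
pose e j := para_e R (rshift p.+1 j) : Cl.
have ee j : e j * e j = - 1.
  apply: (@scalerI R Cl 2); first by rewrite pnatr_eq0.
  by rewrite [LHS]scaler_nat mulr2n para_eC// eqxx mulr1n scaleNr scalerN.
(* Besides e_j^2 = -1, moving e_j past x_q leaves directional derivatives weighted by the
   coordinates of [y]; their sum is the derivative in the direction of x_q, known by Euler's
   identity. *)
have step m : \sum_(j < q) e j * cl_dpow (e j) (vec y) m.+1 =
    - (q%:R + 2 * m%:R) *: vec y ^+ m - vec y * \sum_(j < q) e j * cl_dpow (e j) (vec y) m.
  transitivity (\sum_(j < q) (- vec y ^+ m - vec y * (e j * cl_dpow (e j) (vec y) m)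
      - (2 * y ord0 j) *: cl_dpow (e j) (vec y) m)).
    apply: eq_bigr => j _ /=; rewrite mulrDr !mulrA ee mulN1r -addrA; congr (_ + _).
    have -> : e j * vec y = - (vec y * e j) - (2 * y ord0 j) *: 1.
      by rewrite -[LHS](addrK (vec y * e j)) para_e_vecq scaleNr addrC.
    by rewrite mulrBl mulNr -scalerAl mul1r.
  rewrite !sumrB sumr_const card_ord -mulr_sumr.
  have -> : \sum_(j < q) (2 * y ord0 j) *: cl_dpow (e j) (vec y) m = (2 * m%:R) *: vec y ^+ m.
    under eq_bigr => j _ do rewrite -scalerA.
    rewrite -scaler_sumr cl_dpow_sum.
    by rewrite -/(vecq p y) cl_dpow_self scalerA.
  rewrite opprD scalerDl -!addrA; congr (_ + _); first by rewrite mulNrn scaleNr scaler_nat.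
  by rewrite addrC scaleNr.
elim: k => [|k IH].
  rewrite step big1 ?mulr0 ?subr0; first by rewrite /= mulr0 addr0 subr0.
  by move=> j _; rewrite mulr0.
by rewrite step IH -scalerAr -exprS -scalerBl; congr (_ *: _) => /=; ring.
Qed.

Lemma vecq_pow_double (y : 'rV[R]_q) m :
  vec y ^+ m.*2 = ((-1) ^+ m * enorm y ^+ (2 * m)) *: 1.
Proof.
have E : dot y y = enorm y ^+ 2.
  by rewrite enorm_sqr; apply: eq_bigr => i _; rewrite expr2.
elim: m => [|m IH]; first by rewrite !expr0 mul1r scale1r.
rewrite doubleS (exprS (vec y)) (exprS (vec y)) mulrA vecq_sqr IH E -scalerAl mul1r scalerA.
by congr (_ *: _); rewrite (exprS (-1)) mulnS exprD; ring.
Qed.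

Lemma vecq_pow_doubleM (y : 'rV[R]_q) m (u : Cl) :
  vec y ^+ m.*2 * u = ((-1) ^+ m * enorm y ^+ (2 * m)) *: u.
Proof. by rewrite vecq_pow_double -scalerAl mul1r. Qed.

Lemma vecq_pow_doubleSM (y : 'rV[R]_q) m (u : Cl) :
  vec y ^+ m.*2.+1 * u = ((-1) ^+ m * enorm y ^+ (2 * m)) *: (vec y * u).
Proof. by rewrite exprSr -mulrA vecq_pow_doubleM. Qed.

End vector_dirac.

(** * The domain of the extensions *)

Section row_vector_norm.
Variable R : realType.

Lemma lipschitz_continuous (V W : normedModType R) (f : V -> W) (C : R) :
  (forall x y, `|f x - f y| <= C * `|x - y|) -> continuous f.
Proof.
move=> fC x; apply/cvgrPdist_le => e e0.
have C0 : 0 < 1 + `|C| by rewrite ltr_pwDl.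
have : nbhs x (ball x (e / (1 + `|C|))) by apply: nbhsx_ballx; rewrite divr_gt0.
apply: filterS => y; rewrite -ball_normE/= => xy.
apply: le_trans (fC x y) _; apply: le_trans (_ : (1 + `|C|) * `|x - y| <= _).
  by rewrite ler_wpM2r// (le_trans (ler_norm _))// lerDr.
by rewrite mulrC -ler_pdivlMr// ltW.
Qed.

Lemma coord_le_norm n (x : 'rV[R]_n) i : `|x ord0 i| <= `|x|.
Proof. by rewrite [leRHS]mx_normrE; apply/bigmax_geP; right; exists (ord0, i). Qed.

Lemma row_norm_le n (x : 'rV[R]_n) (e : R) : 0 <= e ->
  (forall i, `|x ord0 i| <= e) -> `|x| <= e.
Proof.
move=> e0 xe; rewrite [leLHS]mx_normrE; apply/bigmax_leP; split => // -[i j] _.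
by rewrite (ord1 i).
Qed.

Lemma lsubmx_norm m n (x : 'rV[R]_(m + n)) : `|lsubmx x| <= `|x|.
Proof. by apply: row_norm_le => // i; rewrite mxE coord_le_norm. Qed.

Lemma rsubmx_norm m n (x : 'rV[R]_(m + n)) : `|rsubmx x| <= `|x|.
Proof. by apply: row_norm_le => // i; rewrite mxE coord_le_norm. Qed.

Lemma row_mx_norm m n (x : 'rV[R]_m) (y : 'rV[R]_n) : `|row_mx x y| <= `|x| + `|y|.
Proof.
apply: row_norm_le => [|i]; first exact: addr_ge0.
rewrite mxE; case: (fintype.splitP i) => j _.
  by apply: le_trans (coord_le_norm _ _) _; rewrite lerDl.
by apply: le_trans (coord_le_norm _ _) _; rewrite lerDr.
Qed.

Lemma lsubmx_continuous m n : continuous (@lsubmx R 1 m n).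
Proof. by apply: (lipschitz_continuous (C := 1)) => x y; rewrite mul1r -linearB lsubmx_norm. Qed.

Lemma rsubmx_continuous m n : continuous (@rsubmx R 1 m n).
Proof. by apply: (lipschitz_continuous (C := 1)) => x y; rewrite mul1r -linearB rsubmx_norm. Qed.

Lemma dot_continuous n : continuous (fun x : 'rV[R]_n => dot x x : R).
Proof.
move=> x; apply: (@big_continuous R _ R^o _ _ (fun i (x : 'rV[R]_n) => x ord0 i * x ord0 i)) => i.
have H : (fun y : 'rV[R]_n => y ord0 i) @ x --> x ord0 i by exact: coord_continuous.
exact: (cvgM H H).
Qed.

Lemma enorm_continuous n : continuous (@enorm R n).
Proof.
move=> x; apply: (@continuous_comp _ _ _ (fun x : 'rV[R]_n => dot x x : R) (@Num.sqrt R)).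
  exact: dot_continuous.
exact: sqrt_continuous.
Qed.

Lemma enormZ n (s : R) (x : 'rV[R]_n) : enorm (s *: x) = `|s| * enorm x.
Proof.
apply/eqP; rewrite -(@eqrXn2 _ 2) ?mulr_ge0 ?enorm_ge0//.
rewrite exprMn !enorm_sqr mulr_sumr; apply/eqP; apply: eq_bigr => i _.
by rewrite mxE exprMn real_normK// num_real.
Qed.

Lemma enorm0 n : enorm (0 : 'rV[R]_n) = 0.
Proof. by rewrite -(scale0r 0) enormZ normr0 mul0r. Qed.

Lemma dotC n (x y : 'rV[R]_n) : dot x y = dot y x.
Proof. by apply: eq_bigr => i _; rewrite mulrC. Qed.

(** Pythagoras: |x|^2 - <x, w>^2 is the squared norm of x - <x, w> w. *)
Lemma dot_le_enorm n (x w : 'rV[R]_n) : enorm w = 1 -> `|dot x w| <= enorm x.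
Proof.
move=> w1; rewrite -(@ler_pXn2r _ 2) ?nnegrE ?enorm_ge0// real_normK ?num_real//.
rewrite -subr_ge0.
have -> : enorm x ^+ 2 - dot x w ^+ 2 = \sum_(i < n) (x ord0 i - dot x w * w ord0 i) ^+ 2.
  transitivity (enorm x ^+ 2 - 2 * dot x w * \sum_(i < n) x ord0 i * w ord0 i +
      dot x w ^+ 2 * enorm w ^+ 2).
    by rewrite w1 -/(dot x w); ring.
  rewrite !enorm_sqr; move: (dot x w) => c.
  rewrite !mulr_sumr -sumrB -big_split; apply: eq_bigr => i _ /=; ring.
by apply: sumr_ge0 => i _; exact: sqr_ge0.
Qed.

(** Each point is joined to the base by a segment in its fibre, so [W] is a union of connected sets
    that all contain the base. It is applied to the domain and to each of its slices. *)
Lemma star_fibres_connected m n (B : set 'rV[R]_m) (W : set 'rV[R]_(m + n)) :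
  connected B -> B !=set0 ->
  (forall a, B a -> W (row_mx a 0)) -> (forall x, W x -> B (lsubmx x)) ->
  (forall x (t : R), 0 <= t <= 1 -> W x -> W (row_mx (lsubmx x) (t *: rsubmx x))) ->
  connected W.
Proof.
move=> cB [b Bb] BW WB Wstar.
pose B' : set 'rV[R]_(m + n) := (fun a => row_mx a 0) @` B.
pose S (x : 'rV[R]_(m + n)) := (fun t : R => row_mx (lsubmx x) (t *: rsubmx x)) @` `[0, 1].
have cB' : connected B'.
  apply: connected_continuous_connected => //; apply: continuous_subspaceT.
  apply: (lipschitz_continuous (C := 1)) => x y; rewrite mul1r opp_row_mx add_row_mx subr0.
  by apply: le_trans (row_mx_norm _ _) _; rewrite normr0 addr0.
have cS x : connected (S x).
  apply: connected_continuous_connected; first exact: segment_connected.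
  apply: continuous_subspaceT.
  have lip (s t : R^o) : `|row_mx (lsubmx x) (s *: rsubmx x) - row_mx (lsubmx x) (t *: rsubmx x)|
      <= `|rsubmx x| * `|s - t|; last exact: lipschitz_continuous lip.
  rewrite opp_row_mx add_row_mx subrr -scalerBl.
  by apply: le_trans (row_mx_norm _ _) _; rewrite normr0 add0r normrZ mulrC.
have WE : W = \bigcup_(x in W) (B' `|` S x).
  apply/seteqP; split => [x Wx|x [y Wy [[a Ba <-]|[t t01 <-]]]].
  - exists x => //; right; exists 1; first by rewrite /= in_itv/= ler01 lexx.
    by rewrite scale1r hsubmxK.
  - exact: BW.
  - by apply: Wstar => //; move: t01; rewrite /= in_itv.
rewrite WE; apply: bigcup_connected.
  by exists (row_mx b 0) => x Wx; left; exists b.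
move=> x Wx; apply: connectedU; [|exact: cB'|exact: cS].
exists (row_mx (lsubmx x) 0); split; first by exists (lsubmx x) => //; exact: WB.
exists 0; first by rewrite /= in_itv/= lexx ler01.
by rewrite scale0r.
Qed.

End row_vector_norm.

(** * The tubes and their union *)

Section slice_domain.
Variables (R : realType) (p q : nat).
Local Notation Cl := (clifford R (p + q)).
Local Notation Rp := 'rV[R]_p.+1.
Local Notation Rpq := 'rV[R]_(p.+1 + q).
Variables (Omega0 : set Rp) (f0 : Rp -> Cl).
Hypotheses (oO : open Omega0) (f0O : real_analytic_on Omega0 f0) (q0 : (0 < q)%N).

(** The sup norm in x_p matches the balls of the power series; the Euclidean norm in x_q makes the
    tube invariant under rotations of R^q. *)
Definition slice_tube (a : Rp) (rho d : R) : set Rpq :=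
  [set x | `|lsubmx x - a| < rho /\ enorm (rsubmx x) < d].

(* On the tube, the series [sum_k c_k x_q ^ k alt_dirac k] with [|c_k| <= 1 / k!]
   and their term by term derivatives are dominated by a geometric series. *)
Definition slice_good (a : Rp) (rho d C K : R) : Prop :=
  [/\ 0 < d, 0 <= C /\ 0 < K, 4 * (cl_kappa R (p + q) * (q%:R * d) * K) <= 1,
  forall y, `|y - a| < rho -> Omega0 y &
  (forall k y, `|y - a| < rho -> `|alt_dirac f0 k y| <= C * K ^+ k * k`!%:R) /\
  (forall k i y, `|y - a| < rho ->
    `|'D_(delta_mx ord0 i) (alt_dirac f0 k) y| <= C * K ^+ k * k`!%:R)].

Definition CK_domain : set Rpq :=
  [set x | exists a rho d C K, slice_good a rho d C K /\ slice_tube a rho d x].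

Lemma slice_tube_open a rho d : open (slice_tube a rho d).
Proof.
rewrite (_ : slice_tube a rho d = (@lsubmx R 1 p.+1 q) @^-1` (ball a rho) `&`
    (@enorm R q \o @rsubmx R 1 p.+1 q) @^-1` [set r | r < d]).
  apply: openI; apply: open_comp.
  - by move=> x _; exact: lsubmx_continuous.
  - exact: ball_open.
  - move=> x _; apply: continuous_comp; first exact: rsubmx_continuous.
    exact: enorm_continuous.
  - exact: open_lt.
by apply/seteqP; split => x [xa xd]; split => //; move: xa;
  rewrite /= -ball_normE/= distrC.
Qed.

Lemma CK_domain_open : open CK_domain.
Proof.
rewrite openE => x [a [rho [d [C [K [good xT]]]]]].
have : nbhs x (slice_tube a rho d).
  by apply: open_nbhs_nbhs; split => //; exact: slice_tube_open.
by apply: filterS => y yT; exists a, rho, d, C, K.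
Qed.

Lemma CK_domain_sub x : CK_domain x -> Omega0 (lsubmx x).
Proof. by move=> [a [rho [d [C [K [[_ _ _ sub _] [xa _]]]]]]]; exact: sub. Qed.

Lemma CK_domain0 a : Omega0 a -> CK_domain (row_mx a 0).
Proof.
move=> Oa; have [rho [C [K [rho0 K0 sub UC dUC]]]] := alt_dirac_bound oO f0O Oa.
have k0 : 0 < cl_kappa R (p + q) by exact: lt_le_trans (cl_kappa_ge1 _ _).
have qR : 0 < q%:R :> R by rewrite ltr0n.
have kqK : 0 < 4 * (cl_kappa R (p + q) * q%:R * K) by rewrite !mulr_gt0// ltr0n.
(* This width turns the smallness condition of [slice_good] into an equality. *)
exists a, rho, (4 * (cl_kappa R (p + q) * q%:R * K))^-1, C, K; split; last first.
  by split; rewrite ?row_mxKl ?row_mxKr ?subrr ?normr0// enorm0 invr_gt0.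
split => //; first by rewrite invr_gt0.
- split => //; have := UC 0%N a; rewrite subrr normr0 => /(_ rho0).
  by rewrite expr0 fact0 !mulr1; exact: le_trans.
- set r := (_)^-1; have rE : 4 * (cl_kappa R (p + q) * q%:R * K) * r = 1.
    by rewrite divff// gt_eqF.
  by rewrite le_eqVlt -[X in _ == X]rE; apply/orP; left; apply/eqP; ring.
Qed.

(** The one geometric property of the domain: p-symmetry, stability under [radon_pt] and star-shaped
    fibres all follow from it. *)
Lemma CK_domain_shrink x y : CK_domain x -> lsubmx y = lsubmx x ->
  enorm (rsubmx y) <= enorm (rsubmx x) -> CK_domain y.
Proof.
move=> [a [rho [d [C [K [good [xa xd]]]]]]] yx yxn; exists a, rho, d, C, K; split => //.
by split; [rewrite yx|exact: le_lt_trans xd].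
Qed.

Lemma CK_domain_p_symmetric : p_symmetric CK_domain.
Proof.
move=> a r w r0 w1 Wx eta e1; apply: CK_domain_shrink Wx _ _.
  by rewrite !row_mxKl.
by rewrite !row_mxKr !enormZ w1 e1.
Qed.

Lemma CK_domain_radon x eta : CK_domain x -> usphere eta -> CK_domain (radon_pt eta x).
Proof.
move=> Wx e1; apply: CK_domain_shrink Wx _ _; first by rewrite row_mxKl.
by rewrite row_mxKr enormZ e1 mulr1 dot_le_enorm.
Qed.

Lemma slice_pt_continuous w : continuous (@slice_pt R p q w).
Proof.
apply: (lipschitz_continuous (C := (1 + `|w|))) => x y.
rewrite /slice_pt opp_row_mx add_row_mx -linearB -scalerBl.
apply: le_trans (row_mx_norm _ _) _; rewrite mulrDl mul1r lerD ?lsubmx_norm//.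
rewrite normrZ mulrC ler_wpM2l//.
have -> : rsubmx x ord0 ord0 - rsubmx y ord0 ord0 = rsubmx (x - y) ord0 ord0.
  by rewrite !mxE.
exact: le_trans (coord_le_norm _ _) (rsubmx_norm _).
Qed.

Lemma CK_domain_slice_domain : domain Omega0 -> slice_domain CK_domain.
Proof.
move=> [_ cO [a Oa]].
have shrink t (y : 'rV[R]_q) : 0 <= t <= 1 -> enorm (t *: y) <= enorm y.
  by move=> /andP[t0 t1]; rewrite enormZ ger0_norm// ler_piMl ?enorm_ge0.
split.
- split; [exact: CK_domain_open| |by exists (row_mx a 0); exact: CK_domain0].
  apply: (star_fibres_connected cO); [by exists a|exact: CK_domain0|exact: CK_domain_sub|].
  move=> x t t01 Wx; apply: CK_domain_shrink Wx _ _; first by rewrite row_mxKl.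
  by rewrite row_mxKr shrink.
- by exists a; exact: CK_domain0.
- move=> w w1; split.
  + by apply: open_comp CK_domain_open => x _; exact: slice_pt_continuous.
  + apply: (star_fibres_connected cO); first by exists a.
    * move=> b Ob; rewrite /slice/= /slice_pt row_mxKl row_mxKr mxE scale0r.
      exact: CK_domain0.
    * by move=> x /CK_domain_sub; rewrite row_mxKl.
    * move=> x t t01 Wx; apply: CK_domain_shrink Wx _ _.
        by rewrite !row_mxKl.
      by rewrite !row_mxKr mxE -scalerA shrink.
  + exists (row_mx a 0); rewrite /slice/= /slice_pt row_mxKl row_mxKr mxE scale0r.
    exact: CK_domain0.
Qed.

End slice_domain.

(** * Series of powers of x_q *)

Section geometric_bounds.
Variables (R : realType) (n : nat).
Local Notation Cl := (clifford R n).
Variables (C K e : R) (c : nat -> R).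
Hypotheses (C0 : 0 <= C) (K0 : 0 < K) (e0 : 0 < e).
Hypothesis eK : 4 * (cl_kappa R n * e * K) <= 1.
Hypothesis c1 : forall k, `|c k| * k`!%:R <= 1.
Local Notation kap := (cl_kappa R n).

Let kC0 : 0 <= kap * C. Proof. by rewrite mulr_ge0 ?cl_kappa_ge0. Qed.
Let t0 : 0 <= kap * e * K. Proof. by rewrite !mulr_ge0 ?cl_kappa_ge0 ?(ltW K0) ?(ltW e0). Qed.

Let quarter k : (kap * e * K) ^+ k <= 4^-1 ^+ k.
Proof.
rewrite lerXn2r ?nnegrE ?invr_ge0// -[leRHS]mulr1.
by rewrite ler_pdivlMl// ltr0n.
Qed.

Let quarter_half k : (4^-1 : R) ^+ k <= 2^-1 ^+ k.
Proof. by rewrite lerXn2r ?nnegrE ?invr_ge0// lef_pV2 ?posrE// ler_nat. Qed.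

Let natquarter_half k : k%:R * (4^-1 : R) ^+ k <= 2^-1 ^+ k.
Proof.
have -> : (4^-1 : R) = 2^-1 * 2^-1 by rewrite -invfM -natrM.
rewrite exprMn mulrA ler_piMl ?exprn_ge0 ?invr_ge0//.
by rewrite exprVn ler_pdivrMr ?exprn_gt0// mul1r -natrX ler_nat ltnW// ltn_expl.
Qed.

Lemma pow_term_norm k (z u : Cl) : `|z| <= e -> `|u| <= C * K ^+ k * k`!%:R ->
  `|c k *: (z ^+ k * u)| <= kap * C * 2^-1 ^+ k.
Proof.
move=> ze uC; rewrite normrZ.
apply: le_trans (_ : `|c k| * (kap * (kap * e) ^+ k * (C * K ^+ k * k`!%:R)) <= _).
  rewrite ler_wpM2l//; apply: le_trans (cl_normM _ _) _; apply: ler_pM => //.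
    by rewrite mulr_ge0 ?cl_kappa_ge0.
  by rewrite ler_wpM2l ?cl_kappa_ge0// cl_pow_norm.
have -> : `|c k| * (kap * (kap * e) ^+ k * (C * K ^+ k * k`!%:R)) =
   (`|c k| * k`!%:R) * (kap * C * (kap * e * K) ^+ k) by rewrite !exprMn; ring.
rewrite -[leRHS]mul1r; apply: ler_pM.
- by rewrite mulr_ge0.
- by apply: mulr_ge0 => //; exact: exprn_ge0.
- exact: c1.
- by apply: ler_wpM2l => //; exact: le_trans (quarter k) (quarter_half k).
Qed.

(** Here the ratio 1/4 in [eK] pays off: the factor [k] produced by differentiation is at most 2^k,
    and a ratio 1/2 is left. *)
Lemma dpow_term_norm k (b z u : Cl) : `|z| <= e -> `|u| <= C * K ^+ k * k`!%:R ->
  `|c k *: (cl_dpow b z k * u)| <= kap * C * (`|b| / e) * 2^-1 ^+ k.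
Proof.
move=> ze uC; rewrite normrZ.
apply: le_trans (_ : `|c k| * (kap * (`|b| * k%:R * (kap * e) ^+ k / e) *
    (C * K ^+ k * k`!%:R)) <= _).
  rewrite ler_wpM2l//; apply: le_trans (cl_normM _ _) _; apply: ler_pM => //.
    by rewrite mulr_ge0 ?cl_kappa_ge0.
  by rewrite ler_wpM2l ?cl_kappa_ge0// ler_pdivlMr// cl_dpow_norm.
have -> : `|c k| * (kap * (`|b| * k%:R * (kap * e) ^+ k / e) * (C * K ^+ k * k`!%:R)) =
   (`|c k| * k`!%:R) * (kap * C * (`|b| / e) * (k%:R * (kap * e * K) ^+ k)).
  by rewrite !exprMn; ring.
have be : 0 <= `|b| / e by rewrite divr_ge0// ltW.
rewrite -[leRHS]mul1r; apply: ler_pM.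
- by rewrite mulr_ge0.
- by apply: mulr_ge0; [exact: mulr_ge0|rewrite mulr_ge0 ?exprn_ge0].
- exact: c1.
- apply: ler_wpM2l; first exact: mulr_ge0.
  by apply: le_trans (natquarter_half k); rewrite ler_wpM2l.
Qed.

End geometric_bounds.

(** * Term-by-term differentiation along [Phi] *)

Section slice_series.
Variables (R : realType) (p q : nat).
Local Notation Cl := (clifford R (p + q)).
Local Notation Rp := 'rV[R]_p.+1.
Local Notation Rpq := 'rV[R]_(p.+1 + q).
Local Notation vec := (@vecq R p q).
Variables (Omega0 : set Rp) (f0 : Rp -> Cl).
Hypotheses (oO : open Omega0) (f0O : real_analytic_on Omega0 f0) (q0 : (0 < q)%N).
Local Notation Omega := (CK_domain Omega0 f0).

Definition power_term (c : nat -> R) (k : nat) (x : Rpq) : Cl :=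
  c k *: (vec (rsubmx x) ^+ k * alt_dirac f0 k (lsubmx x)).

Definition power_sum (c : nat -> R) (x : Rpq) : Cl := limn (series (power_term c ^~ x)).

Definition power_dterm (c : nat -> R) (i : 'I_p.+1) (k : nat) (x : Rpq) : Cl :=
  c k *: (vec (rsubmx x) ^+ k * 'D_(delta_mx ord0 i) (alt_dirac f0 k) (lsubmx x)).

Definition power_dpow_term (c : nat -> R) (b : Cl) (k : nat) (x : Rpq) : Cl :=
  c k *: (cl_dpow b (vec (rsubmx x)) k * alt_dirac f0 k (lsubmx x)).

Lemma vecq_continuous : continuous vec.
Proof.
apply: (lipschitz_continuous (C := q%:R)) => x y.
have -> : vec x - vec y = vec (x - y) by rewrite vecqD -[- y]scaleN1r vecqZ scaleN1r.
apply: le_trans (ler_norm_sum _ _ _) _.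
have -> : q%:R * `|x - y| = \sum_(j < q) `|x - y| by rewrite sumr_const card_ord mulr_natl.
apply: ler_sum => j _; rewrite normrZ -[leRHS]mulr1.
by rewrite ler_pM// ?coord_le_norm// para_e_norm.
Qed.

(* [V] is the whole space or the parameter space of a slice. *)
Variables (V : normedModType R) (Phi : V -> Rpq) (c : nat -> R) (F : V -> Cl).
Hypothesis Phi_cont : continuous Phi.
Hypothesis c1 : forall k, `|c k| * k`!%:R <= 1.
Hypothesis FS : forall x, Omega (Phi x) -> F x = power_sum c (Phi x).

Let prj x := lsubmx (Phi x).
Let xi x := vec (rsubmx (Phi x)).

Let prj_cont : continuous prj.
Proof. by move=> x; apply: continuous_comp; [exact: Phi_cont|exact: lsubmx_continuous]. Qed.

Let xi_cont : continuous xi.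
Proof.
move=> x; apply: (@continuous_comp _ _ _ (rsubmx \o Phi) vec); last exact: vecq_continuous.
by apply: continuous_comp; [exact: Phi_cont|exact: rsubmx_continuous].
Qed.

Section tube.
Variables (a : Rp) (rho d C K : R).
Hypothesis good : slice_good Omega0 f0 a rho d C K.
Local Notation N := (Phi @^-1` slice_tube a rho d).
Local Notation e := (q%:R * d).

Let d0 : 0 < d. Proof. by have [] := good. Qed.
Let C0 : 0 <= C. Proof. by have [_ []] := good. Qed.
Let K0 : 0 < K. Proof. by have [_ []] := good. Qed.
Let eK : 4 * (cl_kappa R (p + q) * e * K) <= 1. Proof. by have [] := good. Qed.
Let e0 : 0 < e. Proof. by rewrite mulr_gt0// ltr0n. Qed.

Let NO x : N x -> Omega0 (prj x).
Proof. by have [_ _ _ rhoO _] := good => -[xa _]; exact: rhoO. Qed.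

Let oN : open N.
Proof. by apply: open_comp (@slice_tube_open R p q a rho d) => x _; exact: Phi_cont. Qed.

Let nbhsN x : N x -> nbhs x N.
Proof. by move=> Nx; apply: open_nbhs_nbhs; split; [exact: oN|exact: Nx]. Qed.

Let UC k x : N x -> `|alt_dirac f0 k (prj x)| <= C * K ^+ k * k`!%:R.
Proof. by have [_ _ _ _ [UC _]] := good => -[xa _]; exact: UC. Qed.

Let dUC k i x : N x -> `|'D_(delta_mx ord0 i) (alt_dirac f0 k) (prj x)| <= C * K ^+ k * k`!%:R.
Proof. by have [_ _ _ _ [_ dUC]] := good => -[xa _]; exact: dUC. Qed.

Let Nxi x : N x -> `|xi x| <= e.
Proof. by move=> [_ xd]; apply: le_trans (vecq_norm _ _) _; rewrite ler_wpM2l// ltW. Qed.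

Let FN x : N x -> F x = power_sum c (Phi x).
Proof. by move=> xT; rewrite FS//; exists a, rho, d, C, K. Qed.

Local Notation kap := (cl_kappa R (p + q)).

Lemma power_term_norm k x : N x -> `|power_term c k (Phi x)| <= kap * C * 2^-1 ^+ k.
Proof. by move=> Nx; apply: (pow_term_norm C0 K0 e0 eK c1); [exact: Nxi|exact: UC]. Qed.

Lemma power_dterm_norm i k x : N x -> `|power_dterm c i k (Phi x)| <= kap * C * 2^-1 ^+ k.
Proof. by move=> Nx; apply: (pow_term_norm C0 K0 e0 eK c1); [exact: Nxi|exact: dUC]. Qed.

Lemma power_dpow_term_norm b k x : N x ->
  `|power_dpow_term c b k (Phi x)| <= kap * C * (`|b| / e) * 2^-1 ^+ k.
Proof. by move=> Nx; apply: (dpow_term_norm C0 K0 e0 eK c1); [exact: Nxi|exact: UC]. Qed.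

Let prj_comp (g : Rp -> Cl) x : real_analytic_on Omega0 g -> N x ->
  {for x, continuous (fun y => g (prj y))}.
Proof.
move=> gO Nx; have H := analytic_continuous oO gO (NO Nx).
exact: (continuous_comp (@prj_cont x) H).
Qed.

Lemma power_term_continuous k x : N x -> {for x, continuous (fun y => power_term c k (Phi y))}.
Proof.
move=> Nx; apply: cl_cvgZ; apply: cl_cvgM; first exact: (@cl_pow_continuous _ _ _ xi _ k (@xi_cont x)).
exact: prj_comp (alt_dirac_analytic oO f0O k) Nx.
Qed.

Lemma power_dterm_continuous i k x : N x ->
  {for x, continuous (fun y => power_dterm c i k (Phi y))}.
Proof.
move=> Nx; apply: cl_cvgZ; apply: cl_cvgM; first exact: (@cl_pow_continuous _ _ _ xi _ k (@xi_cont x)).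
exact: prj_comp (analytic_derive _ oO (alt_dirac_analytic oO f0O k)) Nx.
Qed.

Lemma power_dpow_term_continuous b k x : N x ->
  {for x, continuous (fun y => power_dpow_term c b k (Phi y))}.
Proof.
move=> Nx; apply: cl_cvgZ; apply: cl_cvgM; first exact: (@cl_dpow_continuous _ _ _ b xi _ k (@xi_cont x)).
exact: prj_comp (alt_dirac_analytic oO f0O k) Nx.
Qed.

Lemma tube_sum_continuous x : N x -> {for x, continuous F}.
Proof.
move=> Nx; have H : {for x, continuous (fun y => power_sum c (Phi y))}.
  apply: (@normal_continuous R _ V N (fun k y => power_term c k (Phi y)) (kap * C)).
  - exact: nbhsN.
  - by move=> k y Ny; exact: power_term_norm.
  - by move=> k; exact: power_term_continuous.
by apply: near_eq_continuous H; apply: filterS (nbhsN Nx) => y Ny; exact: FN.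
Qed.

Let C1_of (v : V) (dg : nat -> V -> Cl) (C' : R) :
  (forall k x, N x -> is_derive x v (fun y => power_term c k (Phi y)) (dg k x)) ->
  (forall k x, N x -> `|power_term c k (Phi x)| <= C' * 2^-1 ^+ k) ->
  (forall k x, N x -> `|dg k x| <= C' * 2^-1 ^+ k) ->
  (forall k x, N x -> {for x, continuous (dg k)}) ->
  forall x, N x -> [/\ derivable F x v, {for x, continuous ('D_v F)} &
    'D_v F x = limn (series (dg ^~ x))].
Proof.
move=> gdg gC dgC dgc.
have FD x : N x -> is_derive x v F (limn (series (dg ^~ x))).
  move=> Nx; have H : is_derive x v (fun y => power_sum c (Phi y)) (limn (series (dg ^~ x))).
    apply: (@normal_is_derive R _ V N (fun k y => power_term c k (Phi y)) dg C').
    - exact: oN.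
    - exact: Nx.
    - by move=> k y Ny; exact: gC.
    - by move=> k y Ny; exact: dgC.
    - by move=> k; exact: dgc.
  by apply: near_eq_is_derive H; apply: filterS (nbhsN Nx) => y Ny; rewrite FN.
move=> x Nx; have [dF DF] := FD x Nx; split; [exact: dF| |exact: DF].
have H : {for x, continuous (fun y => limn (series (dg ^~ y)))}.
  apply: (@normal_continuous R _ V N dg C').
  - exact: nbhsN.
  - by move=> k y Ny; exact: dgC.
  - by move=> k; exact: dgc.
apply: near_eq_continuous H; apply: filterS (nbhsN Nx) => y Ny.
by have [_ ->] := FD y Ny.
Qed.

(** Along [v] the vector x_q is constant, so only U_k is differentiated. *)
Lemma tube_sum_pderive i (v : V) :
  (forall (h : R) x, Phi (h *: v + x) = h *: row_mx (delta_mx ord0 i) 0 + Phi x) ->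
  forall x, N x -> [/\ derivable F x v, {for x, continuous ('D_v F)} &
    'D_v F x = limn (series (power_dterm c i ^~ (Phi x)))].
Proof.
move=> vPhi; apply: (@C1_of v (fun k y => power_dterm c i k (Phi y)) (kap * C)) => k y Ny.
- apply: is_derive_clZ.
  have H1 : is_derive y v (fun y => xi y ^+ k) 0.
    apply: is_derive_affine => h.
    by rewrite /xi vPhi linearP/= row_mxKr scaler0 add0r scaler0 add0r.
  have H2 : is_derive y v (alt_dirac f0 k \o prj)
      ('D_(delta_mx ord0 i) (alt_dirac f0 k) (prj y)).
    apply: (is_derive_comp_affine (w := delta_mx ord0 i)) => [h|].
      by rewrite /prj vPhi linearP/= row_mxKl.
    by apply: (alt_dirac_is_derive oO f0O); exact: NO.
  by have := is_derive_clM H1 H2; rewrite mul0r add0r.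
- exact: power_term_norm.
- exact: power_dterm_norm.
- exact: power_dterm_continuous.
Qed.

(** Along [v] the point x_p is constant, so only the power of x_q is differentiated. *)
Lemma tube_sum_qderive u (v : V) :
  (forall (h : R) x, Phi (h *: v + x) = h *: row_mx 0 u + Phi x) ->
  forall x, N x -> [/\ derivable F x v, {for x, continuous ('D_v F)} &
    'D_v F x = limn (series (power_dpow_term c (vec u) ^~ (Phi x)))].
Proof.
move=> vPhi; pose b := vec u; pose C' := kap * C + kap * C * (`|b| / e).
have kC0 : 0 <= kap * C by rewrite mulr_ge0 ?cl_kappa_ge0.
have be : 0 <= kap * C * (`|b| / e) by apply: mulr_ge0 => //; rewrite divr_ge0// ltW.
have h0 k : 0 <= (2^-1 : R) ^+ k by rewrite exprn_ge0 ?invr_ge0.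
apply: (@C1_of v (fun k y => power_dpow_term c b k (Phi y)) C') => k y Ny.
- apply: is_derive_clZ.
  have H1 : is_derive y v (fun y => xi y ^+ k) (cl_dpow b (xi y) k).
    apply: is_derive_cl_pow; apply: is_derive_affine => h.
    by rewrite /xi vPhi linearP/= row_mxKr vecqD vecqZ.
  have H2 : is_derive y v (alt_dirac f0 k \o prj) 0.
    apply: is_derive_affine => h.
    by rewrite /= /prj vPhi linearP/= row_mxKl scaler0 add0r scaler0 add0r.
  by have := is_derive_clM H1 H2; rewrite mulr0 addr0.
- by apply: le_trans (power_term_norm k Ny) _; rewrite ler_wpM2r// lerDl.
- by apply: le_trans (power_dpow_term_norm b k Ny) _; rewrite ler_wpM2r// lerDr.
- exact: power_dpow_term_continuous.
Qed.

End tube.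

Lemma power_sum_cvg x : Omega (Phi x) -> cvgn (series (power_term c ^~ (Phi x))).
Proof.
move=> [a [rho [d [C [K [good xT]]]]]].
by apply: normal_cvg => k; exact: (power_term_norm good k xT).
Qed.

Lemma power_sum_continuous x : Omega (Phi x) -> {for x, continuous F}.
Proof. by move=> [a [rho [d [C [K [good xT]]]]]]; exact: (tube_sum_continuous good xT). Qed.

Lemma power_sum_pderive i (v : V) :
  (forall (h : R) x, Phi (h *: v + x) = h *: row_mx (delta_mx ord0 i) 0 + Phi x) ->
  forall x, Omega (Phi x) -> [/\ derivable F x v, {for x, continuous ('D_v F)} &
    'D_v F x = limn (series (power_dterm c i ^~ (Phi x)))].
Proof.
by move=> vPhi x [a [rho [d [C [K [good xT]]]]]]; exact: (tube_sum_pderive good vPhi xT).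
Qed.

Lemma power_sum_dterm_cvg i x : Omega (Phi x) ->
  cvgn (series (power_dterm c i ^~ (Phi x))).
Proof.
move=> [a [rho [d [C [K [good xT]]]]]].
by apply: normal_cvg => k; exact: (power_dterm_norm good i k xT).
Qed.

Lemma power_sum_qderive u (v : V) :
  (forall (h : R) x, Phi (h *: v + x) = h *: row_mx 0 u + Phi x) ->
  forall x, Omega (Phi x) -> [/\ derivable F x v, {for x, continuous ('D_v F)} &
    'D_v F x = limn (series (power_dpow_term c (vec u) ^~ (Phi x)))].
Proof.
by move=> vPhi x [a [rho [d [C [K [good xT]]]]]]; exact: (tube_sum_qderive good vPhi xT).
Qed.

(* The series of the Dirac derivatives of the terms telescopes. *)
Lemma power_sum_dirac (J : finType) (u : J -> 'rV[R]_q) (tau : nat -> R) x :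
  Omega (Phi x) ->
  (forall k, \sum_j vec (u j) * cl_dpow (vec (u j)) (xi x) k.+1 = - tau k.+1 *: xi x ^+ k) ->
  (forall k, c k.+1 * tau k.+1 = c k) ->
  \sum_(i < p.+1) para_e R (lshift q i) * limn (series (power_dterm c i ^~ (Phi x))) +
  \sum_j vec (u j) * limn (series (power_dpow_term c (vec (u j)) ^~ (Phi x))) = 0.
Proof.
move=> Wx utau ctau; have [a [rho [d [C [K [good xT]]]]]] := Wx.
pose P k := \sum_(i < p.+1) para_e R (lshift q i) * power_dterm c i k (Phi x).
pose Q k := \sum_j vec (u j) * power_dpow_term c (vec (u j)) k (Phi x).
have Qcvg j : cvgn (series (power_dpow_term c (vec (u j)) ^~ (Phi x))).
  by apply: normal_cvg => k; exact: (power_dpow_term_norm good).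
have HP := @cl_series_sum_cvg _ _ _ (index_enum 'I_p.+1) (fun i => para_e R (lshift q i)) _
  (fun i => @power_sum_dterm_cvg i x Wx).
have HQ := @cl_series_sum_cvg _ _ _ (index_enum J) (fun j => vec (u j)) _ Qcvg.
have PE k : P k = c k *: (xi x ^+ k * alt_dirac f0 k.+1 (prj x)).
  rewrite /P /= mulr_sumr scaler_sumr; apply: eq_bigr => i _.
  by rewrite /power_dterm -scalerAr; congr (_ *: _); rewrite [LHS]mulrA para_e_pow [RHS]mulrA.
have QE k : Q k.+1 = - P k.
  rewrite /Q /power_dpow_term; under eq_bigr do rewrite -scalerAr mulrA.
  rewrite -scaler_sumr -mulr_suml utau -scalerAl scalerA mulrN ctau PE.
  by rewrite scaleNr.
have Q0 : Q 0%N = 0.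
  by rewrite /Q big1// => j _; rewrite /power_dpow_term /= mul0r scaler0 mulr0.
(* The x_q-part of each term cancels the x_p-part of the preceding one. With the partial sums offset
   by one, the cancellation is exact before the limit. *)
have tele k : series P k + series Q k.+1 = 0.
  rewrite /series /= big_nat_recl// Q0 add0r -big_split big1// => i _.
  by rewrite QE /= subrr.
have HQ1 : (fun k => series Q k.+1) @ \oo --> \sum_j vec (u j) * limn (series (power_dpow_term c (vec (u j)) ^~ (Phi x))).
  by rewrite (@cvg_shiftS _ (series Q)); exact: HQ.
have H0 : (fun k => series P k + series Q k.+1) @ \oo -->
    \sum_(i < p.+1) para_e R (lshift q i) * limn (series (power_dterm c i ^~ (Phi x))) +
    \sum_j vec (u j) * limn (series (power_dpow_term c (vec (u j)) ^~ (Phi x))).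
  exact: (cvgD HP HQ1).
have E : (fun k => series P k + series Q k.+1) = cst 0 by apply/funext => k; exact: tele.
rewrite E in H0.
have H1 : (cst 0 : nat -> Cl) @ \oo --> (0 : Cl) by exact: cvg_cst.
exact: (cvg_unique (@norm_hausdorff _ _) H0 H1).
Qed.

End slice_series.

(** * Coefficients of the generalized CK-extension *)

Section gck_coefficients.
Variables (R : realType) (q : nat).
Hypothesis q0 : (0 < q)%N.

(* The coefficients of the even and of the odd series of [GCK], merged. *)
Definition gck_coef (k : nat) : R :=
  Gamma (q%:R / 2) / (2 ^+ k * (k./2)`!%:R * Gamma ((uphalf k)%:R + q%:R / 2)).

Let half_q_gt0 m : 0 < m%:R + q%:R / 2 :> R.
Proof. by rewrite ltr_wpDl// divr_gt0// ltr0n. Qed.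

Lemma gck_coef_gt0 k : 0 < gck_coef k.
Proof.
rewrite /gck_coef divr_gt0//; first by rewrite Gamma_gt0// divr_gt0// ltr0n.
by rewrite !mulr_gt0 ?exprn_gt0 ?Gamma_gt0// ltr0n fact_gt0.
Qed.

Lemma gck_coef0 : gck_coef 0 = 1.
Proof.
rewrite /gck_coef expr0 fact0 !mul1r add0r divff// gt_eqF// Gamma_gt0//.
by rewrite divr_gt0// ltr0n.
Qed.

(** Besides the power of 2, passing from an odd index changes only the factorial, and passing from
    an even index only the Gamma factor, by its functional equation. *)
Lemma gck_coefS k : gck_coef k.+1 * dirac_coef R q k.+1 = gck_coef k.
Proof.
have G0 m : Gamma (m%:R + q%:R / 2 : R) != 0 by rewrite gt_eqF ?Gamma_gt0.
have f0 m : m`!%:R != 0 :> R by rewrite pnatr_eq0 -lt0n fact_gt0.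
have p0 m : (2 : R) ^+ m != 0 by rewrite expf_neq0 ?pnatr_eq0.
rewrite -(odd_double_half k); case: (odd k); move: (k./2) => {k} m.
  rewrite add1n /gck_coef -doubleS dirac_coef_double.
  rewrite doubleK uphalf_double.
  have -> : m.*2.+1./2 = m by rewrite -uphalfE uphalf_double.
  have -> : uphalf m.*2.+1 = m.+1 by rewrite uphalfE -doubleS doubleK.
  rewrite doubleS exprS factS natrM.
  have E : m.+1.*2%:R = 2 * m.+1%:R :> R by rewrite -muln2 natrM mulrC.
  rewrite -doubleS E; move: (Gamma _) (Gamma _) (G0 m.+1) => g g' g0; field.
  by rewrite g0 f0 p0 nat1r pnatr_eq0.
rewrite add0n /gck_coef dirac_coef_doubleS doubleK uphalf_double.
have -> : m.*2.+1./2 = m by rewrite -uphalfE uphalf_double.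
have -> : uphalf m.*2.+1 = m.+1 by rewrite uphalfE -doubleS doubleK.
have -> : m.+1%:R + q%:R / 2 = (m%:R + q%:R / 2) + 1 :> R by rewrite -natr1; ring.
rewrite GammaS// exprS.
have E : q%:R + m.*2%:R = 2 * (m%:R + q%:R / 2) :> R.
  by rewrite -muln2 natrM; field.
rewrite E; have := half_q_gt0 m; move: (m%:R + q%:R / 2) (G0 m) => t Gt t0.
field.
by rewrite Gt f0 p0 gt_eqF// pnatr_eq0.
Qed.

Lemma dirac_coef_ge k : k.+1%:R <= dirac_coef R q k.+1.
Proof.
rewrite -(odd_double_half k); case: (odd k); move: (k./2) => {k} m.
  by rewrite add1n -doubleS dirac_coef_double.
by rewrite add0n dirac_coef_doubleS -natrD ler_nat -addn1 addnC leq_add2r.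
Qed.

(** Each tau_j is at least j, so the product tau_1 ... tau_k is at least k!. *)
Lemma gck_coef_le k : gck_coef k * k`!%:R <= 1.
Proof.
elim: k => [|k IH]; first by rewrite gck_coef0 mul1r.
apply: le_trans IH; rewrite -(gck_coefS k) factS natrM mulrA.
by rewrite ler_wpM2r// ler_wpM2l ?(ltW (gck_coef_gt0 _))// dirac_coef_ge.
Qed.

Lemma gck_coef_le1 k : `|gck_coef k| * k`!%:R <= 1.
Proof. by rewrite gtr0_norm ?gck_coef_gt0// gck_coef_le. Qed.

Definition gck_even k : R := if odd k then 0 else gck_coef k.
(** The index is shifted: the factor x_q and the operator D outside the odd series raise both the
    power of x_q and the index of U by one. *)
Definition gck_odd k : R := if odd k then 0 else gck_coef k.+1.

Lemma gck_even_le1 k : `|gck_even k| * k`!%:R <= 1.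
Proof.
rewrite /gck_even; case: (odd k); first by rewrite normr0 mul0r.
exact: gck_coef_le1.
Qed.

Lemma gck_odd_le1 k : `|gck_odd k| * k`!%:R <= 1.
Proof.
rewrite /gck_odd; case: (odd k); first by rewrite normr0 mul0r.
apply: le_trans (gck_coef_le1 k.+1); rewrite ler_wpM2l// ler_nat factS.
by rewrite leq_pmull.
Qed.

End gck_coefficients.

(** * Spherical means *)

Section sphere_mean_theory.
Variables (R : realType) (q n : nat).
Hypothesis q0 : (0 < q)%N.
Local Notation Cl := (clifford R n).
Local Notation mR := (measurableTypeR R).
Local Notation T := (q.-tuple mR).
Local Notation sph := (@sphere_tup R q).
Local Notation smu := (@sphere_measure R q).
Local Notation area := (sphere_area R q).

Definition sphere_bounded (h : T -> R) : Prop :=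
  measurable_fun sph h /\ exists C : R, forall t, sph t -> `|h t| <= C.

Lemma sphere_bounded_integrable h : sphere_bounded h ->
  smu.-integrable sph (EFin \o h).
Proof.
move=> [mh hC]; apply: bounded_integrable => //.
- exact: measurable_sphere_tup.
- exact: sphere_measure_fin.
Qed.

Lemma sphere_bounded_cst (a : R) : sphere_bounded (fun=> a).
Proof. by split; [exact: measurable_cst|exists `|a|]. Qed.

Lemma sphere_boundedD h h' : sphere_bounded h -> sphere_bounded h' ->
  sphere_bounded (fun t => h t + h' t).
Proof.
move=> [mh [C hC]] [mh' [C' hC']]; split; first exact: measurable_funD.
exists (C + C') => t tS; apply: le_trans (ler_normD _ _) _.
by rewrite lerD ?hC ?hC'.
Qed.

Lemma sphere_boundedM h h' : sphere_bounded h -> sphere_bounded h' ->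
  sphere_bounded (fun t => h t * h' t).
Proof.
move=> [mh [C hC]] [mh' [C' hC']]; split; first exact: measurable_funM.
by exists (C * C') => t tS; rewrite normrM ler_pM ?hC ?hC'.
Qed.

Lemma sphere_boundedX h k : sphere_bounded h -> sphere_bounded (fun t => h t ^+ k).
Proof.
move=> hb; elim: k => [|k IH].
  by under eq_fun do rewrite expr0; exact: sphere_bounded_cst.
by under eq_fun do rewrite exprS; exact: sphere_boundedM.
Qed.

Lemma sphere_bounded_coord (j : 'I_q) : sphere_bounded (fun t => tnth t j).
Proof.
split; first by apply: measurable_funTS; exact: measurable_tnth.
by exists 1 => t tS; have := coord_le_enorm t j; rewrite tS.
Qed.

Lemma sphere_bounded_dtup y : sphere_bounded (fun t => dtup t y).
Proof.
split; first by apply: measurable_funTS; exact: measurable_dtup.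
exists (1 * \sum_(i < q) `|y ord0 i|) => t tS.
by have := dtup_norm t y; rewrite tS.
Qed.

Definition sphere_avg (h : T -> R) : R := area^-1 * \int[smu]_(t in sph) h t.

Lemma sphere_avg_eq h h' : (forall t, sph t -> h t = h' t) -> sphere_avg h = sphere_avg h'.
Proof. by move=> hh; congr (_ * _); apply: eq_Rintegral => t /set_mem; exact: hh. Qed.

Lemma sphere_avg1 : sphere_avg (fun=> 1) = 1.
Proof.
rewrite /sphere_avg Rintegral_cst; last exact: measurable_sphere_tup.
by rewrite mul1r mulVf// gt_eqF// sphere_area_gt0.
Qed.

Lemma sphere_avgD h h' : sphere_bounded h -> sphere_bounded h' ->
  sphere_avg (fun t => h t + h' t) = sphere_avg h + sphere_avg h'.
Proof.
move=> hb hb'; rewrite /sphere_avg RintegralD ?mulrDr//.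
- exact: measurable_sphere_tup.
- exact: sphere_bounded_integrable.
- exact: sphere_bounded_integrable.
Qed.

Lemma sphere_avgZ (a : R) h : sphere_bounded h ->
  sphere_avg (fun t => a * h t) = a * sphere_avg h.
Proof.
move=> hb; rewrite /sphere_avg RintegralZl.
- by rewrite mulrCA.
- exact: measurable_sphere_tup.
- exact: sphere_bounded_integrable.
Qed.

Lemma sphere_avg0 : sphere_avg (fun=> 0) = 0.
Proof.
rewrite /sphere_avg Rintegral_cst; last exact: measurable_sphere_tup.
by rewrite mul0r mulr0.
Qed.

Lemma sphere_bounded_sum (J : Type) (s : seq J) (h : J -> T -> R) :
  (forall j, sphere_bounded (h j)) -> sphere_bounded (fun t => \sum_(j <- s) h j t).
Proof.
move=> hb; elim: s => [|j s IH].
  by under eq_fun do rewrite big_nil; exact: sphere_bounded_cst.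
by under eq_fun do rewrite big_cons; exact: sphere_boundedD.
Qed.

Lemma sphere_avg_sum (J : Type) (s : seq J) (h : J -> T -> R) :
  (forall j, sphere_bounded (h j)) ->
  sphere_avg (fun t => \sum_(j <- s) h j t) = \sum_(j <- s) sphere_avg (h j).
Proof.
move=> hb; elim: s => [|j s IH].
  by under eq_fun do rewrite big_nil; rewrite big_nil sphere_avg0.
under eq_fun do rewrite big_cons; rewrite big_cons sphere_avgD ?IH//.
exact: sphere_bounded_sum.
Qed.

Lemma sphere_avg_norm h (e : R) : sphere_bounded h -> (forall t, sph t -> `|h t| <= e) ->
  `|sphere_avg h| <= e.
Proof.
move=> hb he; have a0 := sphere_area_gt0 R q0.
have mS := @measurable_sphere_tup R q.
rewrite normrM normfV (gtr0_norm a0) ler_pdivrMl// mulrC.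
apply: le_trans (le_normr_Rintegral mS (sphere_bounded_integrable hb)) _.
rewrite -[leRHS]/(e * fine (smu sph)) -Rintegral_cst//.
apply: le_Rintegral => //.
- apply: (@sphere_bounded_integrable (fun t => `|h t|)); have [mh [C hC]] := hb; split.
    by apply: measurableT_comp.
  by exists C => t tS; rewrite normr_id hC.
- exact: (sphere_bounded_integrable (sphere_bounded_cst e)).
Qed.

Lemma cl_coef_sum (J : Type) (s : seq J) (u : J -> Cl) A :
  cl_coef (\sum_(j <- s) u j) A = \sum_(j <- s) cl_coef (u j) A.
Proof.
elim: s => [|j s IH]; first by rewrite !big_nil /cl_coef mxE.
by rewrite !big_cons cl_coefD IH.
Qed.

Lemma sphere_mean_coef (g : 'rV[R]_q -> Cl) A :
  cl_coef (sphere_mean g) A = sphere_avg (fun t => cl_coef (g (row_of_tup t)) A).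
Proof.
rewrite /sphere_mean cl_coefZ; congr (_ * _); rewrite /sphere_int cl_coef_sum (bigD1 A)//=.
rewrite cl_coefZ cl_coef_blade eqxx mulr1 big1 ?addr0// => B BA.
by rewrite cl_coefZ cl_coef_blade eq_sym (negbTE BA) mulr0.
Qed.

Lemma cl_coef_inj (u v : Cl) : (forall A, cl_coef u A = cl_coef v A) -> u = v.
Proof.
by move=> uv; rewrite (cl_basis u) (cl_basis v); apply: eq_bigr => A _; rewrite uv.
Qed.

Lemma sphere_mean_eq (g g' : 'rV[R]_q -> Cl) :
  (forall w, usphere w -> g w = g' w) -> sphere_mean g = sphere_mean g'.
Proof.
move=> gg; apply: cl_coef_inj => A; rewrite !sphere_mean_coef.
by apply: sphere_avg_eq => t tS; rewrite gg.
Qed.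

(** The mean is reduced to scalar averages; the second conclusion is what exchanging mean and series
    asks of each term. *)
Lemma sphere_mean_comb (J : Type) (s : seq J) (h : J -> T -> R) (v : J -> Cl)
    (g : 'rV[R]_q -> Cl) : (forall j, sphere_bounded (h j)) ->
  (forall t, sph t -> g (row_of_tup t) = \sum_(j <- s) h j t *: v j) ->
  sphere_mean g = \sum_(j <- s) sphere_avg (h j) *: v j /\
  (forall A, sphere_bounded (fun t => cl_coef (g (row_of_tup t)) A)).
Proof.
move=> hb gE.
have gA A t : sph t ->
    cl_coef (g (row_of_tup t)) A = \sum_(j <- s) cl_coef (v j) A * h j t.
  move=> tS; rewrite gE// cl_coef_sum; apply: eq_bigr => j _.
  by rewrite cl_coefZ mulrC.
have hb' A j : sphere_bounded (fun t => cl_coef (v j) A * h j t).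
  by apply: sphere_boundedM => //; exact: sphere_bounded_cst.
have sb A := sphere_bounded_sum s (hb' A).
split=> [|A].
  apply: cl_coef_inj => A; rewrite sphere_mean_coef (sphere_avg_eq (gA A)).
  rewrite sphere_avg_sum// cl_coef_sum; apply: eq_bigr => j _.
  by rewrite sphere_avgZ// cl_coefZ mulrC.
have [m [C sC]] := sb A; split.
  by apply: eq_measurable_fun m => t /set_mem tS; rewrite gA.
by exists C => t tS; rewrite gA// sC.
Qed.

Lemma sphere_mean_series (g : nat -> 'rV[R]_q -> Cl) (G : 'rV[R]_q -> Cl) (C : R) :
  (forall k A, sphere_bounded (fun t => cl_coef (g k (row_of_tup t)) A)) ->
  (forall k w, usphere w -> `|g k w| <= C * 2^-1 ^+ k) ->
  (forall w, usphere w -> G w = limn (series (g ^~ w))) ->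
  series (fun k => sphere_mean (g k)) @ \oo --> sphere_mean G.
Proof.
move=> gb gC GE.
pose S N w := series (g ^~ w) N.
have SA N A t : cl_coef (S N (row_of_tup t)) A =
    \sum_(0 <= k < N) cl_coef (g k (row_of_tup t)) A by rewrite /S /series/= cl_coef_sum.
have Sb N A : sphere_bounded (fun t => cl_coef (S N (row_of_tup t)) A).
  by under eq_fun do rewrite SA; apply: sphere_bounded_sum.
have SG N w : usphere w -> `|S N w - G w| <= 2 * C * 2^-1 ^+ N.
  by move=> w1; rewrite GE//; apply: normal_tail => k; exact: gC.
have SGA N A t : sph t ->
    `|cl_coef (S N (row_of_tup t)) A - cl_coef (G (row_of_tup t)) A| <= 2 * C * 2^-1 ^+ N.
  by move=> tS; rewrite -cl_coefB; apply: le_trans (cl_coef_norm _ _) (SG _ _ tS).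
(* [G] is measurable as a pointwise limit, and bounded by the tail estimate at [N = 0], where the
   partial sum is empty. *)
have Gb A : sphere_bounded (fun t => cl_coef (G (row_of_tup t)) A).
  split.
    apply: (@measurable_fun_cvg _ _ R sph (fun N t => cl_coef (S N (row_of_tup t)) A)).
      by move=> N; have [] := Sb N A.
    move=> t tS; apply: cl_coef_cvg; rewrite GE//; apply: normal_cvg => k; exact: gC.
  exists (2 * C) => t tS; have := SGA 0%N A t tS; rewrite SA big_geq// sub0r normrN.
  by rewrite mulr1.
apply/cvgrPdist_le => e e0.
have /cvgr0_norm_le/(_ _ e0)[N0 _ HN] := half_expn_cvg0 (2 * C).
exists N0 => // N /= NN.
apply: le_trans (_ : 2 * C * 2^-1 ^+ N <= _); last exact: le_trans (ler_norm _) (HN N NN).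
have C0 : 0 <= 2 * C * 2^-1 ^+ N.
  (* The sphere has positive area, hence a point at which the bound can be read as nonnegative. *)
  have [t tS] : exists t : T, sph t.
    apply: contrapT => noS; have := sphere_area_gt0 R q0.
    rewrite /sphere_area (_ : sph = set0) ?measure0 ?ltxx//.
    by apply/seteqP; split => t // tS; apply: noS; exists t.
  exact: le_trans (normr_ge0 _) (SGA N finset.set0 t tS).
apply: cl_norm_le => // A.
rewrite /series/= cl_coefB cl_coef_sum sphere_mean_coef.
under eq_bigr do rewrite sphere_mean_coef.
rewrite -sphere_avg_sum//.
have -> : sphere_avg (fun t => cl_coef (G (row_of_tup t)) A) -
    sphere_avg (fun t => \sum_(0 <= k < N) cl_coef (g k (row_of_tup t)) A) =
    sphere_avg (fun t => cl_coef (G (row_of_tup t)) A + -1 * cl_coef (S N (row_of_tup t)) A).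
  rewrite sphere_avgD//; last by apply: sphere_boundedM => //; exact: sphere_bounded_cst.
  rewrite sphere_avgZ// mulN1r; congr (_ - _).
  by apply: sphere_avg_eq => t _; rewrite SA.
apply: sphere_avg_norm.
  apply: sphere_boundedD => //.
  by apply: sphere_boundedM => //; exact: sphere_bounded_cst.
by move=> t tS; rewrite mulN1r distrC SGA.
Qed.

End sphere_mean_theory.

(** * Spherical means of powers of a vector *)

Section sphere_mean_powers.
Variables (R : realType) (p q : nat).
Hypothesis q0 : (0 < q)%N.
Local Notation Cl := (clifford R (p + q)).
Local Notation mR := (measurableTypeR R).
Local Notation T := (q.-tuple mR).
Local Notation sph := (@sphere_tup R q).
Local Notation vec := (@vecq R p q).
Variable y : 'rV[R]_q.

Let mom k : R := sphere_avg (fun t : T => dtup t y ^+ k).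
Let mom1 k (j : 'I_q) : R := sphere_avg (fun t : T => tnth t j * dtup t y ^+ k).

Let dbound k : sphere_bounded (fun t : T => dtup t y ^+ k).
Proof. by apply: sphere_boundedX; exact: sphere_bounded_dtup. Qed.

Let dbound1 k j : sphere_bounded (fun t : T => tnth t j * dtup t y ^+ k).
Proof. by apply: sphere_boundedM => //; exact: sphere_bounded_coord. Qed.

Let mom1E k j : (q + k)%:R * mom1 k.+1 j = k.+1%:R * y ord0 j * mom k.
Proof.
by rewrite /mom1 /mom /sphere_avg mulrCA sphere_moment [in RHS]mulrCA.
Qed.

(** One factor <t, y> is expanded in coordinates, and the moments weighted by a coordinate are
    known. *)
Lemma sphere_moment_rec k : (q + k)%:R * mom k.+2 = k.+1%:R * enorm y ^+ 2 * mom k.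
Proof.
have -> : mom k.+2 = \sum_(j < q) y ord0 j * mom1 k.+1 j.
  transitivity (sphere_avg (fun t : T => \sum_(j < q) y ord0 j * (tnth t j * dtup t y ^+ k.+1))).
    apply: sphere_avg_eq => t _; rewrite exprS {1}/dtup mulr_suml.
    by apply: eq_bigr => j _; ring.
  rewrite (sphere_avg_sum q0) => [|j]; last first.
    by apply: sphere_boundedM => //; exact: sphere_bounded_cst.
  by apply: eq_bigr => j _; rewrite (sphere_avgZ q0).
rewrite mulr_sumr enorm_sqr mulr_sumr mulr_suml; apply: eq_bigr => j _.
by rewrite mulrCA mom1E; ring.
Qed.

Lemma sphere_moment_even m :
  mom m.*2 = (m.*2)`!%:R * gck_coef R q m.*2 * enorm y ^+ m.*2.
Proof.
elim: m => [|m IH].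
  rewrite expr0 fact0 gck_coef0// !mulr1 /mom; under eq_fun do rewrite expr0.
  exact: (sphere_avg1 _ q0).
have qm : (q + m.*2)%:R != 0 :> R by rewrite pnatr_eq0 -lt0n ltn_addr.
apply: (mulfI qm); rewrite doubleS sphere_moment_rec IH.
(* Two steps of the recursion: c_(2m) = (q + 2m) (2m + 2) c_(2m+2). *)
have E1 := gck_coefS R q0 m.*2.+1; have E2 := gck_coefS R q0 m.*2.
rewrite -doubleS dirac_coef_double in E1; rewrite dirac_coef_doubleS in E2.
rewrite -E2 -E1 !factS !natrM doubleS !exprS natrD; ring.
Qed.

Lemma sphere_moment_odd m j :
  mom1 m.*2.+1 j = (m.*2.+1)`!%:R * gck_coef R q m.*2.+1 * (y ord0 j * enorm y ^+ m.*2).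
Proof.
have qm : (q + m.*2)%:R != 0 :> R by rewrite pnatr_eq0 -lt0n ltn_addr.
apply: (mulfI qm); rewrite mom1E sphere_moment_even.
have E2 := gck_coefS R q0 m.*2; rewrite dirac_coef_doubleS in E2.
rewrite -E2 !factS !natrM natrD; ring.
Qed.

(** On the unit sphere w^(2m) is the scalar (-1)^m and w^(2m+1) is (-1)^m w. Even powers thus reduce
    to plain moments, odd ones to moments weighted by a coordinate. *)
Lemma sphere_mean_power (u : Cl) k :
  sphere_mean (fun w => (dot w y ^+ k / k`!%:R) *: (vec w ^+ k * u)) =
    gck_coef R q k *: (vec y ^+ k * u) /\
  (forall A, sphere_bounded (fun t : T =>
     cl_coef ((dot (row_of_tup t) y ^+ k / k`!%:R) *: (vec (row_of_tup t) ^+ k * u)) A)).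
Proof.
have dE (t : T) : dot (row_of_tup t) y = dtup t y.
  by apply: eq_bigr => i _; rewrite mxE.
have f0 : k`!%:R != 0 :> R by rewrite pnatr_eq0 -lt0n fact_gt0.
pose a (m : nat) : R := (-1) ^+ m / k`!%:R.
have := odd_double_half k; case: (odd k); move: (k./2) => m; rewrite ?add1n ?add0n => kE.
  subst k.
  pose h j (t : T) := a m * (tnth t j * dtup t y ^+ m.*2.+1).
  have hb j : sphere_bounded (h j).
    by apply: sphere_boundedM => //; exact: sphere_bounded_cst.
  have E t : sph t -> (dot (row_of_tup t) y ^+ m.*2.+1 / (m.*2.+1)`!%:R) *:
      (vec (row_of_tup t) ^+ m.*2.+1 * u) = \sum_(j < q) h j t *: (para_e R (rshift p.+1 j) * u).
    move=> tS; rewrite dE vecq_pow_doubleSM tS expr1n mulr1.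
    rewrite scalerA /vecq mulr_suml scaler_sumr; apply: eq_bigr => j _.
    by rewrite -(scalerAl _ (para_e R (rshift p.+1 j)) u) scalerA mxE; congr (_ *: _); rewrite /h /a; ring.
  have [H1 H2] := sphere_mean_comb q0 hb
    (g := fun w => (dot w y ^+ m.*2.+1 / (m.*2.+1)`!%:R) *: (vec w ^+ m.*2.+1 * u)) E.
  split; [rewrite H1|exact: H2].
  have Eh j : sphere_avg (h j) = a m * ((m.*2.+1)`!%:R * gck_coef R q m.*2.+1 *
      (y ord0 j * enorm y ^+ m.*2)).
    by rewrite [LHS](sphere_avgZ q0 _ (dbound1 _ j)) -/(mom1 _ j) sphere_moment_odd.
  under eq_bigr => j _ do rewrite Eh.
  rewrite vecq_pow_doubleSM scalerA /vecq mulr_suml scaler_sumr.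
  apply: eq_bigr => j _; rewrite -(scalerAl _ (para_e R (rshift p.+1 j)) u) scalerA; congr (_ *: _).
  rewrite /a mul2n; field.
  exact: f0.
subst k.
pose h (j : 'I_1) (t : T) := a m * dtup t y ^+ m.*2.
have hb j : sphere_bounded (h j).
  by apply: sphere_boundedM => //; exact: sphere_bounded_cst.
have E t : sph t -> (dot (row_of_tup t) y ^+ m.*2 / (m.*2)`!%:R) *:
    (vec (row_of_tup t) ^+ m.*2 * u) = \sum_(j < 1) h j t *: u.
  move=> tS; rewrite dE vecq_pow_doubleM tS expr1n mulr1 big_ord1 scalerA.
  by congr (_ *: _); rewrite /h /a; ring.
have [H1 H2] := sphere_mean_comb q0 hb
  (g := fun w => (dot w y ^+ m.*2 / (m.*2)`!%:R) *: (vec w ^+ m.*2 * u)) E.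
split; [rewrite H1|exact: H2].
rewrite big_ord1 [sphere_avg _](sphere_avgZ q0 _ (dbound _)) -/(mom _) sphere_moment_even.
rewrite vecq_pow_doubleM scalerA; congr (_ *: _).
rewrite /a mul2n; field.
exact: f0.
Qed.

End sphere_mean_powers.

(** * The extensions as power sums *)

Section power_sums.
Variables (R : realType) (p q : nat).
Local Notation Cl := (clifford R (p + q)).
Local Notation Rp := 'rV[R]_p.+1.
Local Notation Rpq := 'rV[R]_(p.+1 + q).
Local Notation vec := (@vecq R p q).
Variables (Omega0 : set Rp) (f0 : Rp -> Cl).
Hypotheses (oO : open Omega0) (f0O : real_analytic_on Omega0 f0) (q0 : (0 < q)%N).
Local Notation Omega := (CK_domain Omega0 f0).

Lemma delta_lshift m n (i : 'I_m) :
  delta_mx ord0 (lshift n i) = row_mx (delta_mx ord0 i) 0 :> 'rV[R]_(m + n).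
Proof.
apply/rowP => j; rewrite !mxE eqxx/=; case: (fintype.splitP j) => k jk; rewrite !mxE ?eqxx/=.
  by congr (_%:R); rewrite -!val_eqE /= jk.
by rewrite -val_eqE /= jk gtn_eqF// ltn_addr.
Qed.

Lemma delta_rshift m n (i : 'I_n) :
  delta_mx ord0 (rshift m i) = row_mx 0 (delta_mx ord0 i) :> 'rV[R]_(m + n).
Proof.
apply/rowP => j; rewrite !mxE eqxx/=; case: (fintype.splitP j) => k jk; rewrite !mxE ?eqxx/=.
  by rewrite -val_eqE /= jk ltn_eqF// ltn_addr.
by congr (_%:R); rewrite -!val_eqE /= jk eqn_add2l.
Qed.

Lemma power_sum_monogenic (c : nat -> R) (F : Rpq -> Cl) :
  (forall k, `|c k| * k`!%:R <= 1) -> (forall k, c k.+1 * dirac_coef R q k.+1 = c k) ->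
  (forall x, Omega x -> F x = power_sum f0 c x) ->
  monogenic Omega F.
Proof.
move=> c1 ctau FS.
have idc : continuous (id : Rpq -> Rpq) by move=> x; exact: cvg_id.
have Pd i := @power_sum_pderive R p q Omega0 f0 oO f0O q0 Rpq id c F idc c1 FS i
  (row_mx (delta_mx ord0 i) 0) (fun h x => erefl).
have Qd j := @power_sum_qderive R p q Omega0 f0 oO f0O q0 Rpq id c F idc c1 FS
  (delta_mx ord0 j) (row_mx 0 (delta_mx ord0 j)) (fun h x => erefl).
split.
  move=> x Wx i; case: (fintype.splitP i) => k ik.
    have -> : i = lshift q k by exact/val_inj.
    by rewrite delta_lshift; have [] := Pd k x Wx.
  have -> : i = rshift p.+1 k by exact/val_inj.
  by rewrite delta_rshift; have [] := Qd k x Wx.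
move=> x Wx; rewrite /Dx big_split_ord/=.
have := @power_sum_dirac R p q Omega0 f0 q0 Rpq id c c1 'I_q (fun j => delta_mx ord0 j)
  (dirac_coef R q) x Wx _ ctau.
move=> H; rewrite -[RHS]H => [|k]; last first.
  by rewrite -sum_vecq_dpow; apply: eq_bigr => j _; rewrite vecq_delta.
congr (_ + _); apply: eq_bigr => i _.
  by rewrite delta_lshift; have [_ _ ->] := Pd i x Wx.
by rewrite delta_rshift vecq_delta; have [_ _ ->] := Qd i x Wx; rewrite vecq_delta.
Qed.

Lemma power_series_cvg (c : nat -> R) x : (forall k, `|c k| * k`!%:R <= 1) -> Omega x ->
  cvgn (series (power_term f0 c ^~ x)).
Proof. by move=> c1; exact: (@power_sum_cvg R p q Omega0 f0 q0 Rpq id c c1 x). Qed.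

Lemma power_termE_CK x k : Omega x -> CK_term f0 x k = power_term f0 (fun k => k`!%:R^-1) k x.
Proof.
move=> Wx; rewrite /CK_term /power_term (iter_vecq_Dxp oO f0O)//.
exact: CK_domain_sub Wx.
Qed.

Lemma fact_coef_le1 k : `|k`!%:R^-1 : R| * k`!%:R <= 1.
Proof.
by rewrite ger0_norm ?invr_ge0// mulVf// pnatr_eq0 -lt0n fact_gt0.
Qed.

Lemma CK_power_sum x : Omega x -> CK f0 x = power_sum f0 (fun k => k`!%:R^-1) x.
Proof.
move=> Wx; congr (limn (series _)); apply/funext => k; exact: power_termE_CK.
Qed.

Lemma CK_cvg x : Omega x -> cvgn (series (CK_term f0 x)).
Proof.
move=> Wx; rewrite (_ : CK_term f0 x = (power_term f0 (fun k => k`!%:R^-1))^~ x).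
  by apply: power_series_cvg => //; exact: fact_coef_le1.
by apply/funext => k; exact: power_termE_CK.
Qed.

Lemma CK_continuous x : Omega x -> {for x, continuous (CK f0)}.
Proof.
apply: (@power_sum_continuous R p q Omega0 f0 oO f0O q0 Rpq id (fun k => k`!%:R^-1)).
- by move=> y; exact: cvg_id.
- exact: fact_coef_le1.
- by move=> y; exact: CK_power_sum.
Qed.

Lemma cl_dpow_line (b : Cl) s k :
  cl_dpow b (s *: b) k.+1 = k.+1%:R *: (b * (s *: b) ^+ k).
Proof.
elim: k => [|k IH]; first by rewrite /= mulr0 addr0 expr0 scale1r.
rewrite [LHS]/= -/(cl_dpow b (s *: b) k.+1) IH -scalerAr.
have -> : s *: b * (b * (s *: b) ^+ k) = b * (s *: b) ^+ k.+1.
  by rewrite exprS !mulrA -scalerAl -scalerAr.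
by rewrite -{1}[b * _]scale1r -scalerDl; congr (_ *: _); rewrite [RHS]mulrS.
Qed.

Lemma CK_GSM : GSM Omega (CK f0).
Proof.
move=> w w1; pose c k : R := k`!%:R^-1; pose F := CK f0 \o slice_pt w.
have FS y : Omega (slice_pt w y) -> F y = power_sum f0 c (slice_pt w y).
  by move=> Wy; exact: CK_power_sum.
have Pv i (h : R) x : slice_pt w (h *: delta_mx ord0 (lshift 1 i) + x) =
    h *: row_mx (delta_mx ord0 i) 0 + slice_pt w x :> Rpq.
  rewrite /slice_pt delta_lshift !linearP/= row_mxKl row_mxKr scale_row_mx add_row_mx.
  by rewrite !scaler0 !add0r.
have Qv (h : R) x : slice_pt w (h *: delta_mx ord0 (rshift p.+1 ord0) + x) =
    h *: row_mx 0 w + slice_pt w x :> Rpq.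
  rewrite /slice_pt delta_rshift !linearP/= row_mxKl row_mxKr scale_row_mx add_row_mx.
  by rewrite !scaler0 !add0r !mxE eqxx mulr1 scalerDl.
have Pd i := @power_sum_pderive R p q Omega0 f0 oO f0O q0 _ (slice_pt w) c F
  (@slice_pt_continuous R p q w) fact_coef_le1 FS i _ (Pv i).
have Qd := @power_sum_qderive R p q Omega0 f0 oO f0O q0 _ (slice_pt w) c F
  (@slice_pt_continuous R p q w) fact_coef_le1 FS w _ Qv.
split.
  move=> y Wy i; case: (fintype.splitP i) => k ik.
    have -> : i = lshift 1 k by exact/val_inj.
    by have [] := Pd k y Wy.
  have -> : i = rshift p.+1 ord0 by apply/val_inj; rewrite (ord1 k) in ik; exact: ik.
  by have [] := Qd y Wy.
move=> y Wy.
(* On a slice x_q = r w: the family of directions is [w] alone and tau_k = k, which fits the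
   coefficients 1 / k!. *)
have := @power_sum_dirac R p q Omega0 f0 q0 _ (slice_pt w) c fact_coef_le1 'I_1
  (fun=> w) (fun k => k%:R) y Wy.
move=> H; rewrite -[RHS]H => [|k|k].
- congr (_ + _); first by apply: eq_bigr => i _; have [_ _ ->] := Pd i y Wy.
  by rewrite big_ord1; have [_ _ ->] := Qd y Wy.
- rewrite big_ord1 row_mxKr vecqZ cl_dpow_line -scalerAr mulrA vecq_sqr.
  have -> : dot w w = 1 by have := enorm_sqr w; rewrite w1 expr1n /dot => ->.
  by rewrite scaleN1r mulN1r scalerN scaleNr.
- by rewrite /c factS natrM invfM mulrAC mulVf ?mul1r// pnatr_eq0.
Qed.

Lemma series_double (u : nat -> Cl) : (forall k, odd k -> u k = 0) ->
  series (fun m => u m.*2) = series u \o double.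
Proof.
move=> u0; apply/funext => m; elim: m => [|m IH]; first by rewrite /= !seriesEord/= !big_ord0.
rewrite /= doubleS !seriesSr -/(series u m.*2) IH/= [u m.*2.+1]u0 ?addr0//.
by rewrite /= odd_double.
Qed.

Lemma series_double_cvg (u : nat -> Cl) : (forall k, odd k -> u k = 0) ->
  cvgn (series u) -> series (fun m => u m.*2) @ \oo --> limn (series u).
Proof.
move=> u0 ucvg; rewrite series_double//.
have dbl : double @ \oo --> \oo.
  move=> P [N _ NP]; exists N => // m /= Nm; apply: NP => /=.
  by rewrite -addnn (leq_trans Nm)// leq_addr.
by apply: cvg_comp; [exact: dbl|exact: ucvg].
Qed.

(** The sign and the power of [r] are x_q^(2m), and the iterated Laplacian is U_(2m). *)
Lemma gck_even_termE (z : 'rV[R]_q) y m : Omega0 y ->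
  GCK_even_term f0 (enorm z) y m = power_term f0 (gck_even R q) m.*2 (row_mx y z).
Proof.
move=> Oy; rewrite /GCK_even_term /power_term (iter_laplacian oO f0O)// row_mxKl row_mxKr.
rewrite vecq_pow_doubleM scalerA /gck_even odd_double.
congr (_ *: _); rewrite /gck_coef doubleK uphalf_double -(mul2n m).
rewrite -[in RHS]mulrA; ring.
Qed.

Lemma gck_odd_termE (z : 'rV[R]_q) y m : Omega0 y ->
  GCK_odd_term f0 (enorm z) y m = power_term f0 (gck_odd R q) m.*2 (row_mx y z).
Proof.
move=> Oy; rewrite /GCK_odd_term /power_term (iter_laplacian oO f0O)// row_mxKl row_mxKr.
rewrite vecq_pow_doubleM scalerA /gck_odd odd_double.
congr (_ *: _); rewrite /gck_coef -uphalfE uphalf_double.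
have -> : uphalf m.*2.+1 = m.+1 by rewrite uphalfE -doubleS doubleK.
have -> : m.+1%:R + q%:R / 2 = m%:R + q%:R / 2 + 1 :> R by rewrite -natr1; ring.
rewrite addn1 -(mul2n m); ring.
Qed.

Lemma power_term_odd0 (c : nat -> R) x k : c k = 0 -> power_term f0 c k x = 0.
Proof. by rewrite /power_term => ->; rewrite scale0r. Qed.

Lemma gck_even_cvg x : Omega x ->
  series (GCK_even_term f0 (enorm (rsubmx x)) (lsubmx x)) @ \oo -->
    power_sum f0 (gck_even R q) x.
Proof.
move=> Wx.
rewrite (_ : GCK_even_term _ _ _ = fun m => power_term f0 (gck_even R q) m.*2 x).
  apply: series_double_cvg.
    by move=> k ok; apply: power_term_odd0; rewrite /gck_even ok.
  by apply: power_series_cvg => //; exact: gck_even_le1.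
apply/funext => m; rewrite gck_even_termE ?hsubmxK//; exact: CK_domain_sub Wx.
Qed.

Lemma gck_odd_cvg (z : 'rV[R]_q) y : Omega (row_mx y z) ->
  series (GCK_odd_term f0 (enorm z) y) @ \oo --> power_sum f0 (gck_odd R q) (row_mx y z).
Proof.
move=> Wx.
rewrite (_ : GCK_odd_term _ _ _ = fun m => power_term f0 (gck_odd R q) m.*2 (row_mx y z)).
  apply: series_double_cvg.
    by move=> k ok; apply: power_term_odd0; rewrite /gck_odd ok.
  by apply: power_series_cvg => //; exact: gck_odd_le1.
apply/funext => m; rewrite gck_odd_termE//.
by have := CK_domain_sub Wx; rewrite row_mxKl.
Qed.

Section odd_part.
Variable z : 'rV[R]_q.
Let Phi (y : Rp) : Rpq := row_mx y z.
Let G (y : Rp) : Cl := limn (series (GCK_odd_term f0 (enorm z) y)).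

Let Phi_cont : continuous Phi.
Proof.
apply: (lipschitz_continuous (C := 1)) => x y; rewrite mul1r opp_row_mx add_row_mx subrr.
by apply: le_trans (row_mx_norm _ _) _; rewrite normr0 addr0.
Qed.

Let GS y : Omega (Phi y) -> G y = power_sum f0 (gck_odd R q) (Phi y).
Proof. by move=> Wy; apply: cvg_lim; [exact: norm_hausdorff|exact: gck_odd_cvg]. Qed.

Let PhiD i (h : R) y : Phi (h *: delta_mx ord0 i + y) = h *: row_mx (delta_mx ord0 i) 0 + Phi y.
Proof. by rewrite /Phi scale_row_mx add_row_mx scaler0 add0r. Qed.

Lemma gck_odd_near y : Omega (Phi y) ->
  \forall y' \near y, cvgn (series (GCK_odd_term f0 (enorm z) y')).
Proof.
move=> Wy; have : nbhs y (Phi @^-1` Omega).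
  apply: open_nbhs_nbhs; split => //.
  by apply: open_comp (@CK_domain_open R p q Omega0 f0) => x _; exact: Phi_cont.
by apply: filterS => y' Wy'; apply: cvgP (gck_odd_cvg Wy').
Qed.

Lemma gck_odd_derivable i y : Omega (Phi y) -> derivable G y (delta_mx ord0 i).
Proof.
move=> Wy; have [//] := @power_sum_pderive R p q Omega0 f0 oO f0O q0 Rp Phi _ G Phi_cont
  (gck_odd_le1 R q0) GS i _ (PhiD i) y Wy.
Qed.

(** Moving e_i past z^k turns the derivatives of U_k into U_(k+1), and the outer factor raises the
    power of [z]. *)
Lemma gck_odd_Dxp y : Omega (Phi y) ->
  series (fun k => gck_odd R q k *: (vec z ^+ k.+1 * alt_dirac f0 k.+1 y)) @ \oo -->
    vec z * Dxp G y.
Proof.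
move=> Wy.
pose u i := power_dterm f0 (gck_odd R q) i ^~ (Phi y).
have ucvg i : cvgn (series (u i)).
  exact: (@power_sum_dterm_cvg R p q Omega0 f0 q0 Rp Phi (gck_odd R q)
    (gck_odd_le1 R q0) i y Wy).
have E : Dxp G y = \sum_(i < p.+1) para_e R (lshift q i) * limn (series (u i)).
  apply: eq_bigr => i _.
  by have [_ _ ->] := @power_sum_pderive R p q Omega0 f0 oO f0O q0 Rp Phi _ G Phi_cont
    (gck_odd_le1 R q0) GS i _ (PhiD i) y Wy.
have H := @cl_series_sum_cvg R _ _ (index_enum 'I_p.+1) (fun i => para_e R (lshift q i)) _ ucvg.
have H' : (fun N => vec z * series (fun k => \sum_(i < p.+1) para_e R (lshift q i) * u i k) N)
    @ \oo --> vec z * Dxp G y.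
  by rewrite E; apply: cl_cvgM; [exact: cvg_cst|exact: H].
rewrite (_ : series _ = fun N => vec z * series (fun k => \sum_(i < p.+1) para_e R (lshift q i) * u i k) N).
  exact: H'.
apply/funext => N; rewrite /series/= mulr_sumr; apply: eq_bigr => k _.
rewrite mulr_sumr mulr_sumr scaler_sumr; apply: eq_bigr => i _.
rewrite /u /power_dterm /Phi row_mxKl row_mxKr -!scalerAr; congr (_ *: _).
by rewrite [in RHS](mulrA (para_e R _)) para_e_pow exprS !mulrA.
Qed.

End odd_part.

Lemma GCK_power_sum x : Omega x -> GCK f0 x = power_sum f0 (gck_coef R q) x.
Proof.
move=> Wx; have Wx' : Omega (row_mx (lsubmx x) (rsubmx x)) by rewrite hsubmxK.
have HA := gck_even_cvg Wx.
have -> : GCK f0 x = power_sum f0 (gck_even R q) x +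
   vec (rsubmx x) * Dxp (fun y => limn (series (GCK_odd_term f0 (enorm (rsubmx x)) y))) (lsubmx x).
  by congr (_ + _); apply: cvg_lim; [exact: norm_hausdorff|exact: HA].
have HB := gck_odd_Dxp Wx'.
set B := vec _ * _ in HB *; set A := power_sum f0 (gck_even R q) x.
(* The even partial sum up to [N.+1] and the odd one up to [N] add up to the merged partial sum up
   to [N.+1]; at each index exactly one of the two coefficients survives. *)
have HA1 : (fun N => series (power_term f0 (gck_even R q) ^~ x) N.+1) @ \oo --> A.
  rewrite (@cvg_shiftS _ (series (power_term f0 (gck_even R q) ^~ x))).
  by apply: power_series_cvg => //; exact: gck_even_le1.
have HC1 : (fun N => series (power_term f0 (gck_coef R q) ^~ x) N.+1) @ \oo -->
    power_sum f0 (gck_coef R q) x.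
  rewrite (@cvg_shiftS _ (series (power_term f0 (gck_coef R q) ^~ x))).
  by apply: power_series_cvg => //; exact: gck_coef_le1.
have HAB : (fun N => series (power_term f0 (gck_even R q) ^~ x) N.+1 +
    series (fun k => gck_odd R q k *: (vec (rsubmx x) ^+ k.+1 * alt_dirac f0 k.+1 (lsubmx x))) N)
    @ \oo --> A + B by exact: (cvgD HA1 HB).
suff E : (fun N => series (power_term f0 (gck_even R q) ^~ x) N.+1 +
    series (fun k => gck_odd R q k *: (vec (rsubmx x) ^+ k.+1 * alt_dirac f0 k.+1 (lsubmx x))) N) =
    (fun N => series (power_term f0 (gck_coef R q) ^~ x) N.+1).
  by rewrite E in HAB; exact: (cvg_unique (@norm_hausdorff _ _) HAB HC1).
apply/funext => N.
rewrite /series /= !big_nat_recl//= -addrA; congr (_ + _).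
rewrite -big_split; apply: eq_bigr => k _ /=.
rewrite /power_term -scalerDl; congr (_ *: _).
rewrite /gck_even /gck_odd /=; case: (odd k) => /=; first by rewrite addr0.
by rewrite add0r.
Qed.

Lemma GCK_is_defined : GCK_defined Omega f0.
Proof.
move=> x Wx; have Wx' : Omega (row_mx (lsubmx x) (rsubmx x)) by rewrite hsubmxK.
split.
- exact: cvgP (gck_even_cvg Wx).
- exact: gck_odd_near.
- by move=> i; exact: gck_odd_derivable.
Qed.

Lemma GCK_extension : generalized_CK_extension Omega0 Omega f0 (GCK f0).
Proof.
exists (fun k y => gck_coef R q k *: alt_dirac f0 k y); split.
- by apply/funext => y; rewrite gck_coef0// scale1r.
- move=> k; rewrite (_ : (fun y => _) = fun y => (gck_coef R q k *: 1) * alt_dirac f0 k y).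
    by apply: analytic_Ml; exact: (alt_dirac_analytic oO f0O k).
  by apply/funext => y; rewrite -scalerAl mul1r.
- move=> x Wx; rewrite GCK_power_sum//.
  rewrite (_ : (fun k => _) = power_term f0 (gck_coef R q) ^~ x).
    by apply: power_series_cvg => //; exact: gck_coef_le1.
  by apply/funext => k; rewrite /power_term scalerAr.
- apply: (power_sum_monogenic (gck_coef_le1 R q0) (gck_coefS R q0)).
  exact: GCK_power_sum.
Qed.

(** It is stated for any [g] equal to [GCK f0] on the domain, so that it applies to the dual Radon
    transform. *)
Lemma GCK_AM (g : Rpq -> Cl) : (forall x, Omega x -> g x = GCK f0 x) -> AM Omega g.
Proof.
move=> gG; split.
  apply: (power_sum_monogenic (gck_coef_le1 R q0) (gck_coefS R q0)).
  by move=> x Wx; rewrite gG// GCK_power_sum.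
have evenE (r r' : R) y : r ^+ 2 = r' ^+ 2 ->
    GCK_even_term f0 r y = GCK_even_term f0 r' y.
  by move=> rr; apply/funext => k; rewrite /GCK_even_term !exprM rr.
have oddE (r r' : R) : r ^+ 2 = r' ^+ 2 ->
    GCK_odd_term f0 r = GCK_odd_term f0 r'.
  by move=> rr; apply/funext => y; apply/funext => k; rewrite /GCK_odd_term !exprM rr.
exists (fun a r => limn (series (GCK_even_term f0 r a))),
  (fun a r => r *: Dxp (fun y => limn (series (GCK_odd_term f0 r y))) a); split.
- by move=> a r; rewrite (evenE (- r) r)// sqrrN.
- by move=> a r; rewrite (oddE (- r) r) ?sqrrN// scaleNr.
- move=> a r w w1 Wx; rewrite gG// /GCK row_mxKl row_mxKr.
  (* The norm is |r|, while [r] may be negative; both series depend on its square only. *)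
  have rr : enorm (r *: w) ^+ 2 = r ^+ 2 by rewrite enormZ w1 mulr1 real_normK// num_real.
  by rewrite (evenE _ _ a rr) (oddE _ _ rr) vecqZ -scalerAl -scalerAr.
Qed.

Lemma CK_dir_termE eta x k : Omega x ->
  CK_dir_term f0 eta x k =
    (dot eta (rsubmx x) ^+ k / k`!%:R) *: (vec eta ^+ k * alt_dirac f0 k (lsubmx x)).
Proof.
by move=> Wx; rewrite /CK_dir_term (iter_vecq_Dxp oO f0O)//; exact: CK_domain_sub Wx.
Qed.

(** At the Radon point x_q becomes <x_q, eta> eta, and the power of the scalar factors out of its
    [k]-th power. *)
Lemma CK_dir_term_radon eta x : Omega x -> usphere eta ->
  CK_dir_term f0 eta x = CK_term f0 (radon_pt eta x).
Proof.
move=> Wx e1; apply/funext => k; rewrite CK_dir_termE//.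
rewrite power_termE_CK; last exact: CK_domain_radon.
rewrite /power_term row_mxKl row_mxKr vecqZ exprZn -scalerAl scalerA dotC.
by congr (_ *: _); rewrite mulrC.
Qed.

(** All Radon points of [x] lie in one tube containing [x], so the bound is uniform in [eta]. *)
Lemma CK_dir_term_norm x : Omega x -> exists C : R, forall k eta, usphere eta ->
  `|CK_dir_term f0 eta x k| <= C * 2^-1 ^+ k.
Proof.
move=> Wx; have [a [rho [d [C [K [good [xa xd]]]]]]] := Wx.
exists (cl_kappa R (p + q) * C) => k eta e1.
rewrite CK_dir_term_radon// power_termE_CK; last exact: CK_domain_radon.
apply: (@power_term_norm R p q Omega0 f0 q0 Rpq id _ fact_coef_le1 _ _ _ _ _ good).
split; first by rewrite row_mxKl.
rewrite row_mxKr enormZ e1 mulr1; apply: le_lt_trans xd; exact: dot_le_enorm.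
Qed.

Lemma CK_dir_mean x : Omega x -> GCK f0 x = sphere_mean (fun eta => CK_dir f0 eta x).
Proof.
move=> Wx; have [C gC] := CK_dir_term_norm Wx.
pose g k eta := CK_dir_term f0 eta x k.
have mg k : sphere_mean (g k) = power_term f0 (gck_coef R q) k x /\
    forall A, sphere_bounded (fun t => cl_coef (g k (row_of_tup t)) A).
  rewrite (_ : g k = fun w => (dot w (rsubmx x) ^+ k / k`!%:R) *:
     (vec w ^+ k * alt_dirac f0 k (lsubmx x))).
    exact: (sphere_mean_power q0).
  by apply/funext => w; rewrite /g CK_dir_termE.
have H : series (fun k => sphere_mean (g k)) @ \oo --> sphere_mean (fun eta => CK_dir f0 eta x).
  apply: (sphere_mean_series q0 (C := C)).
  - by move=> k; have [] := mg k.
  - by move=> k w w1; exact: gC.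
  - by [].
have H' : series (power_term f0 (gck_coef R q) ^~ x) @ \oo --> GCK f0 x.
  rewrite (GCK_power_sum Wx).
  by apply: power_series_cvg => //; exact: gck_coef_le1.
have E : (fun k => sphere_mean (g k)) = power_term f0 (gck_coef R q) ^~ x.
  by apply/funext => k; have [-> _] := mg k.
rewrite E in H; exact: (cvg_unique (@norm_hausdorff _ _) H' H).
Qed.

Lemma CK_dir_radon x : Omega x ->
  sphere_mean (fun eta => CK_dir f0 eta x) = dual_radon (CK f0) x.
Proof.
move=> Wx; apply: sphere_mean_eq => eta e1.
by rewrite /CK_dir CK_dir_term_radon.
Qed.

End power_sums.

Theorem theorem5p4 (R : realType) (p q : nat) (hq : (1 <= q)%N)
    (Omega0 : set 'rV[R]_p.+1) (hOmega0 : domain Omega0)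
    (f0 : 'rV[R]_p.+1 -> clifford R (p + q))
    (hf0 : real_analytic_on Omega0 f0) :
  exists Omega : set 'rV[R]_(p.+1 + q),
    [/\ slice_domain Omega, p_symmetric Omega, Omega `<=` cylinder q Omega0 &
        forall a, Omega0 a -> Omega (row_mx a 0)] /\
    [/\ forall x, Omega x -> cvgn (series (CK_term f0 x)),
        forall x eta, Omega x -> usphere eta ->
          cvgn (series (CK_dir_term f0 eta x)),
        GCK_defined Omega f0,
        generalized_CK_extension Omega0 Omega f0 (GCK f0) &
        (forall x eta, Omega x -> usphere eta -> Omega (radon_pt eta x)) /\
        (forall x, Omega x -> {for x, continuous (CK f0)})] /\
    (forall x, Omega x ->
       GCK f0 x = sphere_mean (fun eta => CK_dir f0 eta x) /\
       sphere_mean (fun eta => CK_dir f0 eta x) = dual_radon (CK f0) x) /\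
    GSM Omega (CK f0) /\ AM Omega (dual_radon (CK f0)).
Proof.
have [oO _ _] := hOmega0; exists (CK_domain Omega0 f0).
split; first split.
- exact: CK_domain_slice_domain.
- exact: CK_domain_p_symmetric.
- by move=> x; exact: CK_domain_sub.
- exact: CK_domain0.
split; first split.
- by move=> x; exact: CK_cvg.
- move=> x eta Wx e1; rewrite (CK_dir_term_radon oO hf0 Wx e1).
  by apply: (CK_cvg oO hf0 hq); exact: CK_domain_radon.
- exact: GCK_is_defined.
- exact: GCK_extension.
- split; first by move=> x eta; exact: CK_domain_radon.
  by move=> x; exact: CK_continuous.
have mean x : CK_domain Omega0 f0 x ->
    GCK f0 x = sphere_mean (fun eta => CK_dir f0 eta x) /\
    sphere_mean (fun eta => CK_dir f0 eta x) = dual_radon (CK f0) x.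
  by move=> Wx; split; [exact: (CK_dir_mean oO hf0 hq)|exact: (CK_dir_radon oO hf0)].
split; first exact: mean.
split; first exact: CK_GSM.
by apply: (GCK_AM oO hf0 hq) => x Wx; have [-> ->] := mean x Wx.
Qed.
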